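(* Consider the modal logic separation problem: given finite sets $\mathit{P}$ and $\mathit{N}$ of finite pointed Kripke structures over a finite set of propositions $\Sigma$, and a regular tree grammar $\mathcal{G}$ over syntax trees of modal formulas, synthesize a modal formula $\varphi\in L(\mathcal{G})$ such that $G\models\varphi$ for all $G\in\mathit{P}$ and $G\not\models\varphi$ for all $G\in\mathit{N}$, or declare that none exists. This problem is decidable in time $\mathcal{O}(2^{\mathrm{poly}(mn)}\cdot|\mathcal{G}|)$, where $n=\max_{G\in\mathit{P}\cup\mathit{N}}|G|$ and $m=|\mathit{P}|+|\mathit{N}|$.
   Context: Modal formulas over $\Sigma$: $\varphi::=a\in\Sigma\mid\varphi\wedge\varphi'\mid\varphi\vee\varphi'\mid\neg\varphi\mid\Box\varphi\mid\Diamond\varphi$, represented as syntax trees over the ranked alphabet with propositions nullary, $\neg,\Box,\Diamond$ unary, $\wedge,\vee$ binary. A finite pointed Kripke structure is $G=(W,s,E,P)$ with finite set of nodes $W$, start node $s\in W$, edge relation $E\subseteq W\times W$, and labeling $P:W\to\mathcal{P}(\Sigma)$. Semantics: $G,w\models a$ iff $a\in P(w)$; Boolean connectives as usual; $G,w\models\Box\varphi$ iff $G,w'\models\varphi$ for all $w'$ with $E(w,w')$; $G,w\models\Diamond\varphi$ iff $G,w'\models\varphi$ for some $w'$ with $E(w,w')$. $G\models\varphi$ iff $G,s\models\varphi$. A regular tree grammar $\mathcal{G}$ generates a set $L(\mathcal{G})$ of syntax trees; $|\mathcal{G}|$ is its size; $|G|$ is the size of the Kripke structure. *)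

(* Defs.v *)
From HB Require Import structures.
From mathcomp Require Import all_boot all_algebra.
From Stdlib Require Import Relation_Operators.
From Stdlib Require List.

Set Implicit Arguments.
Unset Strict Implicit.
Unset Printing Implicit Defensive.

(* Formulas and Kripke structures *)

Inductive form (Sigma : Type) : Type :=
| FAtom of Sigma
| FAnd of form Sigma & form Sigma
| FOr of form Sigma & form Sigma
| FNot of form Sigma
| FBox of form Sigma
| FDia of form Sigma.

Record kripke (Sigma : finType) := Kripke {
  knode : finType;
  kstart : knode;
  kedge : rel knode;
  klabel : knode -> {set Sigma} }.

Fixpoint sat (Sigma : finType) (K : kripke Sigma) (w : knode K)
    (phi : form Sigma) : bool :=
  match phi with
  | FAtom a => a \in klabel w
  | FAnd f g => sat w f && sat w g
  | FOr f g => sat w f || sat w g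
  | FNot f => ~~ sat w f
  | FBox f => [forall v : knode K, kedge w v ==> sat v f]
  | FDia f => [exists v : knode K, kedge w v && sat v f]
  end.

Definition models (Sigma : finType) (K : kripke Sigma) (phi : form Sigma) :=
  sat (kstart K) phi.

(* The number of nodes, which is the least of the usual size measures. *)
Definition ksize (Sigma : finType) (K : kripke Sigma) : nat := #|knode K|.

(* Regular tree grammars: a right-hand side is an arbitrary syntax tree with
   nonterminals allowed as additional leaves. *)

Inductive term (Sigma NT : Type) : Type :=
| TNonterm of NT
| TAtom of Sigma
| TAnd of term Sigma NT & term Sigma NT
| TOr of term Sigma NT & term Sigma NT
| TNot of term Sigma NT
| TBox of term Sigma NT
| TDia of term Sigma NT.
Arguments TNonterm {Sigma NT}.
Arguments TAtom {Sigma NT}.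

Record rtg (Sigma : finType) := Rtg {
  nonterm : finType;
  start_nonterm : nonterm;
  rules : seq (nonterm * term Sigma nonterm) }.

Fixpoint term_size (Sigma NT : Type) (t : term Sigma NT) : nat :=
  match t with
  | TNonterm _ | TAtom _ => 1
  | TAnd u v | TOr u v => (term_size u + term_size v).+1
  | TNot u | TBox u | TDia u => (term_size u).+1
  end.

Definition rtg_size (Sigma : finType) (G : rtg Sigma) : nat :=
  #|nonterm G| + \sum_(r <- rules G) (term_size r.2).+1.

(* [rules G] is only a sequence over a type without decidable equality, hence
   [List.In] rather than [\in]. *)
Inductive rewrites (Sigma : finType) (G : rtg Sigma) :
    term Sigma (nonterm G) -> term Sigma (nonterm G) -> Prop :=
| RwRule A t : List.In (A, t) (rules G) -> rewrites (TNonterm A) t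
| RwAndL t t' u : rewrites t t' -> rewrites (TAnd t u) (TAnd t' u)
| RwAndR t u u' : rewrites u u' -> rewrites (TAnd t u) (TAnd t u')
| RwOrL t t' u : rewrites t t' -> rewrites (TOr t u) (TOr t' u)
| RwOrR t u u' : rewrites u u' -> rewrites (TOr t u) (TOr t u')
| RwNot t t' : rewrites t t' -> rewrites (TNot t) (TNot t')
| RwBox t t' : rewrites t t' -> rewrites (TBox t) (TBox t')
| RwDia t t' : rewrites t t' -> rewrites (TDia t) (TDia t').

Fixpoint term_of_form (Sigma NT : Type) (phi : form Sigma) : term Sigma NT :=
  match phi with
  | FAtom a => TAtom a
  | FAnd f g => TAnd (term_of_form NT f) (term_of_form NT g)
  | FOr f g => TOr (term_of_form NT f) (term_of_form NT g)
  | FNot f => TNot (term_of_form NT f)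
  | FBox f => TBox (term_of_form NT f)
  | FDia f => TDia (term_of_form NT f)
  end.

Definition language (Sigma : finType) (G : rtg Sigma) (phi : form Sigma) :=
  clos_refl_trans _ (@rewrites Sigma G) (TNonterm (start_nonterm G))
    (term_of_form (nonterm G) phi).

(* The separation problem *)

Definition separates (Sigma : finType) (Pos Neg : seq (kripke Sigma))
    (G : rtg Sigma) (phi : form Sigma) : Prop :=
  [/\ language G phi,
      forall K, List.In K Pos -> models K phi
    & forall K, List.In K Neg -> ~~ models K phi].

(* Synthesized formulas are written with shared subterms: a dag is a sequence
   of nodes whose arguments are positions of earlier nodes, and it denotes the
   formula at its last node.  Sharing cannot be avoided: the rules
   A_i -> A_(i+1) /\ A_(i+1) (i < k) and A_k -> a generate a single formula,
   whose tree has size exponential in that of the grammar. *)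

Inductive dag_node (Sigma : Type) : Type :=
| DAtom of Sigma
| DAnd of nat & nat
| DOr of nat & nat
| DNot of nat
| DBox of nat
| DDia of nat.

Definition node_form (Sigma : Type) (fs : seq (form Sigma))
    (x : dag_node Sigma) : option (form Sigma) :=
  let un op i := omap op (onth fs i) in
  let bin op i j := obind (fun f => omap (op f) (onth fs j)) (onth fs i) in
  match x with
  | DAtom a => Some (FAtom a)
  | DAnd i j => bin (@FAnd Sigma) i j
  | DOr i j => bin (@FOr Sigma) i j
  | DNot i => un (@FNot Sigma) i
  | DBox i => un (@FBox Sigma) i
  | DDia i => un (@FDia Sigma) i
  end.

Fixpoint dag_forms_from (Sigma : Type) (fs : seq (form Sigma))
    (d : seq (dag_node Sigma)) : option (seq (form Sigma)) :=
  if d is x :: d' then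
    if node_form fs x is Some f then dag_forms_from (rcons fs f) d' else None
  else Some fs.

Definition dag_form (Sigma : Type) (d : seq (dag_node Sigma)) :
    option (form Sigma) :=
  obind (fun fs => ohead (rev fs)) (dag_forms_from [::] d).

(* [None] declares that there is no separating formula. *)
Definition answer (Sigma : Type) : Type := option (seq (dag_node Sigma)).

Definition correct_answer (Sigma : finType) (Pos Neg : seq (kripke Sigma))
    (G : rtg Sigma) (r : answer Sigma) : Prop :=
  match r with
  | Some d => exists2 phi, dag_form d = Some phi & separates Pos Neg G phi
  | None => forall phi, ~ separates Pos Neg G phi
  end.

(* Encoding of instances and answers as sequences of naturals, one small
   number per cell: elements of finite types are given by their rank in the
   enumeration, relations by their 0/1 matrices (in row-major order), and
   terms in prefix notation. *)

Definition enc_kripke (Sigma : finType) (K : kripke Sigma) : seq nat :=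
  [:: #|knode K|; nat_of_ord (enum_rank (kstart K))]
  ++ [seq nat_of_bool (kedge u v) | u <- enum (knode K), v <- enum (knode K)]
  ++ [seq nat_of_bool (a \in klabel u) | u <- enum (knode K), a <- enum Sigma].

Fixpoint enc_term (Sigma NT : finType) (t : term Sigma NT) : seq nat :=
  match t with
  | TAtom a => [:: 0; nat_of_ord (enum_rank a)]
  | TAnd u v => 1 :: enc_term u ++ enc_term v
  | TOr u v => 2 :: enc_term u ++ enc_term v
  | TNot u => 3 :: enc_term u
  | TBox u => 4 :: enc_term u
  | TDia u => 5 :: enc_term u
  | TNonterm A => [:: 6; nat_of_ord (enum_rank A)]
  end.

Definition enc_rtg (Sigma : finType) (G : rtg Sigma) : seq nat :=
  [:: #|nonterm G|; nat_of_ord (enum_rank (start_nonterm G)); size (rules G)]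
  ++ flatten [seq nat_of_ord (enum_rank r.1) :: enc_term r.2 | r <- rules G].

Definition enc_instance (Sigma : finType) (Pos Neg : seq (kripke Sigma))
    (G : rtg Sigma) : seq nat :=
  [:: #|Sigma|; size Pos; size Neg]
  ++ flatten [seq enc_kripke K | K <- Pos ++ Neg] ++ enc_rtg G.

Definition enc_node (Sigma : finType) (x : dag_node Sigma) : seq nat :=
  match x with
  | DAtom a => [:: 0; nat_of_ord (enum_rank a)]
  | DAnd i j => [:: 1; i; j]
  | DOr i j => [:: 2; i; j]
  | DNot i => [:: 3; i]
  | DBox i => [:: 4; i]
  | DDia i => [:: 5; i]
  end.

Definition enc_answer (Sigma : finType) (r : answer Sigma) : seq nat :=
  if r is Some d then 1 :: flatten [seq enc_node x | x <- d] else [:: 0].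

(* Random access machines: finitely many registers (those occurring in the
   program) and an unbounded memory, with unit-cost instructions.  There is
   no multiplication, so the model is polynomially equivalent to Turing
   machines. *)

Inductive instr : Type :=
| IConst (r k : nat)     (* r := k *)
| IAdd (r a b : nat)     (* r := a + b *)
| ISub (r a b : nat)     (* r := a - b, truncated at 0 *)
| ILoad (r a : nat)      (* r := memory[a] *)
| IStore (a b : nat)     (* memory[a] := b *)
| IJz (r l : nat).       (* if r = 0 then go to l *)

Record config := Config {
  pc : nat;
  reg : nat -> nat;
  memory : nat -> nat }.

Definition update (f : nat -> nat) (i x : nat) : nat -> nat :=
  fun j => if j == i then x else f j.

Definition exec (i : instr) (c : config) : config :=
  let: Config pc reg mm := c in
  match i with
  | IConst r k => Config pc.+1 (update reg r k) mm
  | IAdd r a b => Config pc.+1 (update reg r (reg a + reg b)) mm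
  | ISub r a b => Config pc.+1 (update reg r (reg a - reg b)) mm
  | ILoad r a => Config pc.+1 (update reg r (mm (reg a))) mm
  | IStore a b => Config pc.+1 reg (update mm (reg a) (reg b))
  | IJz r l => Config (if reg r == 0 then l else pc.+1) reg mm
  end.

(* The machine halts when the program counter leaves the program. *)
Definition halted (prog : seq instr) (c : config) : bool :=
  size prog <= pc c.

Definition step (prog : seq instr) (c : config) : config :=
  if onth prog (pc c) is Some i then exec i c else c.

(* The input occupies the first memory cells, and register 0 contains its
   length. All other cells and registers are 0. *)
Definition init (input : seq nat) : config :=
  Config 0 (update (fun=> 0) 0 (size input)) (nth 0 input).

(* Registers 0 and 1 contain the address and the length of the output. *)
Definition output (c : config) : seq nat :=
  mkseq (fun i => memory c (reg c 0 + i)) (reg c 1).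

Definition outputs_within (prog : seq instr) (x y : seq nat) (T : nat) : Prop :=
  exists t, let c := iter t (step prog) (init x) in
    [/\ t <= T, halted prog c & output c = y].

(* Main.v *)
(* The set of nodes, over all input structures, at which a formula holds is
   computed from those of its immediate subformulas, so a formula matters only
   through one of the 2^N such sets, N <= m n.  Worklist saturation finds all
   facts (p, S): the right-hand-side subterm at input position p derives a formula
   with set S.  A fact about a right-hand side is forwarded along the linked list
   of the occurrences of its nonterminal, every fact about a subterm goes to its
   parent, where it is combined with the 2^N possible facts of the sibling; hence
   each of the O(2^N |G|) facts costs 2^O(N), linearly in |G|.  The first time a
   fact appears, a dag node for a witness is written to the output.  The
   algorithm is a program of a small loop language, compiled to the RAM. *)

From mathcomp Require Import all_boot all_algebra zify.
From Stdlib Require Import Relation_Operators.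
Require Import Defs.

Set Implicit Arguments.
Unset Strict Implicit.
Unset Printing Implicit Defensive.

Arguments update : simpl never.

(** * Loop programs and their compilation *)

(** The bound must not depend on [#|Sigma|], although the length of the encoded labels does: label
    rows are skipped by adding their length to an address, and labels are read only for atoms that
    occur in the grammar. The table is indexed by input addresses and may be long, but memory starts
    at 0 and is paid for only where it is touched. A nonterminal may have many occurrences, so a
    fact about a right-hand side goes to the first of them only, and each occurrence passes it to
    the next; every fact thus causes a bounded number of transfers. Two sibling facts are combined
    when the later one is processed, whatever their order of arrival. Dag nodes refer to nodes
    emitted earlier, so witnesses are finite even if the grammar is recursive. The exponent is 4 N:
    one factor 2^N counts the sets at a position, another the sets of the sibling, and the two
    nested loops over nodes that evaluate an operator are bounded by 2^N each. Loop counters are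
    mostly left unchanged by the code that uses them, so most of the running time can be read off
    the syntax. *)

Inductive expr : Type :=
| EC of nat
| EV of nat
| EAdd of expr & expr
| ESub of expr & expr
| EIn of expr
| EArr of nat & expr.

Inductive com : Type :=
| CSkip
| CAsg of nat & expr
| CSto of nat & expr & expr
| CSeq of com & com
| CIf of expr & com & com
| CLoop of nat & com.

Record state := State { var : nat -> nat; arr : nat -> nat -> nat }.

Definition setv (s : state) (x v : nat) : state :=
  State (update (var s) x v) (arr s).
Definition seta (s : state) (a i v : nat) : state :=
  State (var s) (fun b => if b == a then update (arr s a) i v else arr s b).

(* Cell [i] of array [a] lives at address [size inp + 32 * i + a]. *)
Definition cell (inp : seq nat) (s : state) (i : nat) : nat :=
  if i < size inp then nth 0 inp i
  else arr s ((i - size inp) %% 32) ((i - size inp) %/ 32).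

Fixpoint eval (inp : seq nat) (s : state) (e : expr) : nat :=
  match e with
  | EC k => k
  | EV x => var s x
  | EAdd e1 e2 => eval inp s e1 + eval inp s e2
  | ESub e1 e2 => eval inp s e1 - eval inp s e2
  | EIn e1 => cell inp s (eval inp s e1)
  | EArr a e1 => arr s a (eval inp s e1)
  end.

Fixpoint den (inp : seq nat) (c : com) (s : state) : state :=
  match c with
  | CSkip => s
  | CAsg x e => setv s x (eval inp s e)
  | CSto a e1 e2 => seta s a (eval inp s e1) (eval inp s e2)
  | CSeq c1 c2 => den inp c2 (den inp c1 s)
  | CIf e c1 c2 => if eval inp s e == 0 then den inp c2 s else den inp c1 s
  | CLoop x c1 => iter (var s x) (den inp c1) s
  end.

(** Number of compiled instructions, each executed once because expressions compile to straight-line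
    code. The 9 of an array access is the length 8 of [addr_code] plus the load. *)
Fixpoint ecost (e : expr) : nat :=
  match e with
  | EC _ => 1
  | EV _ => 2
  | EAdd e1 e2 | ESub e1 e2 => ecost e1 + ecost e2 + 1
  | EIn e1 => ecost e1 + 1
  | EArr _ e1 => ecost e1 + 9
  end.

(** Exact number of machine steps. The [+ 2] of a conditional is the jump over the else branch. A
    loop spends 2 steps on copying its counter and 1 on the final test; an iteration has 1 test and
    4 steps for decrementing and jumping back. *)
Fixpoint cost (inp : seq nat) (c : com) (s : state) : nat :=
  match c with
  | CSkip => 0
  | CAsg x e => ecost e + 2
  | CSto a e1 e2 => ecost e1 + ecost e2 + 9
  | CSeq c1 c2 => cost inp c1 s + cost inp c2 (den inp c1 s)
  | CIf e c1 c2 =>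
      ecost e + 1 + if eval inp s e == 0 then cost inp c2 s
                    else cost inp c1 s + 2
  | CLoop x c1 =>
      3 + \sum_(i < var s x) (cost inp c1 (iter i (den inp c1) s) + 5)
  end.

(** Variables occupy the registers below [temp]; the registers from there on are the evaluation
    stack of the compiled code. *)
Definition temp : nat := 64.

(** Five doublings multiply by 32, the number of arrays, and register 0 contributes the length of
    the input. *)
Definition addr_code (a t : nat) : seq instr :=
  [:: IAdd t t t; IAdd t t t; IAdd t t t; IAdd t t t; IAdd t t t;
      IAdd t t 0; IConst t.+1 a; IAdd t t t.+1].

Fixpoint comp_expr (e : expr) (t : nat) : seq instr :=
  match e with
  | EC k => [:: IConst t k]
  | EV x => [:: IConst t 0; IAdd t t x]
  | EAdd e1 e2 => comp_expr e1 t ++ comp_expr e2 t.+1 ++ [:: IAdd t t t.+1]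
  | ESub e1 e2 => comp_expr e1 t ++ comp_expr e2 t.+1 ++ [:: ISub t t t.+1]
  | EIn e1 => comp_expr e1 t ++ [:: ILoad t t]
  | EArr a e1 => comp_expr e1 t ++ addr_code a t ++ [:: ILoad t t]
  end.

Fixpoint csize (c : com) : nat :=
  match c with
  | CSkip => 0
  | CAsg x e => ecost e + 2
  | CSto a e1 e2 => ecost e1 + ecost e2 + 9
  | CSeq c1 c2 => csize c1 + csize c2
  | CIf e c1 c2 => ecost e + 1 + csize c1 + 2 + csize c2
  | CLoop x c1 => 3 + csize c1 + 4
  end.

(** [k] is the address of the code, as jumps are absolute, and [t] the first free temporary. A loop
    counts down a copy of its variable in register [t], so assignments to the variable in the body
    do not change the number of iterations. Unconditional jumps test a register that has just been
    set to 0. *)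
Fixpoint comp (c : com) (k t : nat) : seq instr :=
  match c with
  | CSkip => [::]
  | CAsg x e => comp_expr e t ++ [:: IConst x 0; IAdd x x t]
  | CSto a e1 e2 =>
      comp_expr e1 t ++ addr_code a t ++ comp_expr e2 t.+1
        ++ [:: IStore t t.+1]
  | CSeq c1 c2 => comp c1 k t ++ comp c2 (k + csize c1) t
  | CIf e c1 c2 =>
      comp_expr e t
        ++ [:: IJz t (k + ecost e + 1 + csize c1 + 2)]
        ++ comp c1 (k + ecost e + 1) t
        ++ [:: IConst t 0; IJz t (k + csize (CIf e c1 c2))]
        ++ comp c2 (k + ecost e + 1 + csize c1 + 2) t
  | CLoop x c1 =>
      [:: IConst t 0; IAdd t t x]
        ++ [:: IJz t (k + csize (CLoop x c1))]
        ++ comp c1 (k + 3) t.+2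
        ++ [:: IConst t.+1 1; ISub t t t.+1; IConst t.+1 0; IJz t.+1 (k + 2)]
  end.

Fixpoint wf_expr (e : expr) : bool :=
  match e with
  | EC _ => true
  | EV x => x < temp
  | EAdd e1 e2 | ESub e1 e2 => wf_expr e1 && wf_expr e2
  | EIn e1 => wf_expr e1
  | EArr a e1 => (a < 32) && wf_expr e1
  end.

(* Variable 0 holds the length of the input and is the base address of the
   arrays, so it is never assigned. *)
Fixpoint wf (c : com) : bool :=
  match c with
  | CSkip => true
  | CAsg x e => [&& 0 < x, x < temp & wf_expr e]
  | CSto a e1 e2 => [&& a < 32, wf_expr e1 & wf_expr e2]
  | CSeq c1 c2 => wf c1 && wf c2
  | CIf e c1 c2 => [&& wf_expr e, wf c1 & wf c2]
  | CLoop x c1 => (x < temp) && wf c1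
  end.

(** * Correctness of the compiler, with exact step counts *)

Lemma iter_addn (T : Type) a b (f : T -> T) x :
  iter (a + b) f x = iter b f (iter a f x).
Proof. by rewrite addnC iterD. Qed.

Definition code_at (prog : seq instr) (k : nat) (l : seq instr) : Prop :=
  exists pre post, prog = pre ++ l ++ post /\ size pre = k.

Lemma code_at_cat prog k l1 l2 :
  code_at prog k (l1 ++ l2) ->
  code_at prog k l1 /\ code_at prog (k + size l1) l2.
Proof.
move=> [pre [post [-> <-]]]; split.
- by exists pre, (l2 ++ post); rewrite -catA.
- by exists (pre ++ l1), post; rewrite size_cat -!catA.
Qed.

Lemma code_at_onth prog k i l : code_at prog k (i :: l) -> onth prog k = Some i.
Proof. by move=> [pre [post [-> <-]]]; rewrite onth_cat ltnn subnn. Qed.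

Lemma code_at_cons prog k i l : code_at prog k (i :: l) ->
  onth prog k = Some i /\ code_at prog (k + 1) l.
Proof.
move=> cl; split; first exact: code_at_onth cl.
by rewrite -cat1s in cl; case/code_at_cat: cl.
Qed.

Definition jump_free (i : instr) : bool := if i is IJz _ _ then false else true.

Definition exec_all (l : seq instr) (c : config) : config :=
  foldl (fun c i => exec i c) c l.

Lemma exec_all_cat l1 l2 c :
  exec_all (l1 ++ l2) c = exec_all l2 (exec_all l1 c).
Proof. exact: foldl_cat. Qed.

Lemma pc_exec i c : jump_free i -> pc (exec i c) = (pc c).+1.
Proof. by case: i; case: c. Qed.

Lemma pc_exec_all l c : all jump_free l -> pc (exec_all l c) = pc c + size l.
Proof.
elim: l c => [|i l IH] c /=; first by rewrite addn0.
by case/andP=> ji jl; rewrite IH // pc_exec // addSnnS.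
Qed.

Lemma run_exec_all prog l c :
  all jump_free l -> code_at prog (pc c) l ->
  iter (size l) (step prog) c = exec_all l c.
Proof.
elim: l c => [//|i l IH] c /= /andP[ji jl] cl.
have st : step prog c = exec i c by rewrite /step (code_at_onth cl).
rewrite -iterS iterSr st IH // pc_exec //.
by rewrite -cat1s in cl; case/code_at_cat: cl => _; rewrite addn1.
Qed.

Lemma size_comp_expr e t : size (comp_expr e t) = ecost e.
Proof.
by elim: e t => //= [e1 IH1 e2 IH2|e1 IH1 e2 IH2|e1 IH1|a e1 IH1] t;
  rewrite !size_cat /= ?IH1 ?IH2 ?addnA.
Qed.

Lemma size_comp c k t : size (comp c k t) = csize c.
Proof.
elim: c k t => //= [x e|a e1 e2|c1 IH1 c2 IH2|e c1 IH1 c2 IH2|x c1 IH1] k t;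
  rewrite ?size_cat /= ?size_comp_expr ?IH1 ?IH2 ?size_cat /= ?size_comp_expr
    ?IH1 ?IH2; lia.
Qed.

Lemma jump_free_comp_expr e t : all jump_free (comp_expr e t).
Proof.
by elim: e t => //= [e1 IH1 e2 IH2|e1 IH1 e2 IH2|e1 IH1|a e1 IH1] t;
  rewrite !all_cat /= ?IH1 ?IH2.
Qed.

Section Compiler.
Variable inp : seq nat.

Definition sim (s : state) (c : config) : Prop :=
  [/\ var s 0 = size inp, forall x, x < temp -> reg c x = var s x
    & forall i, memory c i = cell inp s i].

Definition same_below (t : nat) (c c' : config) : Prop :=
  forall r, r < t -> reg c' r = reg c r.

Lemma sim_same t s c c' : sim s c -> temp <= t -> same_below t c c' ->
  memory c' = memory c -> sim s c'.
Proof.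
case=> s0 sr sm tt sb em; split=> // [x xt|i]; last by rewrite em.
by rewrite sb ?sr //; apply: leq_trans tt.
Qed.

Lemma same_belowW t t' c c' : t <= t' -> same_below t' c c' -> same_below t c c'.
Proof. by move=> tt' sb r rt; apply: sb; apply: leq_trans tt'. Qed.

Lemma same_below_trans t c1 c2 c3 :
  same_below t c1 c2 -> same_below t c2 c3 -> same_below t c1 c3.
Proof. by move=> s1 s2 r rt; rewrite s2 ?s1. Qed.

Lemma updE f i x j : update f i x j = if j == i then x else f j.
Proof. by []. Qed.

Lemma cell_arr s a i : a < 32 -> cell inp s (i * 32 + size inp + a) = arr s a i.
Proof.
move=> a32; rewrite /cell.
have -> : (i * 32 + size inp + a < size inp) = false by lia.
have -> : i * 32 + size inp + a - size inp = i * 32 + a by lia.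
by congr arr; [rewrite modnMDl modn_small|
   rewrite divnMDl // divn_small ?addn0].
Qed.

Lemma addr_code_ok a t c : temp <= t -> reg c 0 = size inp ->
  let c' := exec_all (addr_code a t) c in
  [/\ reg c' t = reg c t * 32 + size inp + a,
      same_below t c c' & memory c' = memory c].
Proof.
rewrite /addr_code; case: c => pc0 rg mm tt /= r0; split=> // [|r rt /=]; last first.
  have [rn rn'] : r != t /\ r != t.+1 by split; lia.
  by rewrite !updE (negbTE rn) (negbTE rn').
have h1 : (t == t.+1) = false by lia.
have h2 : (0 == t) = false by rewrite /temp in tt; lia.
by rewrite !updE !eqxx h1 h2 r0; lia.
Qed.

Lemma jump_free_addr_code a t : all jump_free (addr_code a t).
Proof. by []. Qed.

Lemma size_addr_code a t : size (addr_code a t) = 8.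
Proof. by []. Qed.

Local Opaque addr_code.

Lemma comp_expr_ok e t s c : sim s c -> temp <= t -> wf_expr e ->
  let c' := exec_all (comp_expr e t) c in
  [/\ reg c' t = eval inp s e, same_below t c c' & memory c' = memory c].
Proof.
elim: e t c => /= [k|x|e1 IH1 e2 IH2|e1 IH1 e2 IH2|e1 IH1|a e1 IH1] t c sc tt.
- case: c sc => p r m sc _; split=> //= [|r' rt]; rewrite /= updE ?eqxx //.
  by case: eqP rt => // ->; rewrite ltnn.
- case: c sc => p r m [s0 sr sm] xt; split=> //= [|r' rt]; rewrite /= !updE ?eqxx.
    have xn : (x == t) = false by lia.
    by rewrite xn add0n -(sr _ xt).
  by case: eqP rt => // ->; rewrite ltnn.
- case/andP=> w1 w2; rewrite !exec_all_cat.
  have [r1 b1 m1] := IH1 t c sc tt w1; set c1 := exec_all _ c in r1 b1 m1 *.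
  have sc1 := sim_same sc tt b1 m1.
  have [r2 b2 m2] := IH2 t.+1 c1 sc1 (leqW tt) w2.
  have rt : reg (exec_all (comp_expr e2 t.+1) c1) t = eval inp s e1.
    by rewrite b2 // r1.
  case: (exec_all (comp_expr e2 t.+1) c1) r2 b2 m2 rt => p r m /= r2 b2 m2 rt.
  split=> [|r' rt'|]; rewrite /= ?updE ?eqxx ?r2 ?rt ?m2 //.
  have -> : (r' == t) = false by lia.
  by transitivity (reg c1 r'); [apply: (b2 r'); lia | exact: b1].
- case/andP=> w1 w2; rewrite !exec_all_cat.
  have [r1 b1 m1] := IH1 t c sc tt w1; set c1 := exec_all _ c in r1 b1 m1 *.
  have sc1 := sim_same sc tt b1 m1.
  have [r2 b2 m2] := IH2 t.+1 c1 sc1 (leqW tt) w2.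
  have rt : reg (exec_all (comp_expr e2 t.+1) c1) t = eval inp s e1.
    by rewrite b2 // r1.
  case: (exec_all (comp_expr e2 t.+1) c1) r2 b2 m2 rt => p r m /= r2 b2 m2 rt.
  split=> [|r' rt'|]; rewrite /= ?updE ?eqxx ?r2 ?rt ?m2 //.
  have -> : (r' == t) = false by lia.
  by transitivity (reg c1 r'); [apply: (b2 r'); lia | exact: b1].
- move=> w1; rewrite !exec_all_cat.
  have [r1 b1 m1] := IH1 t c sc tt w1; set c1 := exec_all _ c in r1 b1 m1 *.
  have [_ _ sm] := sim_same sc tt b1 m1.
  case: c1 r1 b1 m1 sm => p r m /= r1 b1 m1 sm.
  split=> [|r' rt'|] //=; rewrite ?updE ?eqxx ?r1 ?sm //.
  have -> : (r' == t) = false by lia.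
  exact: b1.
- case/andP=> a32 w1; rewrite !exec_all_cat.
  have [r1 b1 m1] := IH1 t c sc tt w1; set c1 := exec_all _ c in r1 b1 m1 *.
  have [s0 sr sm] := sim_same sc tt b1 m1.
  have r0 : reg c1 0 = size inp by rewrite sr.
  have [r2 b2 m2] := addr_code_ok a tt r0.
  case: (exec_all (addr_code a t) c1) r2 b2 m2 => p r m /= r2 b2 m2.
  split=> [|r' rt'|] //=; rewrite ?updE ?eqxx ?m2 //.
    by rewrite r2 r1 sm cell_arr.
  have -> : (r' == t) = false by lia.
  by transitivity (reg c1 r'); [apply: (b2 r'); lia | exact: b1].
Qed.

(** By uniqueness of division by 32, distinct pairs of array and index have distinct addresses, and
    none of them lies in the input. *)
Lemma cell_seta s a j v i : a < 32 ->
  cell inp (seta s a j v) i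
  = if i == j * 32 + size inp + a then v else cell inp s i.
Proof.
move=> a32; case: eqP => [->|ne]; first by rewrite cell_arr //= eqxx updE eqxx.
rewrite /cell /=; case: ifP => // ge; case: eqP => // e1; rewrite updE.
case: eqP => [e2|]; last by rewrite e1.
case: ne; have := divn_eq (i - size inp) 32; rewrite e1 e2; lia.
Qed.

(** Preservation of the temporaries below [t] makes the induction go through: the counter of a loop
    lies below the temporaries of its body and has to survive it. *)
Lemma comp_ok prog c k t s cf : code_at prog k (comp c k t) ->
  sim s cf -> pc cf = k -> temp <= t -> wf c ->
  exists2 cf', iter (cost inp c s) (step prog) cf = cf' &
    [/\ sim (den inp c s) cf', pc cf' = k + csize c & 
        forall r, temp <= r < t -> reg cf' r = reg cf r].
Proof.
elim: c k t s cf => [|x e|a e1 e2|c1 IH1 c2 IH2|e c1 IH1 c2 IH2|x c1 IH1] k t s cf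
  /= code sc pck tt.
- by move=> _; exists cf => //; rewrite addn0.
- case/and3P=> x0 xt we; set l := comp_expr e t ++ _ in code.
  have jl : all jump_free l by rewrite all_cat jump_free_comp_expr.
  have sl : size l = ecost e + 2 by rewrite size_cat size_comp_expr.
  rewrite -sl; exists (exec_all l cf); first by apply: run_exec_all; rewrite ?pck.
  rewrite pc_exec_all // pck /l exec_all_cat.
  have [r1 b1 m1] := comp_expr_ok sc tt we.
  have := sim_same sc tt b1 m1.
  case: (exec_all _ cf) r1 b1 m1 => p r m /= r1 b1 m1 [s0 sr sm].
  have tx : (t == x) = false by lia.
  split=> // [|r' /andP[r'1 r'2]].
    split=> //=; first by rewrite updE; case: eqP x0 => // <-.
    by move=> y yt; rewrite !updE; case: eqP => // ye; rewrite ?eqxx ?tx ?r1 // -sr.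
  rewrite !updE; have -> : (r' == x) = false by lia.
  exact: b1.
- case/and3P=> a32 we1 we2; set l := comp_expr e1 t ++ _ in code.
  have jl : all jump_free l by rewrite !all_cat !jump_free_comp_expr jump_free_addr_code.
  have sl : size l = ecost e1 + ecost e2 + 9.
    by rewrite !size_cat !size_comp_expr size_addr_code /=; lia.
  rewrite -sl; exists (exec_all l cf); first by apply: run_exec_all; rewrite ?pck.
  rewrite pc_exec_all // pck /l !exec_all_cat.
  have [r1 b1 m1] := comp_expr_ok sc tt we1.
  have [] := sim_same sc tt b1 m1.
  set cf1 := exec_all _ cf in r1 b1 m1 * => s0 sr sm.
  have r0 : reg cf1 0 = size inp by rewrite sr.
  have [r2 b2 m2] := addr_code_ok a tt r0.
  set cf2 := exec_all _ cf1 in r2 b2 m2 *.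
  have sc2 : sim s cf2 by apply: (@sim_same t s cf1).
  have [r3 b3 m3] := comp_expr_ok sc2 (leqW tt) we2.
  have r3' : reg (exec_all (comp_expr e2 t.+1) cf2) t = eval inp s e1 * 32 + size inp + a.
    by rewrite b3 // r2 r1.
  have [_ sr3 sm3] := sim_same sc2 (leqW tt) b3 m3.
  have bb : same_below t cf (exec_all (comp_expr e2 t.+1) cf2).
    by apply: same_below_trans b1 _; apply: same_below_trans b2 _;
       apply: same_belowW b3.
  case: (exec_all _ cf2) r3 r3' m3 sr3 sm3 bb => p r m /= r3 r3' m3 sr3 sm3 bb.
  split=> // [|r' /andP[_ r't]]; last exact: bb.
  by split=> //= i; rewrite cell_seta // updE r3' r3 sm3.
- case/andP=> w1 w2; have [code1 code2] := code_at_cat code.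
  rewrite size_comp in code2.
  have [cf1 run1 [sc1 pc1 rr1]] := IH1 _ _ _ _ code1 sc pck tt w1.
  have [cf2 run2 [sc2 pc2 rr2]] := IH2 _ _ _ _ code2 sc1 pc1 tt w2.
  exists cf2; first by rewrite iter_addn run1.
  by split=> // [|r rt]; [rewrite pc2 addnA | rewrite rr2 ?rr1].
- case/and3P=> we w1 w2.
  have [codee code'] := code_at_cat code; rewrite size_comp_expr in code'.
  have [codej code''] := code_at_cons code'.
  have [code1 code3] := code_at_cat code''; rewrite size_comp in code3.
  have [codej2 code4] := code_at_cons code3.
  have [codej3 code2] := code_at_cons code4; rewrite -addnA in code2.
  have [r1 b1 m1] := comp_expr_ok sc tt we.
  have sc1 := sim_same sc tt b1 m1.
  have je := jump_free_comp_expr e t.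
  have run1 : iter (ecost e) (step prog) cf = exec_all (comp_expr e t) cf.
    by rewrite -(size_comp_expr e t); apply: run_exec_all; rewrite ?pck.
  have pc1 := pc_exec_all cf je; rewrite size_comp_expr pck in pc1.
  set cf1 := exec_all _ cf in r1 b1 m1 sc1 run1 pc1.
  have st1 : step prog cf1 = exec (IJz t (k + ecost e + 1 + csize c1 + 2)) cf1.
    by rewrite /step pc1 codej.
  case: ifP => ev0.
    rewrite -r1 in ev0.
    set cf2 := exec _ cf1 in st1.
    have sc2 : sim s cf2 by case: (cf1) @cf2 sc1 st1.
    have pc2 : pc cf2 = k + ecost e + 1 + csize c1 + 2.
      by case: (cf1) ev0 @cf2 {st1 sc2} => p r m /= ->.
    have [cf3 run3 [sc3 pc3 rr3]] := IH2 _ _ _ _ code2 sc2 pc2 tt w2.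
    exists cf3; first by rewrite !iter_addn run1 /= st1.
    split=> //; first by rewrite pc3; lia.
    move=> r rt; rewrite rr3 //; transitivity (reg cf1 r).
      by rewrite /cf2; case: (cf1).
    by apply: b1; case/andP: rt.
  rewrite -r1 in ev0.
  set cf2 := exec _ cf1 in st1.
  have sc2 : sim s cf2 by case: (cf1) @cf2 sc1 st1.
  have pc2 : pc cf2 = k + ecost e + 1.
    by case: (cf1) pc1 ev0 @cf2 {st1 sc2} => p r m /= -> ->; rewrite addn1.
  have [cf3 run3 [sc3 pc3 rr3]] := IH1 _ _ _ _ code1 sc2 pc2 tt w1.
  have st3 : step prog cf3 = exec (IConst t 0) cf3.
    by rewrite /step pc3 codej2.
  have pc4 : pc (exec (IConst t 0) cf3) = (k + ecost e + 1 + csize c1).+1.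
    by rewrite -pc3; case: (cf3).
  have st4 : step prog (exec (IConst t 0) cf3)
    = exec (IJz t (k + (ecost e + 1 + csize c1 + 2 + csize c2))) (exec (IConst t 0) cf3).
    by rewrite /step pc4 -addn1 codej3.
  exists (exec (IJz t (k + (ecost e + 1 + csize c1 + 2 + csize c2))) (exec (IConst t 0) cf3)).
    by rewrite !iter_addn run1 /= st1 run3 /= st3 st4.
  case: cf3 run3 sc3 pc3 rr3 {st3 st4 pc4} => p r m run3 [s0 sr sm] pc3 rr3 /=.
  rewrite updE eqxx; split=> //.
    split=> //= x xt; rewrite updE; have -> : (x == t) = false by lia.
    exact: sr.
  move=> r' r't /=; rewrite updE; have -> : (r' == t) = false by lia.
  rewrite -[r r']/(reg (Config p r m) r') rr3 //; transitivity (reg cf1 r').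
    by rewrite /cf2; case: (cf1).
  by apply: b1; case/andP: r't.
- case/andP=> xt w1.
  rewrite -[[:: IConst t 0, _ & _]]/([:: IConst t 0; IAdd t t x] ++ _) in code.
  have [codei code'] := code_at_cat code; rewrite /= in code'.
  have [codej code''] := code_at_cons code'; rewrite -addnA in code''.
  have [code1 codee] := code_at_cat code''; rewrite size_comp in codee.
  set ci := exec_all [:: IConst t 0; IAdd t t x] cf.
  have runi : iter 2 (step prog) cf = ci.
    by apply: (@run_exec_all prog [:: IConst t 0; IAdd t t x]); rewrite ?pck.
  set n := var s x.
  have [sci pci rci rti] : [/\ sim s ci, pc ci = k + 2,
      forall r, temp <= r < t -> reg ci r = reg cf r & reg ci t = n].
    have [s0 sr sm] := sc; rewrite /n -sr //.
    have xt' : (x == t) = false by lia.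
    rewrite /ci; case: (cf) pck sr sm => p r m /= -> sr sm; split=> //.
    + split=> //= y yt; rewrite !updE; have -> : (y == t) = false by lia.
      exact: sr.
    + by rewrite addn2.
    + by move=> r' r't; rewrite !updE; have -> : (r' == t) = false by lia.
    + by rewrite !updE eqxx xt'.
  (* Invariant at the loop test, address [k + 2]: after [j] iterations the counter register holds
     [n - j]. *)
  suff H j : j <= n ->
    exists2 cf', iter (\sum_(i < j) (cost inp c1 (iter i (den inp c1) s) + 5)) (step prog) ci = cf' &
    [/\ sim (iter j (den inp c1) s) cf', pc cf' = k + 2,
     forall r, temp <= r < t -> reg cf' r = reg cf r & reg cf' t = n - j].
    have [cf' run' [sc' pc' rr' rt']] := H n (leqnn n).
    have st : step prog cf' = exec (IJz t (k + (3 + csize c1 + 4))) cf'.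
      by rewrite /step pc' codej.
    exists (exec (IJz t (k + (3 + csize c1 + 4))) cf').
      pose S := \sum_(i < n) (cost inp c1 (iter i (den inp c1) s) + 5).
      by rewrite -[LHS]/(iter (3 + S) (step prog) cf) (_ : 3 + S = (2 + S).+1) // iterS (iter_addn 2 S) runi run' st.
    rewrite subnn in rt'.
    by case: cf' run' sc' pc' rr' rt' {st} => p r m /= _ sc' _ rr' -> /=.
  elim: j => [_|j IHj jn]; first by exists ci; rewrite ?big_ord0 ?subn0.
  have [cf' run' [sc' pc' rr' rt']] := IHj (ltnW jn).
  have st : step prog cf' = exec (IJz t (k + (3 + csize c1 + 4))) cf'.
    by rewrite /step pc' codej.
  set cf1 := exec _ cf' in st.
  have [sc1 pc1 rr1 rt1] : [/\ sim (iter j (den inp c1) s) cf1, pc cf1 = k + 3,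
     forall r, temp <= r < t -> reg cf1 r = reg cf r & reg cf1 t = n - j].
    rewrite /cf1; case: (cf') sc' pc' rr' rt' => p r m /= sc' pc' rr' rt'.
    split=> //; rewrite rt' pc'; have -> : (n - j == 0) = false by lia.
    by lia.
  have [|cf2 run2 [sc2 pc2 rr2]] := IH1 _ _ _ _ code1 sc1 pc1 _ w1; first by lia.
  set lst := [:: IConst t.+1 1; ISub t t t.+1; IConst t.+1 0].
  rewrite -[[:: IConst t.+1 1; _; _; _]]/(lst ++ [:: IJz t.+1 (k + 2)]) in codee.
  have [codel codej2] := code_at_cat codee.
  have run3 : iter 3 (step prog) cf2 = exec_all lst cf2.
    by apply: (@run_exec_all prog lst); rewrite ?pc2 // -addnA.
  have pc3 : pc (exec_all lst cf2) = k + 3 + csize c1 + 3.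
    by rewrite pc_exec_all // pc2.
  have st4 : step prog (exec_all lst cf2) = exec (IJz t.+1 (k + 2)) (exec_all lst cf2).
    rewrite /step pc3 (_ : k + 3 + csize c1 + 3 = k + (2 + 1) + csize c1 + size lst).
      by rewrite (code_at_onth codej2).
    by rewrite /=; lia.
  exists (exec (IJz t.+1 (k + 2)) (exec_all lst cf2)).
    rewrite big_ord_recr /= iter_addn run'.
    rewrite -[5]/(4 + 1) addnA addn1 iterSr st iter_addn run2.
    by rewrite -[4]/(3 + 1) iter_addn run3.
  have r2t : reg cf2 t = n - j by rewrite rr2 ?rt1 //; lia.
  case: cf2 run2 sc2 pc2 rr2 r2t {run3 pc3 st4} => p r m _ [s0 sr sm] /= pc2 rr2 r2t.
  rewrite !updE !eqxx /=.
  have -> : (t == t.+1) = false by lia.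
  split=> //.
  + split=> //= y yt; rewrite !updE.
    have [-> ->] : (y == t.+1) = false /\ (y == t) = false by lia.
    exact: sr.
  + move=> r' r't; rewrite !updE.
    have [-> ->] : (r' == t.+1) = false /\ (r' == t) = false by lia.
    by rewrite rr2 ?rr1 //; lia.
  + by rewrite r2t; lia.
Qed.

Lemma comp_halts c : wf c ->
  let s0 := State (update (fun=> 0) 0 (size inp)) (fun _ _ => 0) in
  exists cf, [/\ iter (cost inp c s0) (step (comp c 0 temp)) (init inp) = cf,
     halted (comp c 0 temp) cf & sim (den inp c s0) cf].
Proof.
move=> wc s0.
have code : code_at (comp c 0 temp) 0 (comp c 0 temp).
  by exists [::], [::]; rewrite cats0.
have sm0 : sim s0 (init inp).
  by split=> // i; rewrite /= /cell; case: ltnP => // /(nth_default 0) ->.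
have [cf run [sc pcf _]] := comp_ok code sm0 erefl (leqnn _) wc.
by exists cf; split=> //; rewrite /halted pcf size_comp.
Qed.

End Compiler.

(** * Frame conditions, loop invariants and syntactic cost bounds *)

Fixpoint modv (c : com) : seq nat :=
  match c with
  | CSkip | CSto _ _ _ => [::]
  | CAsg x _ => [:: x]
  | CSeq c1 c2 | CIf _ c1 c2 => modv c1 ++ modv c2
  | CLoop _ c1 => modv c1
  end.

Fixpoint moda (c : com) : seq nat :=
  match c with
  | CSkip | CAsg _ _ => [::]
  | CSto a _ _ => [:: a]
  | CSeq c1 c2 | CIf _ c1 c2 => moda c1 ++ moda c2
  | CLoop _ c1 => moda c1
  end.

Fixpoint loopv (c : com) : seq nat :=
  match c with
  | CSkip | CSto _ _ _ | CAsg _ _ => [::]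
  | CSeq c1 c2 | CIf _ c1 c2 => loopv c1 ++ loopv c2
  | CLoop x c1 => x :: loopv c1
  end.

Fixpoint depth (c : com) : nat :=
  match c with
  | CSkip | CSto _ _ _ | CAsg _ _ => 0
  | CSeq c1 c2 | CIf _ c1 c2 => maxn (depth c1) (depth c2)
  | CLoop _ c1 => (depth c1).+1
  end.

(** Leading constant of the cost as a polynomial in the bound [M] on loop counters. The 8 of a loop
    absorbs [3 + 5 * M], the overhead of entry and iterations, for [M] positive. *)
Fixpoint weight (c : com) : nat :=
  match c with
  | CSkip => 0
  | CAsg x e => ecost e + 2
  | CSto a e1 e2 => ecost e1 + ecost e2 + 9
  | CSeq c1 c2 => weight c1 + weight c2
  | CIf e c1 c2 => ecost e + 3 + weight c1 + weight c2
  | CLoop _ c1 => weight c1 + 8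
  end.

(* All loop counters of [c], nested ones included, keep their value on entry. *)
Definition static (c : com) : bool := all (fun x => x \notin modv c) (loopv c).

Section Tools.
Variable inp : seq nat.

Lemma var_frame c s x : x \notin modv c -> var (den inp c s) x = var s x.
Proof.
elim: c s => //= [y e|c1 IH1 c2 IH2|e c1 IH1 c2 IH2|y c1 IH1] s.
- by rewrite inE updE => /negbTE ->.
- by rewrite mem_cat => /norP[h1 h2]; rewrite IH2 ?IH1.
- by rewrite mem_cat => /norP[h1 h2]; case: ifP; rewrite ?IH2 ?IH1.
- by move=> h1; elim: (var s y) => //= n IH; rewrite IH1.
Qed.

Lemma arr_frame c s a : a \notin moda c -> arr (den inp c s) a = arr s a.
Proof.
elim: c s => //= [b e1 e2|c1 IH1 c2 IH2|e c1 IH1 c2 IH2|y c1 IH1] s.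
- by rewrite inE => /negbTE ->.
- by rewrite mem_cat => /norP[h1 h2]; rewrite IH2 ?IH1.
- by rewrite mem_cat => /norP[h1 h2]; case: ifP; rewrite ?IH2 ?IH1.
- by move=> h1; elim: (var s y) => //= n IH; rewrite IH1.
Qed.

Definition framed (c : com) (s t : state) : Prop :=
  (forall x, x \notin modv c -> var t x = var s x) /\
  (forall a, a \notin moda c -> arr t a = arr s a).

Lemma framed_iter c s n : framed c s (iter n (den inp c) s).
Proof.
split=> y hy; elim: n => //= n <-; first exact: var_frame.
exact: arr_frame.
Qed.

(** [framed] hands each iteration whatever the body cannot change, so an invariant has to mention
    only what the body does change. *)
Lemma loop_inv x c s (P : nat -> state -> Prop) : P 0 s ->
  (forall i t, i < var s x -> framed c s t -> P i t -> P i.+1 (den inp c t)) ->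
  P (var s x) (den inp (CLoop x c) s).
Proof.
move=> P0 PS /=; elim: {-2}(var s x) (leqnn (var s x)) => //= n IH nx.
by apply: PS => //; [exact: framed_iter | apply: IH; exact: ltnW].
Qed.

Lemma cost_loop x c s (P : nat -> state -> Prop) T : P 0 s ->
  (forall i t, i < var s x -> framed c s t -> P i t ->
     P i.+1 (den inp c t) /\ cost inp c t <= T) ->
  cost inp (CLoop x c) s <= 3 + var s x * (T + 5).
Proof.
move=> P0 PS /=; rewrite leq_add2l.
have H n : n <= var s x -> P n (iter n (den inp c) s).
  elim: n => //= n IH nx.
  by case: (PS n _ nx (framed_iter _ _ _) (IH (ltnW nx))).
rewrite -[X in _ <= X * _]card_ord -sum_nat_const; apply: leq_sum => i _.
rewrite leq_add2r.
by case: (PS i _ (ltn_ord i) (framed_iter _ _ _) (H _ (ltnW (ltn_ord i)))).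
Qed.

(** A static counter has the same value whenever its loop is entered, so the bound at the start
    applies throughout, and each nesting level contributes one factor [M]. *)
Lemma cost_static c s M : 0 < M -> static c ->
  (forall x, x \in loopv c -> var s x <= M) ->
  cost inp c s <= weight c * M ^ depth c.
Proof.
move=> M0; rewrite /static.
have le_exp i j : i <= j -> M ^ i <= M ^ j by move=> ij; rewrite leq_pexp2l.
elim: c s => [|x e|a e1 e2|c1 IH1 c2 IH2|e c1 IH1 c2 IH2|x c1 IH1] s //=.
- by rewrite expn0 muln1.
- by rewrite expn0 muln1.
- rewrite all_cat => /andP[/allP a1 /allP a2] H.
  have l1 := leq_maxl (depth c1) (depth c2).
  have l2 := leq_maxr (depth c1) (depth c2).
  rewrite mulnDl; apply: leq_add.
    apply: leq_trans (IH1 s _ _) _; last by rewrite leq_mul2l le_exp ?orbT.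
      by apply/allP=> x /a1; rewrite mem_cat => /norP[].
    by move=> x xl; apply: H; rewrite mem_cat xl.
  apply: leq_trans (IH2 _ _ _) _; last by rewrite leq_mul2l le_exp ?orbT.
    by apply/allP=> x /a2; rewrite mem_cat => /norP[].
  move=> x xl; rewrite var_frame; first by apply: H; rewrite mem_cat xl orbT.
  by move: (a2 x xl); rewrite mem_cat => /norP[].
- rewrite all_cat => /andP[/allP a1 /allP a2] H.
  have l1 := leq_maxl (depth c1) (depth c2).
  have l2 := leq_maxr (depth c1) (depth c2).
  have h1 : cost inp c1 s <= weight c1 * M ^ maxn (depth c1) (depth c2).
    apply: leq_trans (IH1 s _ _) _; last by rewrite leq_mul2l le_exp ?orbT.
      by apply/allP=> x /a1; rewrite mem_cat => /norP[].
    by move=> x xl; apply: H; rewrite mem_cat xl.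
  have h2 : cost inp c2 s <= weight c2 * M ^ maxn (depth c1) (depth c2).
    apply: leq_trans (IH2 _ _ _) _; last by rewrite leq_mul2l le_exp ?orbT.
      by apply/allP=> x /a2; rewrite mem_cat => /norP[].
    by move=> x xl; apply: H; rewrite mem_cat xl orbT.
  have h3 : ecost e + 3 <= (ecost e + 3) * M ^ maxn (depth c1) (depth c2).
    by rewrite leq_pmulr // expn_gt0 M0.
  by rewrite !mulnDl in h3 *; case: ifP => _; lia.
- case/andP=> xm /allP al H.
  have xM : var s x <= M by apply: H; rewrite inE eqxx.
  have hb i t : i < var s x -> framed c1 s t -> True ->
      True /\ cost inp c1 t <= weight c1 * M ^ depth c1.
    move=> _ [fr _] _; split=> //; apply: IH1; first exact/allP.
    by move=> y yl; rewrite fr ?al //; apply: H; rewrite inE yl orbT.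
  have /= := @cost_loop x c1 s (fun _ _ => True) _ I hb.
  set S := \sum_(_ < _) _; set Q := M ^ depth c1 in hb * => hS.
  have Q0 : 0 < Q by rewrite expn_gt0 M0.
  rewrite expnS -/Q; apply: leq_trans hS _.
  have : var s x * (weight c1 * Q + 5) <= M * (weight c1 * Q + 5) by rewrite leq_mul2r xM orbT.
  have : 5 * M <= 5 * (M * Q) by rewrite leq_mul2l leq_pmulr.
  have : 0 < M * Q by rewrite muln_gt0 M0.
  by set A := weight c1; nia.
Qed.

End Tools.

(* Notation, variables and arrays of the solver *)
Declare Scope com_scope.
Delimit Scope com_scope with com.
Bind Scope com_scope with com.
Open Scope com_scope.
Notation "$ x" := (EV x) (at level 1, x at level 0, format "$ x").
Notation "c1 ;; c2" := (CSeq c1 c2)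
  (at level 90, right associativity) : com_scope.
Notation "x ::= e" := (CAsg x e) (at level 80) : com_scope.
Notation "a @[ i ] ::= e" := (CSto a i e)
  (at level 80, i at level 70) : com_scope.
Notation "a @( i )" := (EArr a i) (at level 2, format "a @( i )").
Notation "e1 [+] e2" := (EAdd e1 e2) (at level 50, left associativity).
Notation "e1 [-] e2" := (ESub e1 e2) (at level 50, left associativity).
Notation ne e1 e2 := (EAdd (ESub e1 e2) (ESub e2 e1)).
Notation incr x := (CAsg x (EAdd (EV x) (EC 1))).

Notation vL := 0.
Notation vOL := 1.
Notation vN := 2.
Notation vB := 3.
Notation vR := 4.
Notation vnc := 5.
Notation vSt := 6.
Notation vSig := 7.
Notation vm := 8.
Notation vPos := 9.
Notation vp := 10.
Notation vk := 11.
Notation vw := 12.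
Notation ver := 13.
Notation vlr := 14.
Notation vu := 15.
Notation vh := 16.
Notation vc := 17.
Notation vT := 18.
Notation vhd := 19.
Notation vtl := 20.
Notation von := 21.
Notation vdn := 22.
Notation vfnd := 23.
Notation vfe := 24.
Notation vS := 25.
Notation vd := 26.
Notation vq := 27.
Notation tp := 28.
Notation ts := 29.
Notation td := 30.
Notation vx := 31.
Notation dl := 32.
Notation dr := 33.
Notation vi := 34.
Notation vj := 35.
Notation vy := 36.
Notation vr := 37.
Notation vS2 := 38.
Notation vsib := 39.
Notation vk2 := 40.
Notation vbad := 41.
Notation vA := 42.

(* Positions are input addresses of terms and rules, and nodes are numbered
   across all structures.  [aEnd]: end of the term at a position; [aPar]: its
   parent, where a right-hand side has its rule as parent and a rule has 0;
   [aOcc], [aNxt]: linked lists of the occurrences of each nonterminal, 0 being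
   nil; [aTab] at [p * 2 ^ N + S]: 1 + queue index of the fact (p, S), or 0;
   [aQp], [aQs], [aQd]: position, set and dag node of a queued fact; [aDend]:
   length of the output after a dag node; [aFs], [aSz], [aEr], [aLr]: first node
   and size of the structure of a node, addresses of its edge row and of its
   label row; [aWant]: 1 at the start nodes of positive structures, 2 of negative
   ones. *)
Notation aOut := 0.
Notation aEnd := 1.
Notation aPar := 2.
Notation aNxt := 3.
Notation aOcc := 4.
Notation aTab := 5.
Notation aQp := 6.
Notation aQs := 7.
Notation aQd := 8.
Notation aDend := 9.
Notation aFs := 10.
Notation aSz := 11.
Notation aEr := 12.
Notation aLr := 13.
Notation aWant := 14.
Notation aB1 := 15.
Notation aB2 := 16.

(** * The solver *)

(** There is no multiplication, so row addresses advance by one row per node. Label rows are stepped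
    over without being read, which keeps [#|Sigma|] out of the running time. *)
Definition scan_node : com :=
  aFs@[$vN [+] $vu] ::= $vN ;;
  aSz@[$vN [+] $vu] ::= $vw ;;
  aEr@[$vN [+] $vu] ::= $ver ;;
  aLr@[$vN [+] $vu] ::= $vlr ;;
  ver ::= $ver [+] $vw ;;
  vlr ::= $vlr [+] $vSig ;;
  incr vu.

Definition scan_head : com :=
  vw ::= EIn $vp ;;
  vy ::= EC 1 ;;
  CIf ($vPos [-] $vk) CSkip (vy ::= EC 2) ;;
  aWant@[$vN [+] EIn ($vp [+] EC 1)] ::= $vy ;;
  ver ::= $vp [+] EC 2 ;;
  vlr ::= $ver ;;
  vu ::= EC 0.

(** The first loop moves [vlr] past the edge matrix by adding [vw] to it [vw] times. After the
    second loop, [vlr] is behind the label matrix, where the next structure begins. *)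
Definition scan_tail : com :=
  CLoop vw (vlr ::= $vlr [+] $vw) ;;
  CLoop vw scan_node ;;
  vN ::= $vN [+] $vw ;;
  vp ::= $vlr ;;
  incr vk.

Definition scan_init : com :=
  vSig ::= EIn (EC 0) ;;
  vPos ::= EIn (EC 1) ;;
  vm ::= $vPos [+] EIn (EC 2) ;;
  vp ::= EC 3.

(** The encoded grammar opens with the number of nonterminals, the start symbol and the number of
    rules, hence the offsets 1 and 3. *)
Definition scan_final : com :=
  vSt ::= EIn ($vp [+] EC 1) ;;
  vR ::= $vp [+] EC 3 ;;
  vnc ::= $vL [-] $vR ;;
  vB ::= EC 1 ;;
  CLoop vN (vB ::= $vB [+] $vB).

(** Going from right to left, the ends of the arguments are available when the operator is reached.
    Cells that do not start a term get meaningless entries, which no term consults. *)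
Definition ends_step : com :=
  vp ::= $vp [-] EC 1 ;;
  vc ::= EIn $vp ;;
  CIf $vc
    (CIf (ne $vc (EC 6))
       (CIf ($vc [-] EC 2)
          (aEnd@[$vp] ::= aEnd@($vp [+] EC 1))
          (aEnd@[$vp] ::= aEnd@(aEnd@($vp [+] EC 1))))
       (aEnd@[$vp] ::= $vp [+] EC 2))
    (aEnd@[$vp] ::= $vp [+] EC 2).

Definition ends : com := vp ::= $vL ;; CLoop vnc ends_step.

(* [vh] is the position of the next rule. *)
Definition parents_step : com :=
  CIf (ne $vp $vh)
    (CIf aPar@($vp)
       (vc ::= EIn $vp ;;
        CIf $vc
          (CIf (ne $vc (EC 6))
             (aPar@[$vp [+] EC 1] ::= $vp ;;
              CIf (EC 3 [-] $vc)
                (aPar@[aEnd@($vp [+] EC 1)] ::= $vp) CSkip)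
             (vA ::= EIn ($vp [+] EC 1) ;;
              aNxt@[$vp] ::= aOcc@($vA) ;;
              aOcc@[$vA] ::= $vp))
          CSkip)
       CSkip)
    (aPar@[$vp [+] EC 1] ::= $vp ;;
     vh ::= aEnd@($vp [+] EC 1)) ;;
  incr vp.

Definition parents : com :=
  vp ::= $vR ;; vh ::= $vR ;; CLoop vnc parents_step.

Definition lookup : com :=
  vx ::= $tp ;; CLoop vN (vx ::= $vx [+] $vx) ;; vx ::= $vx [+] $ts.

Definition push : com :=
  aTab@[$vx] ::= $vtl [+] EC 1 ;;
  aQp@[$vtl] ::= $tp ;;
  aQs@[$vtl] ::= $ts ;;
  aQd@[$vtl] ::= $td ;;
  incr vtl.

(** [aDend] records where the output can be cut so that the new node comes last. *)
Definition emit : com :=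
  aOut@[$von] ::= $vc ;;
  aOut@[$von [+] EC 1] ::= $dl ;;
  von ::= $von [+] EC 2 ;;
  CIf $vc
    (CIf (EC 3 [-] $vc) (aOut@[$von] ::= $dr ;; incr von) CSkip)
    CSkip ;;
  aDend@[$vdn] ::= $von ;;
  td ::= $vdn ;;
  incr vdn.

(** Replacing a nonterminal by a right-hand side leaves the derived formula as it is, so the new
    fact shares the dag node of the old one. *)
Definition derive_copy : com := lookup ;; CIf aTab@($vx) CSkip push.

Definition derive_op : com :=
  lookup ;; CIf aTab@($vx) CSkip (emit ;; push).

Definition label_bits : com :=
  ts ::= EC 0 ;;
  vi ::= EC 0 ;;
  CLoop vN (ts ::= $ts [+] $ts [+] EIn (aLr@($vi) [+] $dl) ;; incr vi).

Definition atoms_step : com :=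
  CIf aPar@($vp)
    (vc ::= EIn $vp ;;
     CIf $vc CSkip
       (dl ::= EIn ($vp [+] EC 1) ;;
        label_bits ;;
        tp ::= $vp ;;
        derive_op))
    CSkip ;;
  incr vp.

Definition atoms : com :=
  aOut@[EC 0] ::= EC 1 ;;
  von ::= EC 1 ;;
  vp ::= $vR ;;
  CLoop vnc atoms_step.

(** In the absence of division, bits are read from the top: the number is doubled and compared with
    2^N, and the carry is the next bit. The added 1 turns the truncated difference into a test for
    [vB <= vy]. *)
Definition unpack (a x : nat) : com :=
  vy ::= $x ;;
  vi ::= EC 0 ;;
  CLoop vN
    (vy ::= $vy [+] $vy ;;
     CIf ($vy [+] EC 1 [-] $vB)
       (a@[$vi] ::= EC 1 ;; vy ::= $vy [-] $vB)
       (a@[$vi] ::= EC 0) ;;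
     incr vi).

(** Sets [vr] at a successor that decides the formula: one where the argument holds for a diamond,
    one where it fails for a box. The two outer tests keep [vj] within the structure of node
    [vi]. *)
Definition modal_step : com :=
  CIf (aFs@($vi) [-] $vj) CSkip
    (CIf (aFs@($vi) [+] aSz@($vi) [-] $vj)
       (CIf (EIn (aEr@($vi) [+] ($vj [-] aFs@($vi))))
          (CIf ($vc [-] EC 4)
             (CIf aB1@($vj) (vr ::= EC 1) CSkip)
             (CIf aB1@($vj) CSkip (vr ::= EC 1)))
          CSkip)
       CSkip) ;;
  incr vj.

(** On bits, conjunction is the truncated [a + b - 1], and disjunction is [a + b] minus this excess.
    For a box the search finds refuting successors, so its result is complemented. *)
Definition op_bit : com :=
  CIf ($vc [-] EC 3)
    (vr ::= EC 0 ;;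
     vj ::= EC 0 ;;
     CLoop vN modal_step ;;
     CIf ($vc [-] EC 4) CSkip (vr ::= EC 1 [-] $vr))
    (CIf ($vc [-] EC 2)
       (vr ::= EC 1 [-] aB1@($vi))
       (CIf ($vc [-] EC 1)
          (vr ::= aB1@($vi) [+] aB2@($vi)
                    [-] (aB1@($vi) [+] aB2@($vi) [-] EC 1))
          (vr ::= aB1@($vi) [+] aB2@($vi) [-] EC 1))).

Definition operate : com :=
  ts ::= EC 0 ;;
  vi ::= EC 0 ;;
  CLoop vN (op_bit ;; ts ::= $ts [+] $ts [+] $vr ;; incr vi).

Definition combine : com :=
  unpack aB1 vS ;; unpack aB2 vS2 ;; operate ;; tp ::= $vq ;; derive_op.

(** [tp = 0] is the end of an occurrence list. *)
Definition forward : com :=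
  ts ::= $vS ;; td ::= $vd ;; CIf $tp derive_copy CSkip.

Definition check_step : com :=
  CIf aWant@($vi)
    (CIf (aWant@($vi) [-] EC 1)
       (CIf aB1@($vi) (vbad ::= EC 1) CSkip)
       (CIf aB1@($vi) CSkip (vbad ::= EC 1)))
    CSkip ;;
  incr vi.

Definition check : com :=
  unpack aB1 vS ;;
  vbad ::= EC 0 ;;
  vi ::= EC 0 ;;
  CLoop vN check_step ;;
  CIf $vbad CSkip (vfnd ::= EC 1 ;; vfe ::= aDend@($vd)).

Definition at_header : com :=
  vA ::= EIn $vp ;;
  CIf (ne $vA $vSt) CSkip check ;;
  tp ::= aOcc@($vA) ;;
  forward.

Definition at_occurrence : com :=
  CIf (ne (EIn $vp) (EC 6)) CSkip (tp ::= aNxt@($vp) ;; forward).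

(** Tries one candidate set [vS2] of the sibling. The arguments of the dag node have to be in order,
    so it matters whether the current position is the left one, at [vq + 1]. *)
Definition binary_step : com :=
  tp ::= $vsib ;;
  ts ::= $vS2 ;;
  lookup ;;
  vk2 ::= aTab@($vx) ;;
  CIf $vk2
    (CIf (ne $vp ($vq [+] EC 1))
       (dl ::= aQd@($vk2 [-] EC 1) ;; dr ::= $vd)
       (dl ::= $vd ;; dr ::= aQd@($vk2 [-] EC 1)) ;;
     combine)
    CSkip ;;
  incr vS2.

Definition at_operator : com :=
  vc ::= EIn $vq ;;
  CIf (EC 3 [-] $vc)
    (CIf (ne $vp ($vq [+] EC 1))
       (vsib ::= $vq [+] EC 1)
       (vsib ::= aEnd@($vq [+] EC 1)) ;;
     vS2 ::= EC 0 ;;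
     CLoop vB binary_step)
    (dl ::= $vd ;; vS2 ::= $vS ;; combine).

Definition at_parent : com :=
  CIf aPar@($vq) at_operator (tp ::= $vq ;; forward).

Definition process : com :=
  vp ::= aQp@($vhd) ;;
  vS ::= aQs@($vhd) ;;
  vd ::= aQd@($vhd) ;;
  vq ::= aPar@($vp) ;;
  CIf $vq (at_occurrence ;; at_parent) at_header ;;
  incr vhd.

(** The loop language has only counted loops: the worklist loop runs a precomputed number of rounds
    and idles once the queue is empty. *)
Definition main_step : com := CIf ($vtl [-] $vhd) process CSkip.

(* [vT] bounds the number of facts, hence of queue entries. *)
Definition main : com :=
  vT ::= $vnc ;; CLoop vN (vT ::= $vT [+] $vT) ;; CLoop vT main_step.

(* Cell [i] of array [r] is at offset [32 * i + r], so output cells, which lie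
   32 apart, become contiguous when they are spread over all arrays. *)
Definition copy_lanes : com :=
  foldr (fun r c => r@[$vi] ::= aOut@($vx [+] EC r) ;; c) CSkip (iota 0 32).

Definition choose_output : com :=
  CIf $vfnd (vOL ::= $vfe) (aOut@[EC 0] ::= EC 0 ;; vOL ::= EC 1) ;;
  vx ::= EC 0 ;;
  vi ::= EC 0.

Definition finish : com :=
  choose_output ;;
  CLoop vOL (copy_lanes ;; vx ::= $vx [+] EC 32 ;; incr vi).

Definition solver : com :=
  scan_init ;; CLoop vm (scan_head ;; scan_tail) ;; scan_final ;;
  ends ;; parents ;; atoms ;; main ;; finish.

Lemma solver_wf : wf solver.
Proof. by vm_compute. Qed.

(** * Lists and bit strings *)

Lemma In_split (T : Type) (x : T) s :
  List.In x s -> exists s1 s2, s = s1 ++ x :: s2.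
Proof.
elim: s => //= y s IH [->|/IH[s1 [s2 ->]]]; first by exists [::], s.
by exists (y :: s1), s2.
Qed.

Lemma In_mid (T : Type) (x : T) s1 s2 : List.In x (s1 ++ x :: s2).
Proof. by elim: s1 => [|y s1 IH] /=; [left | right]. Qed.

Lemma onth_nth_flatten (T : Type) (x0 : T) (ss1 ss2 : seq (seq T)) s j :
  j < size s -> nth x0 (flatten (ss1 ++ s :: ss2)) (size (flatten ss1) + j)
  = nth x0 s j.
Proof.
move=> js; rewrite flatten_cat /= nth_cat ltnNge leq_addr /= addKn.
by rewrite nth_cat js.
Qed.

(* Most significant bit first. *)
Definition pack (s : seq bool) : nat := foldl (fun x (b : bool) => x + x + b) 0 s.

Lemma pack_rcons s b : pack (rcons s b) = pack s + pack s + b.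
Proof. by rewrite /pack foldl_rcons. Qed.

Lemma pack_lt s : pack s < 2 ^ size s.
Proof.
elim/last_ind: s => [//|s b IH]; rewrite pack_rcons size_rcons expnS.
by have := leq_b1 b; lia.
Qed.

Lemma pack_cat s t : pack (s ++ t) = pack s * 2 ^ size t + pack t.
Proof.
elim/last_ind: t => [|t b IH]; first by rewrite cats0 muln1 addn0.
by rewrite -rcons_cat !pack_rcons IH size_rcons expnS; lia.
Qed.

(** * Positions in the encoded grammar *)

Section Grammar.
Variables (Sigma NT : finType).
Implicit Types t u v : term Sigma NT.

Definition tcode t : nat :=
  match t with
  | TAtom _ => 0 | TAnd _ _ => 1 | TOr _ _ => 2 | TNot _ => 3 | TBox _ => 4
  | TDia _ => 5 | TNonterm _ => 6
  end.

Definition kids t : seq (nat * term Sigma NT) :=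
  match t with
  | TAtom _ | TNonterm _ => [::]
  | TAnd u v | TOr u v => [:: (1, u); (1 + size (enc_term u), v)]
  | TNot u | TBox u | TDia u => [:: (1, u)]
  end.

Lemma enc_term_cons t : exists r, enc_term t = tcode t :: r.
Proof. by case: t => *; eexists. Qed.

Lemma size_enc_term_gt0 t : 0 < size (enc_term t).
Proof. by case: (enc_term_cons t) => r ->. Qed.

(** Prefix notation delimits itself: the tag determines the number of arguments, and ranks determine
    symbols. *)
Lemma enc_term_inj t t' r r' :
  enc_term t ++ r = enc_term t' ++ r' -> t = t' /\ r = r'.
Proof.
elim: t t' r r' => [A|a|u IHu v IHv|u IHu v IHv|u IHu|u IHu|u IHu]
  [A'|a'|u' v'|u' v'|u'|u'|u'] r r' //=.
- by case=> /val_inj/enum_rank_inj -> ->.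
- by case=> /val_inj/enum_rank_inj -> ->.
- by case; rewrite -!catA => /IHu[-> /IHv[-> ->]].
- by case; rewrite -!catA => /IHu[-> /IHv[-> ->]].
- by case=> /IHu[-> ->].
- by case=> /IHu[-> ->].
- by case=> /IHu[-> ->].
Qed.

(** May also hold at a cell that looks like a term by accident, for instance one that stores a rank;
    [isub] below singles out the genuine subterm positions. *)
Definition term_at (inp : seq nat) (p : nat) t : Prop :=
  exists r, drop p inp = enc_term t ++ r.

Lemma term_at_inj inp p t t' : term_at inp p t -> term_at inp p t' -> t = t'.
Proof. by rewrite /term_at => -[r ->] [r' /enc_term_inj[]]. Qed.

Lemma term_at_size inp p t : term_at inp p t -> p + size (enc_term t) <= size inp.
Proof.
move=> [r e]; have := size_drop p inp; rewrite e size_cat.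
by have := size_enc_term_gt0 t; lia.
Qed.

Lemma nth_drop_at (s : seq nat) p i r : drop p s = r -> nth 0 s (p + i) = nth 0 r i.
Proof. by move=> <-; rewrite nth_drop. Qed.

Lemma term_at_code inp p t : term_at inp p t -> nth 0 inp p = tcode t.
Proof.
move=> [r e]; rewrite -[p]addn0 (nth_drop_at 0 e).
by case: (enc_term_cons t) => r' ->.
Qed.

Lemma term_at_kid inp p t o u :
  term_at inp p t -> List.In (o, u) (kids t) -> term_at inp (p + o) u.
Proof.
move=> [r e]; rewrite /term_at addnC -drop_drop e.
case: t {e} => [A|a|u1 v1|u1 v1|u1|u1|u1] //= [[<- <-]|] //=;
  try by rewrite drop0 -?catA; eexists.
- by case=> // -[<- <-]; rewrite /= -catA drop_size_cat //; eexists.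
- by case=> // -[<- <-]; rewrite /= -catA drop_size_cat //; eexists.
Qed.

Lemma kids_size t o u : List.In (o, u) (kids t) ->
  0 < o /\ o + size (enc_term u) <= size (enc_term t).
Proof.
case: t => [A|a|u1 v1|u1 v1|u1|u1|u1] //= [[<- <-]|] //=; rewrite ?size_cat; try lia.
- by case=> // -[<- <-]; lia.
- by case=> // -[<- <-]; lia.
Qed.

(* [sub_at q0 p0 t0 q p t]: when [t0] is placed at [p0] below parent [q0],
   its subterm [t] is at [p] and has parent [q]. *)
Inductive sub_at : nat -> nat -> term Sigma NT ->
    nat -> nat -> term Sigma NT -> Prop :=
| SubRefl q p t : sub_at q p t q p t
| SubKid q0 p0 t0 o u q p t : List.In (o, u) (kids t0) ->
    sub_at p0 (p0 + o) u q p t -> sub_at q0 p0 t0 q p t.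

Lemma sub_at_kid q0 p0 t0 q p t o u : sub_at q0 p0 t0 q p t ->
  List.In (o, u) (kids t) -> sub_at q0 p0 t0 p (p + o) u.
Proof.
elim=> {q0 p0 t0 q p t} [q p t i1|q0 p0 t0 o' u' q p t i1 _ IH i2].
  by apply: SubKid i1 _; exact: SubRefl.
by apply: SubKid i1 _; exact: IH.
Qed.

Lemma sub_at_inv q0 p0 t0 q p t : sub_at q0 p0 t0 q p t ->
  [/\ q = q0, p = p0 & t = t0] \/
  exists q' t' o, [/\ sub_at q0 p0 t0 q' q t', List.In (o, t) (kids t') & p = q + o].
Proof.
elim=> {q0 p0 t0 q p t} [q p t|q0 p0 t0 o' u' q p t i1 _ IH]; first by left.
right; case: IH => [[-> -> ->]|[q' [t' [o [s1 i2 ->]]]]].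
  by exists q0, t0, o'; split=> //; exact: SubRefl.
by exists q', t', o; split=> //; apply: SubKid i1 _.
Qed.

(** Finds the parent of position [x] by descending into the argument whose interval contains it.
    That this is a function of [x] is how uniqueness of parents is obtained from the relation
    [sub_at]. *)
Fixpoint parent_in (q p : nat) t (x : nat) : option nat :=
  if x == p then Some q else
  match t with
  | TAtom _ | TNonterm _ => None
  | TAnd u v | TOr u v =>
      if x < p + 1 + size (enc_term u) then parent_in p (p + 1) u x
      else parent_in p (p + (1 + size (enc_term u))) v x
  | TNot u | TBox u | TDia u => parent_in p (p + 1) u x
  end.

Lemma sub_at_parent q0 p0 t0 q p t : sub_at q0 p0 t0 q p t ->
  [/\ p0 <= p, p + size (enc_term t) <= p0 + size (enc_term t0)
    & parent_in q0 p0 t0 p = Some q].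
Proof.
elim=> {q0 p0 t0 q p t} [q p t|q0 p0 t0 o u q p t i1 _ [h1 h2 h3]].
  by split=> //; case: t => //= *; rewrite eqxx.
have [o0 os] := kids_size i1; have tg := size_enc_term_gt0 t.
have pp : (p == p0) = false by lia.
split; [lia | lia | move: i1 h1 h2 h3 {o0 os}].
by case: t0 => [A|a|u1 v1|u1 v1|u1|u1|u1] //= [[<- <-]|] //=; rewrite ?pp //=;
   try (by case: ifP => //; lia); case=> // -[<- <-]; case: ifP => //; lia.
Qed.

Lemma sub_at_term_at inp q0 p0 t0 q p t : sub_at q0 p0 t0 q p t ->
  term_at inp p0 t0 -> term_at inp p t.
Proof.
elim=> {q0 p0 t0 q p t} [//|q0 p0 t0 o u q p t i1 _ IH] h.
by apply: IH; apply: term_at_kid i1.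
Qed.

End Grammar.

(** * Derivations, and positions of rules and subterms *)

Section Instance.
Variables (Sigma : finType) (Pos Neg : seq (kripke Sigma)) (G : rtg Sigma).
Local Notation NT := (nonterm G).

(** Derivation in big steps, without the intermediate terms of [rewrites]. Completeness of the
    solver is proved by induction on it. *)
Inductive gen : term Sigma NT -> form Sigma -> Prop :=
| GenAtom a : gen (TAtom a) (FAtom a)
| GenAnd u v f g : gen u f -> gen v g -> gen (TAnd u v) (FAnd f g)
| GenOr u v f g : gen u f -> gen v g -> gen (TOr u v) (FOr f g)
| GenNot u f : gen u f -> gen (TNot u) (FNot f)
| GenBox u f : gen u f -> gen (TBox u) (FBox f)
| GenDia u f : gen u f -> gen (TDia u) (FDia f)
| GenRule A t f : List.In (A, t) (rules G) -> gen t f -> gen (TNonterm A) f.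

Lemma gen_term_of_form f : gen (term_of_form NT f) f.
Proof. by elim: f => *; constructor. Qed.

Lemma gen_rewrites t t' f : rewrites t t' -> gen t' f -> gen t f.
Proof.
move=> rw; elim: rw f => {t t'} [A t i|t t' u _ IH|t t' u _ IH|t t' u _ IH
  |t t' u _ IH|t t' _ IH|t t' _ IH|t t' _ IH] f g; first exact: GenRule i g.
all: by inversion g; subst; constructor; auto.
Qed.

Local Notation rtc := (clos_refl_trans _ (@rewrites Sigma G)).

Lemma rtc_congr (C : term Sigma NT -> term Sigma NT) t t' :
  (forall u u', rewrites u u' -> rewrites (C u) (C u')) ->
  rtc t t' -> rtc (C t) (C t').
Proof.
move=> HC; elim=> [u u' r|u|u v w _ IH1 _ IH2]; first exact/rt_step/HC.
  exact: rt_refl.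
exact: rt_trans IH1 IH2.
Qed.

(** From left to right, [gen] holds at the final term and is pulled back along each rewriting step.
    Conversely, a big-step derivation is carried out one argument at a time, in context. *)
Lemma language_gen f : language G f <-> gen (TNonterm (start_nonterm G)) f.
Proof.
split.
  rewrite /language => h; move: (gen_term_of_form f).
  elim: h => [t t' r|//|t u v _ IH1 _ IH2 /IH2/IH1 //]; exact: gen_rewrites.
rewrite /language; elim=> {f} /= [a|u v f g _ IH1 _ IH2|u v f g _ IH1 _ IH2
  |u f _ IH|u f _ IH|u f _ IH|A t f i _ IH].
- exact: rt_refl.
- apply: (@rt_trans _ _ _ (TAnd (term_of_form NT f) v)).
    by apply: (@rtc_congr (fun w => TAnd w v)) IH1 => *; apply: RwAndL.
  by apply: (@rtc_congr (TAnd _)) IH2 => *; apply: RwAndR.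
- apply: (@rt_trans _ _ _ (TOr (term_of_form NT f) v)).
    by apply: (@rtc_congr (fun w => TOr w v)) IH1 => *; apply: RwOrL.
  by apply: (@rtc_congr (TOr _)) IH2 => *; apply: RwOrR.
- by apply: (@rtc_congr (@TNot _ _)) IH => *; apply: RwNot.
- by apply: (@rtc_congr (@TBox _ _)) IH => *; apply: RwBox.
- by apply: (@rtc_congr (@TDia _ _)) IH => *; apply: RwDia.
- exact: rt_trans (rt_step _ _ _ _ (RwRule i)) IH.
Qed.

(** Indexed by the tags of the encoding, so that it can be applied to the value of the variable
    [vc]. *)
Definition fop (c : nat) (f g : form Sigma) : form Sigma :=
  match c with
  | 1 => FAnd f g | 2 => FOr f g | 3 => FNot f | 4 => FBox f | _ => FDia f
  end.

Lemma gen_unary t u f : 2 < tcode t < 6 -> List.In (1, u) (kids t) -> gen u f ->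
  gen t (fop (tcode t) f f).
Proof. by case: t => //= v _ [[->]|//] g; constructor. Qed.

Lemma gen_binary t u v o f g : 0 < tcode t < 3 -> kids t = [:: (1, u); (o, v)] ->
  gen u f -> gen v g -> gen t (fop (tcode t) f g).
Proof. by case: t => //= t1 t2 _ [-> _ ->] g1 g2; constructor. Qed.

Local Notation inp := (enc_instance Pos Neg G).
Local Notation Ks := (Pos ++ Neg).

Definition enc_rules (rs : seq (NT * term Sigma NT)) : seq nat :=
  flatten [seq nat_of_ord (enum_rank r.1) :: enc_term r.2 | r <- rs].

Definition enc_rules_prefix : seq nat :=
  [:: #|Sigma|; size Pos; size Neg] ++ flatten [seq enc_kripke K | K <- Ks]
  ++ [:: #|NT|; nat_of_ord (enum_rank (start_nonterm G)); size (rules G)].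

Lemma enc_instanceE : inp = enc_rules_prefix ++ enc_rules (rules G).
Proof. by rewrite /enc_instance /enc_rules_prefix /enc_rtg -!catA. Qed.

Definition rules_pos : nat := size enc_rules_prefix.

Definition hdr (h : nat) A t : Prop :=
  exists pre post, rules G = pre ++ (A, t) :: post /\ h = rules_pos + size (enc_rules pre).

Definition isub q p t : Prop :=
  exists h A t0, hdr h A t0 /\ sub_at h h.+1 t0 q p t.

Lemma isub_root h A t : hdr h A t -> isub h h.+1 t.
Proof. by move=> hh; exists h, A, t; split=> //; exact: SubRefl. Qed.

Lemma isub_kid q p t o u : isub q p t -> List.In (o, u) (kids t) -> isub p (p + o) u.
Proof. by move=> [h [A [t0 [hh s]]]] i; exists h, A, t0; split=> //; apply: sub_at_kid s i. Qed.

Lemma isub_inv q p t : isub q p t ->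
  (exists2 A, hdr q A t & p = q.+1) \/
  exists q' t' o, [/\ isub q' q t', List.In (o, t) (kids t') & p = q + o].
Proof.
move=> [h [A [t0 [hh /sub_at_inv]]]] [[-> -> ->]|[q' [t' [o [s i ->]]]]].
  by left; exists A.
by right; exists q', t', o; split=> //; exists h, A, t0.
Qed.

Lemma enc_rules_cat r1 r2 : enc_rules (r1 ++ r2) = enc_rules r1 ++ enc_rules r2.
Proof. by rewrite /enc_rules map_cat flatten_cat. Qed.

Lemma hdr_drop h A t : hdr h A t -> exists r,
  drop h inp = nat_of_ord (enum_rank A) :: enc_term t ++ r.
Proof.
move=> [pre [post [e ->]]]; exists (enc_rules post).
rewrite enc_instanceE e enc_rules_cat catA drop_cat size_cat ltnn subnn drop0.
by [].
Qed.

Lemma hdr_nt h A t : hdr h A t -> nth 0 inp h = enum_rank A.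
Proof. by case/hdr_drop => r e; rewrite -[h]addn0 (nth_drop_at _ e). Qed.

Lemma hdr_term_at h A t : hdr h A t -> term_at inp h.+1 t.
Proof.
by case/hdr_drop => r e; exists r; rewrite -addn1 addnC -drop_drop e /= drop0.
Qed.

Lemma isub_term_at q p t : isub q p t -> term_at inp p t.
Proof. by move=> [h [A [t0 [/hdr_term_at h1 s]]]]; exact: sub_at_term_at s h1. Qed.

(** Positions of rules and subterms are therefore nonzero, which frees 0 to mean no parent or end of
    list. *)
Lemma rules_pos_gt5 : 5 < rules_pos.
Proof. by rewrite /rules_pos !size_cat /=; lia. Qed.

Lemma hdr_ge h A t : hdr h A t -> rules_pos <= h.
Proof. by move=> [pre [post [_ ->]]]; rewrite leq_addr. Qed.

Lemma isub_gt q p t : isub q p t -> rules_pos < p.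
Proof.
by move=> [h [A [t0 [/hdr_ge h1 /sub_at_parent[h2 _ _]]]]]; apply: leq_ltn_trans h1 h2.
Qed.

Lemma isub_parent_ge q p t : isub q p t -> rules_pos <= q /\ q < p.
Proof.
move=> s; case: (isub_inv s) => [[A /hdr_ge h ->]//|[q' [t' [o [/isub_gt/ltnW h i ->]]]]].
by have [o0 _] := kids_size i; split=> //; lia.
Qed.

(** Extends [parent_in] to the whole grammar. Its value is [None] at rules, so it yields both the
    uniqueness of parents and the disjointness of rule positions from subterm positions. *)
Fixpoint rules_parent (p : nat) (rs : seq (NT * term Sigma NT)) (x : nat) : option nat :=
  if rs is r :: rs' then
    if x == p then None
    else if x < p + 1 + size (enc_term r.2) then parent_in p p.+1 r.2 x
    else rules_parent (p + 1 + size (enc_term r.2)) rs' x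
  else None.

Lemma rules_parent_cat p pre rs x : p + size (enc_rules pre) <= x ->
  rules_parent p (pre ++ rs) x = rules_parent (p + size (enc_rules pre)) rs x.
Proof.
elim: pre p => [|r pre IH] p /=; first by rewrite addn0.
rewrite /enc_rules /= size_cat -/(enc_rules pre) => h.
have -> : (x == p) = false by lia.
have -> : (x < p + 1 + size (enc_term r.2)) = false by lia.
by rewrite IH; [congr rules_parent; lia | lia].
Qed.

Lemma isub_rules_parent q p t : isub q p t ->
  rules_parent rules_pos (rules G) p = Some q.
Proof.
move=> [h [A [t0 [[pre [post [-> hE]]] /sub_at_parent[h1 h2 h3]]]]].
rewrite rules_parent_cat -hE /=; last by lia.
have := size_enc_term_gt0 t => tg.
have -> : (p == h) = false by lia.
by have -> : p < h + 1 + size (enc_term t0) by lia.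
Qed.

Lemma hdr_rules_parent h A t : hdr h A t -> rules_parent rules_pos (rules G) h = None.
Proof.
by move=> [pre [post [-> ->]]]; rewrite rules_parent_cat //= eqxx.
Qed.

Lemma hdr_isub_disj p A t q u : hdr p A t -> isub q p u -> False.
Proof. by move=> /hdr_rules_parent h1 /isub_rules_parent; rewrite h1. Qed.

Lemma isub_inj q p t q' t' : isub q p t -> isub q' p t' -> q = q' /\ t = t'.
Proof.
move=> s1 s2; split; last exact: term_at_inj (isub_term_at s1) (isub_term_at s2).
by have := isub_rules_parent s1; rewrite (isub_rules_parent s2) => -[].
Qed.

Lemma hdr_inj h A t A' t' : hdr h A t -> hdr h A' t' -> A = A' /\ t = t'.
Proof.
move=> h1 h2; split; last exact: term_at_inj (hdr_term_at h1) (hdr_term_at h2).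
by apply/enum_rank_inj/val_inj; rewrite /= -(hdr_nt h1) (hdr_nt h2).
Qed.

Lemma In_hdr A t : List.In (A, t) (rules G) -> exists h, hdr h A t.
Proof.
by move=> i; case: (In_split i) => pre [post e]; exists (rules_pos + size (enc_rules pre)), pre, post.
Qed.

Lemma hdr_In h A t : hdr h A t -> List.In (A, t) (rules G).
Proof. by move=> [pre [post [-> _]]]; exact: In_mid. Qed.

End Instance.

Lemma nth_cat_size (T : Type) (x0 : T) s t i : nth x0 (s ++ t) (size s + i) = nth x0 t i.
Proof. by rewrite nth_cat ltnNge leq_addr /= addKn. Qed.

Lemma flat_index_lt i j a b : i < a -> j < b -> i * b + j < a * b.
Proof. nia. Qed.

(** * Dags and their prefixes *)

Section Dags.
Variable Sigma : Type.
Implicit Types (d : seq (dag_node Sigma)) (fs : seq (form Sigma)).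

Lemma dag_forms_from_cat fs0 d1 d2 :
  dag_forms_from fs0 (d1 ++ d2)
  = obind (fun fs => dag_forms_from fs d2) (dag_forms_from fs0 d1).
Proof. by elim: d1 fs0 => //= x d1 IH fs0; case: node_form. Qed.

Lemma dag_forms_from_take fs0 d fs : dag_forms_from fs0 d = Some fs ->
  size fs = size fs0 + size d /\
  forall j, dag_forms_from fs0 (take j d) = Some (take (size fs0 + j) fs).
Proof.
elim: d fs0 => [|x d IH] fs0 /=.
  by case=> <-; rewrite addn0; split=> // j; rewrite take_oversize // leq_addr.
case ef: node_form => [f|//] /IH[es IHj]; split; first by rewrite es size_rcons addSnnS.
case=> [|j] /=; last by rewrite ef IHj size_rcons addSnnS.
move: (IHj 0); rewrite take0 addn0 size_rcons addn0 /= => -[e].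
have := congr1 (take (size fs0)) e; rewrite -take_min (minn_idPl (leqnSn _)) => <-.
by rewrite -cats1 take_size_cat.
Qed.

(** A node depends only on earlier ones, so cutting the dag behind node [j] leaves its formula at
    the end. The output is cut in this way at the witness. *)
Lemma dag_form_take d fs j f : dag_forms_from [::] d = Some fs ->
  onth fs j = Some f -> dag_form (take j.+1 d) = Some f.
Proof.
case/dag_forms_from_take => _ /(_ j.+1) e ef; rewrite /dag_form e /=.
have jf : j < size fs by rewrite -onthTE ef.
rewrite (take_nth f) // rev_rcons /=.
by rewrite (onth_nth _ _ _ _ ef).
Qed.

End Dags.

(** * Sets of nodes as numbers, and the layout of the structures *)

Section Instance.
Variables (Sigma : finType) (Pos Neg : seq (kripke Sigma)) (G : rtg Sigma).
Local Notation inp := (enc_instance Pos Neg G).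
Local Notation Ks := (Pos ++ Neg).

Definition nodes (Ls : seq (kripke Sigma)) : nat :=
  sumn [seq #|knode K| | K <- Ls].

Definition kbits (f : form Sigma) (K : kripke Sigma) : seq bool :=
  [seq sat u f | u <- enum (knode K)].

Definition bits (f : form Sigma) : seq bool := flatten [seq kbits f K | K <- Ks].

(** The behaviour of [f]: the set of nodes at which it holds, as an [N]-bit number with the first
    node in the top bit. *)
Definition beh (f : form Sigma) : nat := pack (bits f).

Lemma size_kbits f K : size (kbits f K) = #|knode K|.
Proof. by rewrite size_map -cardE. Qed.

Lemma size_flatten_kbits f Ls : size (flatten [seq kbits f K | K <- Ls]) = nodes Ls.
Proof.
by elim: Ls => //= K Ls IH; rewrite size_cat size_kbits IH.
Qed.

Lemma size_bits f : size (bits f) = nodes Ks.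
Proof. exact: size_flatten_kbits. Qed.

Lemma beh_lt f : beh f < 2 ^ nodes Ks.
Proof. by rewrite -(size_bits f) pack_lt. Qed.

(** Locating the structure by a splitting of the list, and not by an index, gives the type of [u]
    directly, without a default structure. *)
Definition node_at (i : nat) (K1 : seq (kripke Sigma)) (K : kripke Sigma)
    (u : knode K) : Prop :=
  (exists K2, Ks = K1 ++ K :: K2) /\ i = nodes K1 + enum_rank u.

Lemma nodes_cat K1 K2 : nodes (K1 ++ K2) = nodes K1 + nodes K2.
Proof. by rewrite /nodes map_cat sumn_cat. Qed.

Lemma node_at_ex i : i < nodes Ks -> exists K1 K (u : knode K), node_at i K1 u.
Proof.
suff H (L2 L1 : seq (kripke Sigma)) : Ks = L1 ++ L2 -> nodes L1 <= i < nodes Ks ->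
    exists K1 K (u : knode K), node_at i K1 u.
  by move=> h; apply: (H Ks [::]).
elim: L2 L1 => [|K L2 IH] L1 e.
  by rewrite e cats0; case: ltngtP.
case/andP=> h1 h2; case: (ltnP i (nodes (L1 ++ [:: K]))) => h3; last first.
  by apply: (IH (rcons L1 K)); rewrite ?cat_rcons // -cats1 h3.
rewrite nodes_cat {2}/nodes /= addn0 in h3.
have h4 : i - nodes L1 < #|knode K| by rewrite ltn_subLR.
exists L1, K, (enum_val (Ordinal h4)); split; first by exists L2.
by rewrite enum_valK /= subnKC.
Qed.

Lemma nth_enum_map (T : finType) (A : Type) (x0 : A) (F : T -> A) (u : T) :
  nth x0 [seq F v | v <- enum T] (enum_rank u) = F u.
Proof.
rewrite (nth_map u) ?nth_enum_rank // -cardE; exact: ltn_ord.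
Qed.

Lemma node_at_lt i K1 K (u : knode K) : node_at i K1 u -> i < nodes Ks.
Proof.
move=> [[K2 ->] ->]; rewrite nodes_cat ltn_add2l /nodes /=.
by apply: leq_trans (ltn_ord _) _; rewrite leq_addr.
Qed.

Lemma nth_bits f i K1 K (u : knode K) : node_at i K1 u ->
  nth false (bits f) i = sat u f.
Proof.
move=> [[K2 e] ->]; rewrite /bits e map_cat /= -(size_flatten_kbits f K1).
rewrite onth_nth_flatten; last by rewrite size_kbits; exact: ltn_ord.
exact: nth_enum_map.
Qed.

(** Whether a structure is positive is decided by its index in [Pos ++ Neg], as in the solver; a
    structure in both lists is asked to satisfy and to refute [f]. *)
Definition good (f : form Sigma) : Prop :=
  forall K1 K K2, Ks = K1 ++ K :: K2 -> models K f = (size K1 < size Pos).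

Lemma good_separates f : language G f -> good f -> separates Pos Neg G f.
Proof.
move=> lf gf; split=> // K i; case: (In_split i) => s1 [s2 e].
  rewrite (gf s1 K (s2 ++ Neg)) ?e ?size_cat /= ?addnS ?ltnS ?leq_addr //.
  by rewrite -catA.
rewrite (gf (Pos ++ s1) K s2) ?e ?catA // size_cat -leqNgt.
exact: leq_addr.
Qed.

Lemma separates_good f : separates Pos Neg G f -> good f.
Proof.
move=> [_ pos neg] K1 K K2 e; case: (ltnP (size K1) (size Pos)) => h.
  apply: pos; have := congr1 (take (size Pos)) e.
  rewrite take_size_cat // take_cat ltnNge ltnW //=.
  have -> : size Pos - size K1 = (size Pos - (size K1).+1).+1 by lia.
  by move=> /= ->; exact: In_mid.
apply/negbTE/neg; have := congr1 (drop (size Pos)) e.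
rewrite drop_size_cat // drop_cat; case: ltnP => [_ ->|h']; first exact: In_mid.
have -> : size Pos - size K1 = 0 by lia.
by rewrite drop0 => ->; left.
Qed.

Definition kripkes_pos (L : seq (kripke Sigma)) : nat :=
  3 + size (flatten [seq enc_kripke K | K <- L]).

Lemma size_enc_kripke (K : kripke Sigma) :
  size (enc_kripke K) = 2 + #|knode K| * #|knode K| + #|knode K| * #|Sigma|.
Proof.
by rewrite /enc_kripke !size_cat !size_allpairs -!cardE /=; lia.
Qed.

Lemma drop_kripke K1 K K2 : Ks = K1 ++ K :: K2 -> exists r,
  drop (kripkes_pos K1) inp = enc_kripke K ++ r.
Proof.
move=> e; rewrite /enc_instance /kripkes_pos addnC -drop_drop /= drop0 e.
rewrite map_cat flatten_cat /= -!catA drop_size_cat //.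
by exists (flatten [seq enc_kripke K | K <- K2] ++ enc_rtg G); rewrite /enc_kripke /= -!catA.
Qed.

Lemma nth_allpairs_flat (A B : finType) (F : A -> B -> nat) (u : A) (v : B) :
  nth 0 [seq F x y | x <- enum A, y <- enum B]
    (enum_rank u * #|B| + enum_rank v) = F u v.
Proof.
suff H (s : seq A) (t : seq B) i j : i < size s -> j < size t ->
    nth 0 [seq F x y | x <- s, y <- t] (i * size t + j) = F (nth u s i) (nth v t j).
  have hu : enum_rank u < size (enum A) by rewrite -cardE.
  have hv : enum_rank v < size (enum B) by rewrite -cardE.
  by have := H _ _ _ _ hu hv; rewrite !nth_enum_rank -cardE.
elim: s i => //= x s IH [|i] /= hi jt; first by rewrite nth_cat size_map jt (nth_map v).
by rewrite nth_cat size_map mulSn -addnA ltnNge leq_addr /= addKn IH.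
Qed.

Section OneKripke.
Variables (K1 : seq (kripke Sigma)) (K : kripke Sigma) (K2 : seq (kripke Sigma)).
Hypothesis eK : Ks = K1 ++ K :: K2.
Local Notation p := (kripkes_pos K1).

Lemma kripke_bound : p + size (enc_kripke K) <= size inp.
Proof.
case: (drop_kripke eK) => r e; have := size_drop p inp; rewrite e size_cat.
by rewrite size_enc_kripke; lia.
Qed.

Lemma kripke_card : nth 0 inp p = #|knode K|.
Proof. by case: (drop_kripke eK) => r e; rewrite -[p]addn0 (nth_drop_at _ e). Qed.

Lemma kripke_start : nth 0 inp (p + 1) = enum_rank (kstart K).
Proof. by case: (drop_kripke eK) => r e; rewrite (nth_drop_at _ e). Qed.

Lemma kripke_edge (u v : knode K) :
  nth 0 inp (p + (2 + (enum_rank u * #|knode K| + enum_rank v))) = kedge u v.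
Proof.
case: (drop_kripke eK) => r e.
rewrite (nth_drop_at _ e) /enc_kripke -!catA (nth_cat_size _ [:: _; _]).
rewrite nth_cat size_allpairs -!cardE.
rewrite (flat_index_lt (ltn_ord (enum_rank u)) (ltn_ord (enum_rank v))).
exact: (nth_allpairs_flat (fun u v => nat_of_bool (kedge u v))).
Qed.

Lemma kripke_label (u : knode K) (a : Sigma) :
  nth 0 inp (p + (2 + #|knode K| * #|knode K| + (enum_rank u * #|Sigma| + enum_rank a)))
  = (a \in klabel u).
Proof.
case: (drop_kripke eK) => r e; rewrite -addnA (nth_drop_at _ e).
rewrite /enc_kripke -!catA (nth_cat_size _ [:: _; _]).
rewrite nth_cat size_allpairs -!cardE ltnNge leq_addr /= addKn.
rewrite nth_cat size_allpairs -!cardE.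
rewrite (flat_index_lt (ltn_ord (enum_rank u)) (ltn_ord (enum_rank a))).
exact: (nth_allpairs_flat (fun u a => nat_of_bool (a \in klabel u))).
Qed.

End OneKripke.

Lemma kripkes_posS K1 K :
  kripkes_pos (rcons K1 K) = kripkes_pos K1 + size (enc_kripke K).
Proof.
by rewrite /kripkes_pos map_rcons flatten_rcons size_cat; lia.
Qed.

Lemma rules_posE : rules_pos Pos Neg G = kripkes_pos Ks + 3.
Proof. by rewrite /rules_pos /enc_rules_prefix /kripkes_pos !size_cat /=; lia. Qed.

Lemma nth_start : nth 0 inp (kripkes_pos Ks + 1) = enum_rank (start_nonterm G).
Proof.
rewrite /enc_instance /kripkes_pos catA nth_cat size_cat /= addnC.
rewrite -[X in X < _]addnC ltnNge leq_addr /=.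
by rewrite addnC addKn.
Qed.

Lemma inp0 : nth 0 inp 0 = #|Sigma|. Proof. by []. Qed.
Lemma inp1 : nth 0 inp 1 = size Pos. Proof. by []. Qed.
Lemma inp2 : nth 0 inp 2 = size Neg. Proof. by []. Qed.

(** A leaf takes two cells and an operator one, and a rule adds the rank of its left-hand side. The
    structures lie before [rules_pos], outside the part that is linear in the grammar. *)
Lemma size_inp_bound : size inp <= rules_pos Pos Neg G + 3 * rtg_size G.
Proof.
have ht (NT : finType) (t : term Sigma NT) : size (enc_term t) <= 2 * term_size t.
  by elim: t => //= *; rewrite ?size_cat; lia.
rewrite enc_instanceE size_cat -/(rules_pos Pos Neg G) leq_add2l /rtg_size.
apply: leq_trans (_ : 3 * \sum_(r <- rules G) (term_size r.2).+1 <= _); last by lia.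
rewrite big_distrr /=; elim: (rules G) => [|r rs IH]; first by rewrite big_nil.
rewrite big_cons /enc_rules /= size_cat -/(enc_rules rs).
by have := ht _ r.2; lia.
Qed.

Lemma rules_pos_size : rules_pos Pos Neg G <= size inp.
Proof. by rewrite enc_instanceE size_cat leq_addr. Qed.

Lemma nodes_le : nodes Ks <= (size Pos + size Neg) * \max_(K <- Ks) ksize K.
Proof.
rewrite -size_cat; set n := \max_(_ <- _) _.
have : forall K, List.In K Ks -> ksize K <= n.
  rewrite /n; elim: (Ks) => //= K L IH K' [->|i]; rewrite big_cons leq_max ?leqnn //.
  by rewrite IH ?orbT.
elim: (Ks) => //= K L IH H.
rewrite mulSn leq_add //; first by apply: (H K); left.
by apply: IH => K' i; apply: H; right.
Qed.

(** The start node makes every structure nonempty; the loop over the structures is thereby bounded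
    in terms of the nodes. *)
Lemma size_le_nodes L : size L <= nodes L.
Proof.
elim: L => //= K L IH; rewrite /nodes /= -/(nodes L) -add1n leq_add //.
by apply/card_gt0P; exists (kstart K).
Qed.

End Instance.

(** * Bit vectors, operators and the acceptance test *)

Arguments den : simpl never.
Arguments cell : simpl never.
Arguments enc_instance : simpl never.

Lemma denS inp c1 c2 s : den inp (c1 ;; c2) s = den inp c2 (den inp c1 s).
Proof. by []. Qed.
Lemma denA inp x e s : den inp (x ::= e) s = setv s x (eval inp s e).
Proof. by []. Qed.
Lemma denT inp a e1 e2 s :
  den inp (a@[e1] ::= e2) s = seta s a (eval inp s e1) (eval inp s e2).
Proof. by []. Qed.
Lemma denI inp e c1 c2 s : den inp (CIf e c1 c2) s
  = if eval inp s e == 0 then den inp c2 s else den inp c1 s.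
Proof. by []. Qed.
Lemma den0 inp s : den inp CSkip s = s.
Proof. by []. Qed.

Lemma cellE inp s i : i < size inp -> cell inp s i = nth 0 inp i.
Proof. by rewrite /cell => ->. Qed.

(** The side conditions of the frame lemmas are closed Booleans that compute to [true], so [isT]
    proves them by conversion. *)
Ltac frame :=
  repeat match goal with
  | |- context [var (den ?i ?c ?s) ?x] => rewrite (@var_frame i c s x isT)
  | |- context [arr (den ?i ?c ?s) ?a] => rewrite (@arr_frame i c s a isT)
  end.

Ltac ev := repeat progress rewrite ?denS ?denA ?denT ?den0 ?updE /=.

Lemma double_loop inp x s :
  var (den inp (CLoop vN (x ::= $x [+] $x)) s) x = var s x * 2 ^ var s vN.
Proof.
apply: (@loop_inv inp vN (x ::= $x [+] $x) s (fun i t => var t x = var s x * 2 ^ i)).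
  by rewrite muln1.
by move=> i t _ _ e; rewrite denA /= updE eqxx e expnS; lia.
Qed.

Lemma lookup_ok inp s :
  var (den inp lookup s) vx = var s tp * 2 ^ var s vN + var s ts.
Proof. by rewrite /lookup !denS !denA /= updE /= double_loop /=; frame. Qed.

Lemma pack_cons b s : pack (b :: s) = b * 2 ^ size s + pack s.
Proof. by rewrite -cat1s pack_cat. Qed.

Lemma drop_nth_cons (s : seq bool) i : i < size s ->
  drop i s = nth false s i :: drop i.+1 s.
Proof. exact: drop_nth. Qed.

Lemma unpack_ok inp a x s f : size f = var s vN -> var s vB = 2 ^ size f ->
  var s x = pack f -> forall i, i < size f ->
  arr (den inp (unpack a x) s) a i = nth false f i.
Proof.
move=> sf eB ex; rewrite /unpack !denS; set s0 := den inp (vi ::= _) _.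
(* After [i] rounds [vy] is the number formed by the unread bits, shifted to the top by [i]
   places. *)
have := @loop_inv inp vN (vy ::= $vy [+] $vy ;;
     CIf ($vy [+] EC 1 [-] $vB)
       (a@[$vi] ::= EC 1 ;; vy ::= $vy [-] $vB)
       (a@[$vi] ::= EC 0) ;;
     incr vi) s0 (fun i t => [/\ var t vi = i, var t vy = pack (drop i f) * 2 ^ i
  & forall j, j < i -> arr t a j = nth false f j]).
have eN : var s0 vN = size f by rewrite /s0 /= sf.
rewrite eN; case.
- by split=> //; rewrite /s0 !denA /= drop0 muln1 ex.
- move=> i t i_lt [frv _] [e1 e2 e3].
  have eBt : var t vB = 2 ^ size f by rewrite frv // /s0 /= eB.
  (* The bits after bit [i] stay below 2^N, so the doubled value reaches 2^N exactly if bit [i] is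
     set. *)
  have lt1 : pack (drop i.+1 f) * 2 ^ i.+1 < 2 ^ size f.
    rewrite -(subnK i_lt) expnD ltn_pmul2r ?expn_gt0 //.
    by rewrite -size_drop pack_lt.
  have e4 : 2 ^ (size f - i.+1) * 2 ^ i.+1 = 2 ^ size f by rewrite -expnD subnK.
  have e5 : var t vy + var t vy
      = nth false f i * 2 ^ size f + pack (drop i.+1 f) * 2 ^ i.+1.
    rewrite e2 (drop_nth_cons i_lt) pack_cons size_drop -e4 expnS.
    by move: (2 ^ _) (2 ^ i) (nat_of_bool _) (pack _) => *; lia.
  rewrite !denS denA denI; ev; rewrite eBt e5.
  case eb: (nth false f i) e5 => /= e5.
    have -> : (1 * 2 ^ size f + pack (drop i.+1 f) * 2 ^ i.+1 + 1 - 2 ^ size f == 0) = false.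
      by lia.
    ev; rewrite e1 eqxx; split=> //; [by lia | by lia | move=> j].
    by rewrite ltnS leq_eqVlt updE; case: eqP => [-> _|_ /=]; [rewrite eb|exact: e3].
  have -> : (0 * 2 ^ size f + pack (drop i.+1 f) * 2 ^ i.+1 + 1 - 2 ^ size f == 0).
    by lia.
  ev; rewrite e1 eqxx; split=> //; [by lia | move=> j].
  by rewrite ltnS leq_eqVlt updE; case: eqP => [-> _|_ /=]; [rewrite eb|exact: e3].
- by case.
Qed.

Section Instance.
Variables (Sigma : finType) (Pos Neg : seq (kripke Sigma)) (G : rtg Sigma).
Local Notation inp := (enc_instance Pos Neg G).
Local Notation Ks := (Pos ++ Neg).
Local Notation N := (nodes Ks).
Local Notation bits := (bits Pos Neg).
Local Notation beh := (beh Pos Neg).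
Local Notation node_at := (node_at Pos Neg).
Local Notation den := (den inp).

(** Stated for a prefix [Ls] of the structures, so that it can serve as an invariant of the scan. *)
Definition nodes_below (Ls : seq (kripke Sigma)) (s : state) : Prop :=
  forall K1 K K2 L2 (u : knode K), Ks = K1 ++ K :: K2 -> Ls = K1 ++ K :: L2 ->
  let i := nodes K1 + enum_rank u in
  [/\ arr s aFs i = nodes K1, arr s aSz i = #|knode K|,
      arr s aEr i = kripkes_pos K1 + 2 + enum_rank u * #|knode K|,
      arr s aLr i = kripkes_pos K1 + 2 + #|knode K| * #|knode K|
                      + enum_rank u * #|Sigma|
    & arr s aWant i = if u == kstart K then (if size K1 < size Pos then 1 else 2)
                      else 0].

Definition nodes_ok (s : state) : Prop :=
  [/\ var s vN = N, var s vB = 2 ^ N & nodes_below Ks s].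

Lemma nodes_ok_frame c s :
  all (fun x => x \notin modv c) [:: vN; vB] ->
  all (fun a => a \notin moda c) [:: aFs; aSz; aEr; aLr; aWant] ->
  nodes_ok s -> nodes_ok (den c s).
Proof.
move=> /and3P[m1 m2 _] /and5P[a1 a2 a3 a4 /andP[a5 _]] [n1 n2 n3].
by split; rewrite ?var_frame // => K1 K K2 L2 u e1 e2; rewrite !arr_frame //; exact: n3 e1 e2.
Qed.

Section Static.
Variable s : state.
Hypothesis ok : nodes_ok s.

Lemma node_ok i K1 K (u : knode K) : node_at i K1 u ->
  [/\ arr s aFs i = nodes K1, arr s aSz i = #|knode K|
    & arr s aWant i = if u == kstart K then (if size K1 < size Pos then 1 else 2)
                      else 0].
Proof. by move=> [[K2 e] ->]; case: ok => _ _ /(_ K1 K K2 K2 u e e)[-> -> _ _ ->]. Qed.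

Lemma cell_edge i K1 K (u v : knode K) : node_at i K1 u ->
  cell inp s (arr s aEr i + enum_rank v) = kedge u v.
Proof.
move=> [[K2 e] ->]; case: ok => _ _ /(_ K1 K K2 K2 u e e)[_ _ -> _ _].
have h := flat_index_lt (ltn_ord (enum_rank u)) (ltn_ord (enum_rank v)).
have hb := kripke_bound G e; rewrite size_enc_kripke in hb.
rewrite -!addnA cellE ?(kripke_edge G e) //.
apply: leq_trans hb; rewrite ltn_add2l -!addnA ltn_add2l.
by apply: leq_trans h _; rewrite leq_addr.
Qed.

Lemma cell_label i K1 K (u : knode K) (a : Sigma) : node_at i K1 u ->
  cell inp s (arr s aLr i + enum_rank a) = (a \in klabel u).
Proof.
move=> [[K2 e] ->]; case: ok => _ _ /(_ K1 K K2 K2 u e e)[_ _ _ -> _].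
have h := flat_index_lt (ltn_ord (enum_rank u)) (ltn_ord (enum_rank a)).
have hb := kripke_bound G e; rewrite size_enc_kripke in hb.
have <- := kripke_label G e u a.
rewrite -!addnA cellE //.
by apply: leq_trans hb; rewrite ltn_add2l -!addnA !ltn_add2l.
Qed.

Lemma label_bits_ok (a : Sigma) : var s dl = enum_rank a ->
  var (den label_bits s) ts = beh (FAtom a).
Proof.
move=> ea; rewrite /label_bits !denS; set s0 := den (vi ::= _) _.
have eN : var s0 vN = N by rewrite /s0; ev; case: ok.
have := @loop_inv inp vN (ts ::= $ts [+] $ts [+] EIn (aLr@($vi) [+] $dl) ;; incr vi)
  s0 (fun i t => var t vi = i /\ var t ts = pack (take i (bits (FAtom a)))).
rewrite eN; case.
- by rewrite take0 /s0; ev.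
- move=> i t iN [frv fra] [e1 e2]; ev; rewrite e1 e2 addn1; split=> //.
  have [K1 [K [u nu]]] := node_at_ex iN.
  rewrite (take_nth false) ?size_bits // pack_rcons (nth_bits _ nu) /=.
  rewrite frv // /s0; ev; rewrite ea fra // -(cell_label a nu).
  by congr (_ + _); rewrite /cell fra.
- by move=> _ ->; rewrite take_oversize ?size_bits.
Qed.

(** [4 < var s vc] is the truth value searched for among the successors: true for a diamond, tag 5,
    and false for a box, tag 4. *)
Lemma modal_ok f i K1 K (u : knode K) : node_at i K1 u ->
  var s vi = i -> var s vr = 0 -> var s vj = 0 ->
  (forall j, j < N -> arr s aB1 j = nth false (bits f) j) ->
  var (den (CLoop vN modal_step) s) vr =
  [exists v : knode K, kedge u v && (sat v f == (4 < var s vc))].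
Proof.
move=> nu ei er ej eb; have [ef ez _] := node_ok nu.
pose E j := [exists v : knode K, [&& nodes K1 + enum_rank v < j, kedge u v
  & sat v f == (4 < var s vc)]].
have eN : var s vN = N by case: ok.
have := @loop_inv inp vN modal_step s
  (fun j t => var t vj = j /\ var t vr = E j).
have E0 : E 0 = false by apply/existsP => -[v]; rewrite ltn0.
rewrite eN; case.
- by rewrite E0 er ej.
- move=> j t jN [frv fra] [e1 e2]; rewrite /modal_step denS denA /= updE /=.
  rewrite var_frame // e1 addn1; split=> //; rewrite updE /=.
  have eS : E j.+1 = E j || [exists v : knode K, [&& nodes K1 + enum_rank v == j, kedge u v
      & sat v f == (4 < var s vc)]].
    apply/existsP/orP => [[v]|[/existsP[v]|/existsP[v]]].
    + rewrite ltnS leq_eqVlt => /and3P[/orP[h1|h1] h2 h3]; [right|left]; apply/existsP; exists v; exact/and3P.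
    + by case/and3P=> h1 h2 h3; exists v; rewrite ltnS ltnW //= h2.
    + by case/and3P=> /eqP<- h2 h3; exists v; rewrite ltnS leqnn h2.
  rewrite eS.
  have none : ~~ (nodes K1 <= j < nodes K1 + #|knode K|) ->
      [exists v : knode K, [&& nodes K1 + enum_rank v == j, kedge u v
      & sat v f == (4 < var s vc)]] = false.
    move=> h; apply/existsP => -[v /and3P[/eqP e _ _]]; case/negP: h.
    by rewrite -e leq_addr ltn_add2l ltn_ord.
  rewrite !denI /= !fra // e1 !frv // ei ef ez.
  case: ifP => [h1|h1]; last by rewrite none ?orbF ?den0 //; lia.
  case: ifP => [h2|h2]; first by rewrite none ?orbF ?den0 //; lia.
  have h3 : j - nodes K1 < #|knode K| by lia.
  pose v := enum_val (Ordinal h3).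
  have ev : enum_rank v = j - nodes K1 :> nat by rewrite enum_valK.
  have nv : node_at j K1 v by case: nu => ex _; split=> //; lia.
  have one : [exists w : knode K, [&& nodes K1 + enum_rank w == j, kedge u w
      & sat w f == (4 < var s vc)]] = kedge u v && (sat v f == (4 < var s vc)).
    apply/existsP/andP => [[w /and3P[/eqP e h4 h5]]|[h4 h5]].
      suff <- : w = v by [].
      by apply/enum_rank_inj/val_inj; rewrite /= ev -e addKn.
    by exists v; rewrite h4 h5 ev; lia.
  rewrite one -ev.
  have -> : cell inp t (arr s aEr i + enum_rank v) = kedge u v.
    by rewrite -(cell_edge v nu) /cell fra.
  case: (kedge u v) => /=; last by rewrite den0 orbF e2.
  rewrite (eb _ jN) (nth_bits f nv) ltnNge -subn_eq0.
  by case: (var s vc - 4 == 0); case: (sat v f) => /=;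
     rewrite ?den0 ?denA /= ?e2 ?updE ?orbT ?orbF.
- move=> _ ->; congr nat_of_bool; apply/existsP/existsP => -[v].
    by case/and3P=> _ h2 h3; exists v; rewrite h2.
  case/andP=> h2 h3; exists v; rewrite h2 h3 !andbT.
  by have := node_at_lt (_ : node_at (nodes K1 + enum_rank v) K1 v); apply; case: nu.
Qed.

End Static.

Lemma op_bit_ok s f g i : nodes_ok s -> 0 < var s vc < 6 -> i < N -> var s vi = i ->
  (forall j, j < N -> arr s aB1 j = nth false (bits f) j) ->
  (forall j, j < N -> arr s aB2 j = nth false (bits g) j) ->
  var (den op_bit s) vr = nth false (bits (fop (var s vc) f g)) i.
Proof.
move=> ok c6 iN ei b1 b2; have [K1 [K [u nu]]] := node_at_ex iN.
rewrite (nth_bits _ nu).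
have m1 := modal_ok (f := f) (s := den (vj ::= EC 0) (den (vr ::= EC 0) s)) _ nu.
rewrite /op_bit denI /=; case: ifP => [h1|h1]; last first.
  rewrite !denS denI; set s1 := den (CLoop _ _) _.
  have er : var s1 vr = [exists v : knode K, kedge u v && (sat v f == (4 < var s vc))].
    by rewrite /s1 m1 //; do 2!apply: nodes_ok_frame => //.
  have ec : var s1 vc = var s vc by rewrite /s1; frame; ev.
  rewrite /= ec; case: ifP => h2; ev; last first.
    have c5 : var s vc = 5 by lia.
    rewrite er c5 /=; congr nat_of_bool; apply/existsP/existsP => -[v hv]; exists v;
    by move: hv; rewrite eqb_id.
  have c4 : var s vc = 4 by lia.
  rewrite er c4 /= -[RHS]/(nat_of_bool [forall v, kedge u v ==> sat v f]).
  rewrite -(negbK [forall v, _]) negb_forall.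
  have -> : [exists v, ~~ (kedge u v ==> sat v f)] = [exists v, kedge u v && (sat v f == false)].
    by apply: eq_existsb => v; rewrite negb_imply eqbF_neg.
  by case: [exists v, _].
rewrite !denI /=.
case: ifP => h2; last first.
  have c3 : var s vc = 3 by lia.
  by ev; rewrite c3 /= ei b1 // (nth_bits _ nu); case: sat.
case: ifP => h3; ev; rewrite ei b1 // b2 // !(nth_bits _ nu).
  have c1 : var s vc = 1 by lia.
  by rewrite c1 /=; case: sat; case: sat.
have c2 : var s vc = 2 by lia.
by rewrite c2 /=; case: sat; case: sat.
Qed.

Lemma operate_ok s f g : nodes_ok s -> 0 < var s vc < 6 ->
  (forall j, j < N -> arr s aB1 j = nth false (bits f) j) ->
  (forall j, j < N -> arr s aB2 j = nth false (bits g) j) ->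
  var (den operate s) ts = beh (fop (var s vc) f g).
Proof.
move=> ok c6 b1 b2; rewrite /operate !denS; set s0 := den (vi ::= _) _.
have ok0 : nodes_ok s0 by do 2!apply: nodes_ok_frame => //.
have eN : var s0 vN = N by case: ok0.
have ec : var s0 vc = var s vc by [].
have := @loop_inv inp vN (op_bit ;; ts ::= $ts [+] $ts [+] $vr ;; incr vi)
  s0 (fun i t => var t vi = i /\ var t ts = pack (take i (bits (fop (var s vc) f g)))).
rewrite eN; case.
- by rewrite take0 /s0; ev.
- move=> i t iN [frv fra] [e1 e2].
  have okt : nodes_ok t.
    case: ok0 => o1 o2 o3; split; rewrite ?frv // => K1 K K2 L2 u k1 k2.
    by rewrite !fra //; exact: o3 k1 k2.
  have ect : var t vc = var s vc by rewrite frv.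
  have er : var (den op_bit t) vr = nth false (bits (fop (var s vc) f g)) i.
    by rewrite -ect (@op_bit_ok t f g i) ?ect // => j jN; rewrite fra // ?b1 ?b2.
  rewrite !denS !denA /= !updE /= er.
  frame; rewrite e1 e2 addn1; split=> //.
  by rewrite (take_nth false) ?size_bits // pack_rcons.
- by move=> _ ->; rewrite take_oversize ?size_bits.
Qed.

(** Only start nodes have a nonzero [aWant], so the loop inspects exactly the bits that decide
    [models]. *)
Lemma check_loop_ok s f : nodes_ok s -> var s vi = 0 -> var s vbad = 0 ->
  (forall j, j < N -> arr s aB1 j = nth false (bits f) j) ->
  (var (den (CLoop vN check_step) s) vbad == 0) <-> good Pos Neg f.
Proof.
move=> ok ei eb b1.
pose bad i := [exists j : 'I_i, [|| (arr s aWant j == 1) && ~~ nth false (bits f) j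
                | (1 < arr s aWant j) && nth false (bits f) j]].
have eN : var s vN = N by case: ok.
have := @loop_inv inp vN check_step s (fun i t => var t vi = i /\ var t vbad = bad i).
rewrite eN; case.
- split=> //; rewrite eb; suff -> : bad 0 = false by [].
  by apply/existsP => -[[]].
- move=> i t iN [frv fra] [e1 e2]; rewrite /check_step denS denA /= !updE /=.
  rewrite var_frame // e1 addn1; split=> //; frame.
  have eS : bad i.+1 = bad i || [|| (arr s aWant i == 1) && ~~ nth false (bits f) i
                | (1 < arr s aWant i) && nth false (bits f) i].
    apply/existsP/orP => [[[j /=]]|[/existsP[j h]|h]].
    + rewrite ltnS leq_eqVlt => /orP[/eqP-> h|ji h]; first by right.
      by left; apply/existsP; exists (Ordinal ji).
    + by exists (widen_ord (leqnSn i) j).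
    + by exists ord_max.
  rewrite eS !denI /= !fra // e1.
  case: ifP => [/eqP->|h0]; first by rewrite orbF den0.
  rewrite b1 //; case: ifP => h1.
    have -> : arr s aWant i = 1 by lia.
    by case: nth => /=; rewrite ?den0 ?denA ?orbF ?orbT ?e2 //= updE.
  have [-> ->] : (arr s aWant i == 1) = false /\ 1 < arr s aWant i by lia.
  by case: nth => /=; rewrite ?den0 ?denA ?orbF ?orbT ?e2 //= updE.
- move=> _ ->; rewrite eqb0; split.
    move=> /existsPn H K1 K K2 e.
    have nu : node_at (nodes K1 + enum_rank (kstart K)) K1 (kstart K) by split=> //; exists K2.
    have [_ _] := node_ok ok nu; rewrite eqxx => hw.
    have := H (Ordinal (node_at_lt nu)); rewrite /= hw (nth_bits f nu).
    by rewrite /models; case: ifP; case: sat.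
  move=> gf; apply/existsPn => j; have [K1 [K [u nu]]] := node_at_ex (ltn_ord j).
  have [_ _ ->] := node_ok ok nu; rewrite (nth_bits f nu).
  case: (u =P kstart K) => //= eu; case: nu => -[K2 e] _.
  have -> : sat u f = (size K1 < size Pos) by rewrite eu; exact: gf e.
  by case: ifP.
Qed.

End Instance.

(** * Correctness and cost of the solver *)

Section Solver.
Variables (Sigma : finType) (Pos Neg : seq (kripke Sigma)) (G : rtg Sigma).
Local Notation inp := (enc_instance Pos Neg G).
Local Notation Ks := (Pos ++ Neg).
Local Notation N := (nodes Ks).
Local Notation L := (size inp).
Local Notation R := (rules_pos Pos Neg G).
Local Notation rank A := (nat_of_ord (enum_rank A)).
Local Notation den := (den inp).
Local Notation beh := (beh Pos Neg).
Local Notation bits := (bits Pos Neg).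
Local Notation good := (good Pos Neg).
Local Notation nodes_below := (@nodes_below Sigma Pos Neg).
Local Notation nodes_ok := (@nodes_ok Sigma Pos Neg).
Local Notation hdr := (@hdr Sigma Pos Neg G).
Local Notation isub := (@isub Sigma Pos Neg G).

(** * Scanning the structures *)

Lemma scan_nodes_ok s w b e l : var s vw = w -> var s vN = b -> var s vu = 0 ->
  var s ver = e -> var s vlr = l ->
  let t := den (CLoop vw scan_node) s in
  [/\ var t vlr = l + w * var s vSig,
    forall j, j < w -> [/\ arr t aFs (b + j) = b, arr t aSz (b + j) = w,
      arr t aEr (b + j) = e + j * w & arr t aLr (b + j) = l + j * var s vSig]
  & forall i, i < b -> [/\ arr t aFs i = arr s aFs i, arr t aSz i = arr s aSz i,
      arr t aEr i = arr s aEr i & arr t aLr i = arr s aLr i]].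
Proof.
move=> ew eb eu ee el /=.
have := @loop_inv inp vw scan_node s (fun i t => [/\ var t vu = i,
    var t ver = e + i * w, var t vlr = l + i * var s vSig,
    forall j, j < i -> [/\ arr t aFs (b + j) = b, arr t aSz (b + j) = w,
      arr t aEr (b + j) = e + j * w & arr t aLr (b + j) = l + j * var s vSig]
  & forall i, i < b -> [/\ arr t aFs i = arr s aFs i, arr t aSz i = arr s aSz i,
      arr t aEr i = arr s aEr i & arr t aLr i = arr s aLr i]]).
rewrite ew; case.
- by rewrite !mul0n !addn0; split.
- move=> i t iw [frv _] [e1 e2 e3 e4 e5].
  have [f1 f2 f3] : [/\ var t vw = w, var t vN = b & var t vSig = var s vSig].
    by rewrite !frv.
  rewrite /scan_node; ev; rewrite e1 e2 e3 f1 f2 f3; split.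
  + by rewrite addn1.
  + by rewrite mulSn; lia.
  + by rewrite mulSn; lia.
  + move=> j; rewrite ltnS leq_eqVlt !updE eqn_add2l.
    by case: eqP => [->|_ /=]; [split|exact: e4].
  + move=> k kb; rewrite !updE; have -> : (k == b + i) = false by lia.
    exact: e5.
- by move=> _ _ e3 e4 e5; split.
Qed.

(** The last clause supplies the zeros of [aWant] at nodes other than start nodes: a single entry is
    written per structure, and the others keep their initial value. *)
Definition scan_inv (k : nat) (t : state) : Prop :=
  [/\ var t vk = k, var t vN = nodes (take k Ks), var t vp = kripkes_pos (take k Ks),
      nodes_below (take k Ks) t
    & forall i, nodes (take k Ks) <= i -> arr t aWant i = 0].

Lemma take_split k : k < size Ks -> exists K,
  Ks = take k Ks ++ K :: drop k.+1 Ks /\ take k.+1 Ks = rcons (take k Ks) K.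
Proof.
move=> h; case E : Ks h => [//|K0 L0] h; rewrite -E in h *.
by exists (nth K0 Ks k); rewrite -drop_nth // cat_take_drop -take_nth.
Qed.

Lemma scan_step_ok k t : k < size Ks -> var t vSig = #|Sigma| -> var t vPos = size Pos ->
  scan_inv k t -> scan_inv k.+1 (den (scan_head ;; scan_tail) t).
Proof.
move=> kK eS eP [e1 e2 e3 e4 e5]; have [K [eK eR]] := take_split kK.
set K1 := take k Ks in e2 e3 e4 e5 eK eR.
have hb := kripke_bound G eK; rewrite size_enc_kripke in hb.
have c1 : cell inp t (kripkes_pos K1) = #|knode K|.
  by rewrite cellE ?(kripke_card G eK) //; lia.
have c2 (t' : state) : cell inp t' (kripkes_pos K1 + 1) = enum_rank (kstart K).
  by rewrite cellE ?(kripke_start G eK) //; lia.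
have szk : size K1 = k by rewrite size_take kK.
set w := #|knode K| in c1 hb *.
rewrite denS; set s1 := den scan_head t.
have [h1 h2 h3 h4 h5] : [/\ var s1 vw = w, var s1 ver = kripkes_pos K1 + 2,
    var s1 vlr = kripkes_pos K1 + 2, var s1 vu = 0
  & arr s1 aWant = update (arr t aWant) (nodes K1 + enum_rank (kstart K))
                    (if k < size Pos then 1 else 2)].
  rewrite /s1 /scan_head; ev; rewrite !denI /= !updE /= eP e1 subn_eq0.
  by case: (leqP (size Pos) k) => _; ev; rewrite e3 e2 c1 c2.
have [h6 h7 h8] : [/\ var s1 vN = nodes K1, var s1 vSig = #|Sigma| & var s1 vk = k].
  by rewrite /s1; split; frame.
rewrite /scan_tail denS; set s2 := den (CLoop _ _) s1.
have k1 : var s2 vlr = kripkes_pos K1 + 2 + w * w.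
  have := @loop_inv inp vw (vlr ::= $vlr [+] $vw) s1
    (fun i t => var t vlr = kripkes_pos K1 + 2 + i * w).
  rewrite h1; apply; first by rewrite addn0.
  by move=> i t' _ [frv _] e; ev; rewrite e frv // h1 mulSn; lia.
rewrite denS; set s3 := den (CLoop _ _) s2.
have [||||| l1 l2 l3] := @scan_nodes_ok s2 w (nodes K1) (kripkes_pos K1 + 2)
   (kripkes_pos K1 + 2 + w * w) _ _ _ _ _; rewrite /s2; frame => //.
rewrite -/s2 -/s3 in l1 l2 l3.
have g1 : var s3 vN = nodes K1 by rewrite /s3 /s2; frame.
have g2 : var s3 vw = w by rewrite /s3 /s2; frame.
have g3 : var s3 vk = k by rewrite /s3 /s2; frame.
have g4 : arr s3 aWant = arr s1 aWant by rewrite /s3 /s2; frame.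
have g5 a : a \in [:: aFs; aSz; aEr; aLr] -> arr s2 a = arr t a.
  rewrite !inE => /or4P[]/eqP->; by rewrite /s2 /s1; frame.
have en : nodes (rcons K1 K) = nodes K1 + w by rewrite -cats1 nodes_cat /nodes /= addn0.
have es2 : var s2 vSig = #|Sigma| by rewrite /s2; frame.
rewrite es2 in l1 l2.
set s4 := den _ s3.
have [q1 q2 q3 q4] : [/\ var s4 vN = nodes K1 + w, var s4 vk = k.+1,
   var s4 vp = var s3 vlr & arr s4 = arr s3].
  by rewrite /s4; ev; rewrite g1 g2 g3 addn1.
clearbody s4.
rewrite /scan_inv eR en q1 q2 q3 l1 kripkes_posS size_enc_kripke -/w; split=> //.
- by lia.
- move=> K1' K' K2' L2 u eq1; case/lastP: L2 => [|L2 K''].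
    rewrite cats1 => /rcons_inj[e6 e7].
    rewrite -{}e6 in eq1 *; case: K' / e7 u eq1 => u eq1.
    have ul : enum_rank u < w := ltn_ord _.
    rewrite /= q4; have [-> -> -> ->] := l2 _ ul; split=> //.
    rewrite g4 h5 updE eqn_add2l szk; case: (u =P kstart K) => [->|ne]; first by rewrite eqxx.
    case: eqP => [e8|_]; last by apply: e5; rewrite leq_addr.
    by case: ne; apply/enum_rank_inj/val_inj.
  rewrite -rcons_cons -rcons_cat => /rcons_inj[e6 _].
  have ul : enum_rank u < #|knode K'| := ltn_ord _.
  have ilt : nodes K1' + enum_rank u < nodes K1.
    by rewrite e6 nodes_cat ltn_add2l /nodes /=; apply: leq_trans ul _; rewrite leq_addr.
  rewrite /= q4; have [-> -> -> ->] := l3 _ ilt; rewrite !g5 //.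
  have [-> -> -> -> <-] := e4 _ _ _ _ u eq1 e6; split=> //.
  by rewrite g4 h5 updE; case: eqP => // ex; move: ilt; rewrite ex ltnNge leq_addr.
- move=> i ib; rewrite q4 g4 h5 updE.
  have := ltn_ord (enum_rank (kstart K)) => hs.
  have -> : (i == nodes K1 + enum_rank (kstart K)) = false.
    by apply/eqP => ei; move: ib; rewrite ei leq_add2l leqNgt hs.
  by apply: e5; lia.
Qed.

Lemma card_le_nodes K1 K K2 : Ks = K1 ++ K :: K2 -> #|knode K| <= N.
Proof. by move=> ->; rewrite nodes_cat /nodes /= addnCA leq_addr. Qed.

(** The body as a whole is not static, because [scan_head] assigns the counter [vw] of the loops in
    [scan_tail]. The two halves are bounded separately, with [vw] read from the input in between. *)
Lemma scan_step_cost k t : k < size Ks -> scan_inv k t ->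
  cost inp (scan_head ;; scan_tail) t <= (weight scan_head + weight scan_tail) * 2 ^ N.
Proof.
move=> kK [e1 e2 e3 e4 e5]; have [K [eK eR]] := take_split kK.
have M0 : 0 < 2 ^ N by rewrite expn_gt0.
rewrite mulnDl; apply: leq_add.
  apply: leq_trans (@cost_static inp scan_head t _ M0 isT _) _; first by [].
  by rewrite muln1 leq_pmulr.
apply: leq_trans (@cost_static inp scan_tail _ _ M0 isT _) _; last by rewrite expn1.
move=> x; have -> : loopv scan_tail = [:: vw; vw] by [].
rewrite !inE orbb => /eqP->.
have hb := kripke_bound G eK; rewrite size_enc_kripke in hb.
have -> : var (den scan_head t) vw = #|knode K|.
  rewrite /scan_head; ev; rewrite !denI; case: ifP => _; ev;
  by rewrite e3 cellE ?(kripke_card G eK) //; lia.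
by apply: leq_trans (card_le_nodes eK) _; exact/ltnW/ltn_expl.
Qed.

Definition scan : com :=
  scan_init ;; CLoop vm (scan_head ;; scan_tail) ;; scan_final.

Definition scanned (s : state) : Prop :=
  [/\ var s vL = L, var s vR = R, var s vnc = L - R,
      var s vSt = enum_rank (start_nonterm G) & nodes_ok s].

Definition start_state : state :=
  State (update (fun=> 0) 0 L) (fun _ _ => 0).

Lemma scan_init_ok (s := den scan_init start_state) :
  [/\ var s vSig = #|Sigma|, var s vPos = size Pos, var s vm = size Ks,
      var s vp = 3 & var s vN = 0].
Proof.
have h := rules_pos_gt5 Pos Neg G; have h' := rules_pos_size Pos Neg G.
rewrite /s /scan_init; ev; rewrite !cellE; try lia.
by rewrite inp0 inp1 inp2 size_cat.
Qed.

Lemma scan_inv0 : scan_inv 0 (den scan_init start_state).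
Proof.
have [_ _ _ e4 e5] := scan_init_ok.
rewrite /scan_inv take0 e4 e5; split=> // K1 K K2 L2 u _ /(congr1 size).
by rewrite size_cat /= addnS.
Qed.

Lemma scan_ok : scanned (den scan start_state).
Proof.
rewrite /scan !denS; set s0 := den scan_init start_state.
have [e1 e2 e3 e4 e5] := scan_init_ok; rewrite -/s0 in e1 e2 e3 e4 e5.
have := @loop_inv inp vm (scan_head ;; scan_tail) s0 scan_inv scan_inv0.
rewrite e3 => /(_ _)[].
  by move=> i t iK [frv _] h; apply: scan_step_ok => //; rewrite frv.
set s1 := den _ s0; rewrite take_size => h1 h2 h3 h4 _.
have eR : R = kripkes_pos Ks + 3 by rewrite rules_posE.
have h' := rules_pos_size Pos Neg G.
have eL : var s1 vL = L by rewrite /s1 /s0; frame.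
rewrite /scan_final /scanned; split.
- by rewrite ?denS; frame; ev.
- by rewrite ?denS; frame; ev; rewrite h3 eR.
- by rewrite ?denS; frame; ev; rewrite h3 eR eL.
- by rewrite ?denS; frame; ev; rewrite h3 cellE ?nth_start //; lia.
- split; first by rewrite ?denS; frame; ev.
    by rewrite ?denS double_loop; ev; rewrite h2 mul1n.
  by move=> K1 K K2 L2 u k1 k2; rewrite ?denS; frame; exact: h4 k1 k2.
Qed.

Lemma size_Ks_lt : size Ks < 2 ^ N.
Proof. exact: leq_ltn_trans (size_le_nodes _) (ltn_expl _ _). Qed.

Lemma scan_cost : cost inp scan start_state
  <= (weight scan_init + 8 + weight scan_head + weight scan_tail + weight scan_final)
     * (2 ^ N * 2 ^ N).
Proof.
rewrite /scan; set s0 := den scan_init start_state.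
have [e1 e2 e3 e4 e5] := scan_init_ok; rewrite -/s0 in e1 e2 e3 e4 e5.
have M0 : 0 < 2 ^ N by rewrite expn_gt0.
have h0 := @cost_static inp scan_init start_state 1 isT isT (fun _ => ltac:(by [])).
rewrite exp1n muln1 in h0.
have h1 := @cost_loop inp vm (scan_head ;; scan_tail) s0 scan_inv
  ((weight scan_head + weight scan_tail) * 2 ^ N) scan_inv0.
rewrite e3 in h1.
have {}h1 : cost inp (CLoop vm (scan_head ;; scan_tail)) s0
   <= 3 + size Ks * ((weight scan_head + weight scan_tail) * 2 ^ N + 5).
  apply: h1 => i t iK [frv _] h; split; last exact: scan_step_cost h.
  by apply: scan_step_ok => //; rewrite frv.
set s1 := den (CLoop vm (scan_head ;; scan_tail)) s0.
have h2 : cost inp scan_final s1 <= weight scan_final * 2 ^ N.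
  apply: leq_trans (@cost_static inp scan_final s1 _ M0 isT _) _; last by rewrite expn1.
  move=> x; have -> : loopv scan_final = [:: vN] by [].
  rewrite inE => /eqP->; have := @loop_inv inp vm (scan_head ;; scan_tail) s0 scan_inv scan_inv0.
  rewrite e3 => /(_ _)[].
    by move=> i t iK [frv _] h; apply: scan_step_ok => //; rewrite frv.
  by rewrite -/s1 take_size => _ -> _ _ _; exact/ltnW/ltn_expl.
rewrite -[cost _ _ _]/(cost inp scan_init start_state
  + (cost inp (CLoop vm (scan_head ;; scan_tail)) s0 + cost inp scan_final s1)).
have hK := size_Ks_lt.
move: (weight scan_init) (weight scan_head) (weight scan_tail) (weight scan_final)
  (cost inp scan_init _) (cost inp _ s0) (cost inp scan_final _) h0 h1 h2 => a b b' c A B C.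
move: (size Ks) (2 ^ N) M0 hK => k M M0 kM h0 h1 h2.
have k1 : 1 <= M * M by rewrite muln_gt0 M0.
have k2 : a <= a * (M * M) by rewrite leq_pmulr.
have k3 : c * M <= c * (M * M) by rewrite leq_mul2l leq_pmulr ?orbT.
have k4 : k * ((b + b') * M + 5) <= M * ((b + b') * M + 5) by rewrite leq_mul2r ltnW ?orbT.
have k5 : M <= M * M by rewrite leq_pmulr.
by lia.
Qed.

(** * Ends, parents and occurrence lists *)

Lemma ends_ok s : var s vL = L -> var s vR = R -> var s vnc = L - R ->
  forall p (t : term Sigma (nonterm G)), R <= p -> term_at inp p t ->
  arr (den ends s) aEnd p = p + size (enc_term t).
Proof.
move=> eL eR en; rewrite /ends denS; set s0 := den _ s.
(* After [i] steps the positions from [L - i] on are settled. No term starts at or behind [L], so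
   the claim is vacuous at first. *)
have := @loop_inv inp vnc ends_step s0 (fun i t => var t vp = L - i /\
  forall p (u : term Sigma (nonterm G)), L - i <= p -> term_at inp p u ->
   arr t aEnd p = p + size (enc_term u)).
have en0 : var s0 vnc = L - R by [].
rewrite en0; case.
- split; first by rewrite /s0 denA /= updE /= eL subn0.
  move=> p u Lp /term_at_size; have := size_enc_term_gt0 u; rewrite subn0 in Lp.
  by move: (size inp) Lp => l; lia.
- move=> i t iL _ [e1 e2].
  set p := L - i.+1; have ep : var t vp - 1 = p by rewrite e1 /p; lia.
  have pL : p < L by rewrite /p; lia.
  set t' := den ends_step t.
  have hv : var t' vp = p by rewrite /t' /ends_step !denS; frame; ev.
  have ho x : x != p -> arr t' aEnd x = arr t aEnd x.
    move=> xp; rewrite /t' /ends_step; ev; rewrite !denI /= !updE /= ep.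
    by do !case: ifP => _; rewrite denT /= !updE /= ?ep (negbTE xp).
  have hp : arr t' aEnd p = if nth 0 inp p == 0 then p + 2 else
     if nth 0 inp p == 6 then p + 2 else if nth 0 inp p <= 2 then
     arr t aEnd (arr t aEnd (p + 1)) else arr t aEnd (p + 1).
    rewrite /t' /ends_step; ev; rewrite !denI /= !updE /= ep cellE //.
    case: ifP => h1; first by rewrite denT /= !updE /= ?ep eqxx.
    have -> : (nth 0 inp p - 6 + (6 - nth 0 inp p) == 0) = (nth 0 inp p == 6) by lia.
    case: ifP => h2; first by rewrite denT /= !updE /= ?ep eqxx.
    by rewrite subn_eq0; case: ifP => h3; rewrite denT /= !updE /= ?ep eqxx.
  split=> // x u; rewrite leq_eqVlt => /orP[/eqP<-|xp] tu; last first.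
    rewrite ho; last by rewrite /p; lia.
    by apply: e2 => //; rewrite /p in xp; lia.
  rewrite hp (term_at_code tu).
  have e2' o v : List.In (o, v) (kids u) -> arr t aEnd (p + o) = p + o + size (enc_term v).
    move=> k; apply: e2; last exact: term_at_kid k.
    by have [o0 _] := kids_size k; rewrite /p; lia.
  case: u tu e2' => [A|a|u v|u v|u|u|u] _ e2' //=.
  + by rewrite (e2' 1 u) /= ?size_cat; [rewrite -addnA (e2' _ v) /=; [lia|right; left] | left].
  + by rewrite (e2' 1 u) /= ?size_cat; [rewrite -addnA (e2' _ v) /=; [lia|right; left] | left].
  + by rewrite (e2' 1 u) /=; [lia | left].
  + by rewrite (e2' 1 u) /=; [lia | left].
  + by rewrite (e2' 1 u) /=; [lia | left].
- move=> _ H p t Rp; apply: H; have := rules_pos_size Pos Neg G; lia.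
Qed.

Local Notation trm := (term Sigma (nonterm G)).

Lemma rank_inj (T : finType) (x y : T) :
  nat_of_ord (enum_rank x) = enum_rank y -> x = y.
Proof. by move/val_inj/enum_rank_inj. Qed.

Lemma cat_split_lt (T : Type) (s1 s2 t1 t2 : seq T) x y :
  s1 ++ x :: t1 = s2 ++ y :: t2 -> size s1 < size s2 ->
  exists m, s2 = s1 ++ x :: m.
Proof.
move=> e h; exists (take (size s2 - (size s1).+1) t1).
have e2 : s2 = take (size s2) (s1 ++ x :: t1) by rewrite e take_size_cat.
by rewrite {1}e2 take_cat ltnNge ltnW //= -(subnSK h).
Qed.

Lemma enc_rules_cons A (t : trm) rs :
  enc_rules ((A, t) :: rs) = rank A :: enc_term t ++ enc_rules rs.
Proof. by []. Qed.

(** Two splittings of the rule list are comparable, and the longer prefix contains the whole rule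
    that follows the shorter one. *)
Lemma hdr_order h A t h' A' t' : hdr h A t -> hdr h' A' t' ->
  h' <= h \/ h + 1 + size (enc_term t) <= h'.
Proof.
move=> [pre [post [e ->]]] [pre' [post' [e' ->]]].
rewrite {}e in e'; case: (ltnP (size pre) (size pre')) => hs.
  right; case: (cat_split_lt e' hs) => m ->.
  by rewrite enc_rules_cat enc_rules_cons size_cat /= size_cat; lia.
left; move: hs; rewrite leq_eqVlt => /orP[/eqP hs|hs].
  have := congr1 (take (size pre')) e'; rewrite take_size_cat // {1}hs take_size_cat // => ->.
  by [].
case: (cat_split_lt (esym e') hs) => m ->.
by rewrite enc_rules_cat !size_cat; lia.
Qed.

Definition ends_done (s : state) : Prop :=
  forall p (t : trm), R <= p -> term_at inp p t ->
  arr s aEnd p = p + size (enc_term t).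

Definition parents_sound (s : state) : Prop :=
  forall x, arr s aPar x != 0 -> exists t, isub (arr s aPar x) x t.

Definition occ_sound (s : state) : Prop :=
  (forall A, arr s aOcc (rank A) != 0 ->
     exists q, isub q (arr s aOcc (rank A)) (TNonterm A)) /\
  (forall x q A, arr s aNxt x != 0 -> isub q x (TNonterm A) ->
     exists q', isub q' (arr s aNxt x) (TNonterm A)).

(** [c] bounds the part scanned so far. Each occurrence is the list head or the successor of a
    larger occurrence; as positions are bounded, every occurrence is reached from the head. *)
Definition occ_complete (c : nat) (s : state) : Prop :=
  forall q x A, isub q x (TNonterm A) -> x < c ->
  x = arr s aOcc (rank A) \/
  exists q' x', [/\ x < x', x' < c, isub q' x' (TNonterm A) & arr s aNxt x' = x].

(** Parents precede their arguments, so when the scan reaches a cell, its pointer is already set if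
    a subterm starts there and is 0 otherwise; this tells subterms from cells that store ranks.
    Rules are recognized by [vh], the first rule position not yet passed, or [L] after the last
    rule. *)
Definition parents_inv (i : nat) (s : state) : Prop :=
  [/\ var s vp = R + i,
      [/\ R + i <= var s vh, var s vh <= L,
        (var s vh < L -> exists A t, hdr (var s vh) A t)
        & forall h A t, hdr h A t -> h < R + i \/ var s vh <= h],
      parents_sound s /\ (forall q x t, isub q x t -> q < R + i -> arr s aPar x = q),
      occ_sound s & occ_complete (R + i) s].

Lemma isub_lt q p t : isub q p t -> p + size (enc_term t) <= L.
Proof. by move/isub_term_at/term_at_size. Qed.

Lemma parents_step_header i s A t : ends_done s -> R + i < L -> hdr (R + i) A t ->
  var s vh = R + i ->
  parents_inv i s -> parents_inv i.+1 (den parents_step s).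
Proof.
move=> es cL hh eh [e1 [_ _ _ h4] [p1 p2] [o1 o2] oc].
rewrite /parents_step denS denI /= e1 eh !subnn addn0 /=; ev; rewrite e1.
have tt := hdr_term_at hh; have ts := term_at_size tt.
have Rc := hdr_ge hh.
have ee : arr s aEnd (R + i + 1) = R + i + 1 + size (enc_term t).
  by rewrite addn1 (es _ t) // ltnW.
have tg := size_enc_term_gt0 t.
have hr := isub_root hh.
rewrite /parents_inv (addnS R i); split=> //=; ev; rewrite ?ee.
- by rewrite addn1.
- split.
  + by lia.
  + by apply: leq_trans ts; lia.
  + move=> lt; case: hh => pre [post [er ec]].
    have ep : R + i + 1 + size (enc_term t) = R + size (enc_rules (rcons pre (A, t))).
      by rewrite -cats1 enc_rules_cat enc_rules_cons ec !size_cat /= size_cat /=; lia.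
    case: post er => [|[A' t'] post] er.
      move: lt; rewrite -[X in _ < X]/(size inp) ep enc_instanceE size_cat er cats1.
      by rewrite ltnn.
    exists A', t', (rcons pre (A, t)), post; split=> //.
    by rewrite cat_rcons.
  + move=> h' A' t' hh'; case: (hdr_order hh hh') => ?; [left|right]; lia.
- split.
  + move=> x; rewrite /=; ev; case: (x =P R + i + 1) => [-> _|_ hx]; last exact: p1.
    by exists t; rewrite addn1.
  + move=> q x u su; rewrite ltnS leq_eqVlt => /orP[/eqP eq|qc]; rewrite /=; ev.
      rewrite eq in su *; case: (isub_inv su) => [[A' hh' ->]|[q' [t' [o [s1 _ _]]]]].
        by rewrite addn1 eqxx.
      by case: (hdr_isub_disj hh s1).
    case: eqP => [ex|_]; last exact: p2 su qc.
    rewrite ex addn1 in su; have [eq _] := isub_inj hr su.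
    by rewrite eq ltnn in qc.
- move=> q x B su; rewrite ltnS leq_eqVlt => /orP[/eqP ex|xc].
    by rewrite ex in su; case: (hdr_isub_disj hh su).
  case: (oc _ _ _ su xc) => [->|[q' [x' [k1 k2 k3 k4]]]]; first by left.
  by right; exists q', x'; split=> //; lia.
Qed.

Lemma parents_step_skip i s : R + i < L -> var s vh != R + i -> 
  (forall q t, ~ isub q (R + i) t) ->
  parents_inv i s -> parents_inv i.+1 (setv s vp (R + i + 1)).
Proof.
move=> cL eh ns [e1 [h1 h2 h3 h4] [p1 p2] [o1 o2] oc].
rewrite /parents_inv (addnS R i); split=> //=; ev.
- by rewrite addn1.
- split=> //; first by lia.
  by move=> h A t hh; case: (h4 _ _ _ hh) => ?; [left | right]; lia.
- split=> // q x t su; rewrite ltnS leq_eqVlt => /orP[/eqP eq|qc]; last exact: p2 su qc.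
  rewrite eq in su; case: (isub_inv su) => [[A hh _]|[q' [t' [o [s1 _ _]]]]].
    by case: (h4 _ _ _ hh) => ?; lia.
  by case: (ns _ _ s1).
- move=> q x B su; rewrite ltnS leq_eqVlt => /orP[/eqP ex|xc].
    by rewrite ex in su; case: (ns _ _ su).
  case: (oc _ _ _ su xc) => [->|[q' [x' [k1 k2 k3 k4]]]]; first by left.
  by right; exists q', x'; split=> //; lia.
Qed.

(** Treats all tags except that of nonterminals at once: the state [s'] is abstract, since the tags
    differ only in which parent pointers are written. *)
Lemma parents_step_kids i s s' q t : R + i < L -> var s vh != R + i ->
  isub q (R + i) t -> (forall A, t <> TNonterm A) ->
  var s' vp = R + i + 1 -> var s' vh = var s vh ->
  arr s' aNxt = arr s aNxt -> arr s' aOcc = arr s aOcc ->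
  (forall x, arr s' aPar x = arr s aPar x \/
     arr s' aPar x = R + i /\ exists u, isub (R + i) x u) ->
  (forall o u, List.In (o, u) (kids t) -> arr s' aPar (R + i + o) = R + i) ->
  parents_inv i s -> parents_inv i.+1 s'.
Proof.
move=> cL eh st tn ep eh' en eo hx hk [e1 [h1 h2 h3 h4] [p1 p2] [o1 o2] oc].
rewrite /parents_inv (addnS R i); split; rewrite ?ep ?eh'.
- by rewrite addn1.
- split=> //; first by lia.
  by move=> h A t' hh; case: (h4 _ _ _ hh) => ?; [left | right]; lia.
- split.
    by move=> x; case: (hx x) => [->|[-> [u su]] _]; [exact: p1 | exists u].
  move=> q' x u su; rewrite ltnS leq_eqVlt => /orP[/eqP eq|qc].
    rewrite eq in su *; case: (isub_inv su) => [[A hh _]|[q1 [t1 [o [s1 k1 ->]]]]].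
      by case: (hdr_isub_disj hh st).
    by have [_ et] := isub_inj st s1; rewrite -et in k1; exact: hk k1.
  case: (hx x) => [->|[_ [v sv]]]; first exact: p2 su qc.
  by have [eq _] := isub_inj su sv; rewrite eq ltnn in qc.
- by split; rewrite ?en ?eo.
- move=> q' x B su; rewrite ltnS leq_eqVlt => /orP[/eqP ex|xc].
    by rewrite ex in su; have [_ /tn] := isub_inj st su.
  rewrite eo en; case: (oc _ _ _ su xc) => [->|[q1 [x' [k1 k2 k3 k4]]]]; first by left.
  by right; exists q1, x'; split=> //; lia.
Qed.

(** The new occurrence becomes the list head and points to the old head, so positions decrease along
    the list. *)
Lemma parents_step_occ i s q A : R + i < L -> var s vh != R + i ->
  isub q (R + i) (TNonterm A) ->
  parents_inv i s ->
  parents_inv i.+1 (setv (seta (seta (setv (setv s vc 6) vA (rank A)) aNxt (R + i) (arr s aOcc (rank A)))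
     aOcc (rank A) (R + i)) vp (R + i + 1)).
Proof.
move=> cL eh st [e1 [h1 h2 h3 h4] [p1 p2] [o1 o2] oc].
have Rc := isub_gt st.
rewrite /parents_inv (addnS R i); split=> //=; ev.
- by rewrite addn1.
- split=> //; first by lia.
  by move=> h A' t' hh; case: (h4 _ _ _ hh) => ?; [left | right]; lia.
- split=> // q' x u su; rewrite ltnS leq_eqVlt => /orP[/eqP eq|qc]; last exact: p2 su qc.
  rewrite eq in su; case: (isub_inv su) => [[A' hh _]|[q1 [t1 [o [s1 k1 ->]]]]].
    by case: (hdr_isub_disj hh st).
  by have [_ et] := isub_inj st s1; rewrite -et in k1.
- split=> [B|x q' B]; rewrite /=; ev.
    case: (rank B =P rank A) => [/rank_inj-> _|_]; last exact: o1.
    by exists q.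
  case: (x =P R + i) => [-> h|_]; last exact: o2.
  by move=> /(isub_inj st)[_ [<-]]; exact: o1.
- move=> q' x B su; rewrite ltnS leq_eqVlt /=; ev => /orP[/eqP ex|xc].
    by rewrite ex in su *; have [_ [->]] := isub_inj st su; left; rewrite eqxx.
  case: (oc _ _ _ su xc) => [ex|[q1 [x' [k1 k2 k3 k4]]]]; last first.
    right; exists q1, x'; split=> //; first by lia.
    by rewrite updE; case: (x' =P R + i) => // e; lia.
  case: eqP => [/rank_inj eB|_]; last by left.
  right; exists q, (R + i); rewrite updE eqxx eB; split=> //; by rewrite ex eB.
Qed.

Lemma parents_step_ok i s : ends_done s -> i < L - R ->
  parents_inv i s -> parents_inv i.+1 (den parents_step s).
Proof.
move=> es iL inv; have [e1 [h1 h2 h3 h4] [p1 p2] [o1 o2] oc] := inv.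
have cL : R + i < L by lia.
case: (eqVneq (var s vh) (R + i)) => eh.
  have [A [t hh]] : exists A t, hdr (R + i) A t by rewrite -eh; apply: h3; rewrite eh.
  exact: parents_step_header hh eh inv.
rewrite /parents_step denS denI /= e1.
have -> : (R + i - var s vh + (var s vh - (R + i)) == 0) = false by move: eh; lia.
rewrite denI /= e1; case: (eqVneq (arr s aPar (R + i)) 0) => ep.
  ev; rewrite e1; apply: parents_step_skip => // q t su.
  have [Rq qp] := isub_parent_ge su.
  have := p2 _ _ _ su qp; have := rules_pos_gt5 Pos Neg G; rewrite ep; lia.
have [t st] := p1 _ ep.
have tt := isub_term_at st; have ts := isub_lt st.
have Rc := isub_gt st.
have en o u : List.In (o, u) (kids t) -> arr s aEnd (R + i + o) = R + i + o + size (enc_term u).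
  by move=> k; apply: es; [rewrite -addnA leq_addr | exact: term_at_kid k].
ev; rewrite !denI /= !updE /= e1 cellE // (term_at_code tt).
case: t st tt ts en => [A|a|u v|u v|u|u|u] st tt ts en /=; ev; rewrite ?denI /= ?updE /=.
- rewrite e1; have -> : cell inp (setv s vc 6) (R + i + 1) = rank A.
    rewrite cellE; last by move: ts => /=; lia.
    by case: tt => r e; rewrite (nth_drop_at 1 e).
  exact: (parents_step_occ cL eh st inv).
- rewrite e1; apply: (@parents_step_kids i s _ _ (TAtom a) cL eh st) => // x.
  by left.
- ev; rewrite e1 (en 1 u) /=; last by left.
  apply: (@parents_step_kids i s _ _ (TAnd u v) cL eh st) => //= [x|o w]; ev.
    case: eqP => [->|_].
      right; split=> //; exists v; rewrite -addnA.
      by apply: (isub_kid st); right; left.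
    case: eqP => [->|_]; last by left.
    by right; split=> //; exists u; apply: (isub_kid st); left.
  by case=> [[<- _]|[[<- _]|//]]; ev; rewrite ?addnA ?eqxx //; case: ifP.
- ev; rewrite e1 (en 1 u) /=; last by left.
  apply: (@parents_step_kids i s _ _ (TOr u v) cL eh st) => //= [x|o w]; ev.
    case: eqP => [->|_].
      right; split=> //; exists v; rewrite -addnA.
      by apply: (isub_kid st); right; left.
    case: eqP => [->|_]; last by left.
    by right; split=> //; exists u; apply: (isub_kid st); left.
  by case=> [[<- _]|[[<- _]|//]]; ev; rewrite ?addnA ?eqxx //; case: ifP.
- rewrite e1; apply: (@parents_step_kids i s _ _ (TNot u) cL eh st) => //= [x|o w]; ev.
    case: eqP => [->|_]; last by left.
    by right; split=> //; exists u; apply: (isub_kid st); left.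
  by case=> [[<- _]|//]; rewrite eqxx.
- rewrite e1; apply: (@parents_step_kids i s _ _ (TBox u) cL eh st) => //= [x|o w]; ev.
    case: eqP => [->|_]; last by left.
    by right; split=> //; exists u; apply: (isub_kid st); left.
  by case=> [[<- _]|//]; rewrite eqxx.
- rewrite e1; apply: (@parents_step_kids i s _ _ (TDia u) cL eh st) => //= [x|o w]; ev.
    case: eqP => [->|_]; last by left.
    by right; split=> //; exists u; apply: (isub_kid st); left.
  by case=> [[<- _]|//]; rewrite eqxx.
Qed.

Definition gram_ok (s : state) : Prop :=
  [/\ ends_done s, forall q x t, isub q x t -> arr s aPar x = q,
      forall h A t, hdr h A t -> arr s aPar h = 0,
      parents_sound s & occ_sound s /\ occ_complete L s].

Lemma parents_ok s : ends_done s -> var s vR = R -> var s vnc = L - R ->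
  (forall x, [/\ arr s aPar x = 0, arr s aNxt x = 0 & arr s aOcc x = 0]) ->
  gram_ok (den parents s).
Proof.
move=> es eR en z; rewrite /parents !denS; set s0 := den _ (den _ s).
have RL := rules_pos_size Pos Neg G.
have hd0 : R < L -> exists A t, hdr R A t.
  case er : (rules G) => [|[A t] rs].
    by rewrite enc_instanceE size_cat er addn0 ltnn.
  by exists A, t, [::], rs; rewrite er addn0.
have inv0 : parents_inv 0 s0.
  rewrite /s0; split; ev; rewrite ?eR ?addn0 //.
  - by split=> // h A t hh; right; exact: hdr_ge hh.
  - split; first by move=> x; case: (z x) => /= ->.
    by move=> q x t /isub_parent_ge[] ?; lia.
  - by split=> [A|x q A]; [case: (z (rank A)) | case: (z x)] => /= _ h1 h2; rewrite ?h1 ?h2.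
  - by move=> q x A /isub_gt; lia.
have es0 : ends_done s0 by [].
have := @loop_inv inp vnc parents_step s0 parents_inv inv0.
have -> : var s0 vnc = L - R by [].
move=> /(_ _)[].
  move=> i t iL [_ fra]; apply: parents_step_ok => // p u h1 h2.
  by rewrite fra //; exact: es0 h1 h2.
rewrite /parents_inv subnKC // => _ [_ h2 _ _] [p1 p2] o oc; split=> //.
- by move=> p u h3 h4; rewrite arr_frame //; exact: es0 h3 h4.
- move=> q x t sx; apply: (p2 _ _ _ sx).
  by have [_ qx] := isub_parent_ge sx; have := isub_lt sx; lia.
- move=> h A t hh; apply/eqP/negPn/negP => hn; case: (p1 _ hn) => u.
  exact: hdr_isub_disj hh.
Qed.

(** * Facts, the queue and the output dag *)

Definition gen_at (p : nat) (f : form Sigma) : Prop :=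
  (exists A t, hdr p A t /\ gen t f) \/ (exists q t, isub q p t /\ gen t f).

Definition known (s : state) (p S : nat) : Prop := arr s aTab (p * 2 ^ N + S) != 0.

Definition dag_cells (d : seq (dag_node Sigma)) : seq nat :=
  1 :: flatten [seq enc_node x | x <- d].

(** [queue_ok] provides a single formula that is derivable at the position, has the stored set and
    is denoted by the dag node. The table inverts the queue, with indices shifted by 1 because 0
    means absent. *)
Record dag_ok (d : seq (dag_node Sigma)) (forms : seq (form Sigma)) (s : state) : Prop :=
  DagOk {
    dag_formsE : dag_forms_from [::] d = Some forms;
    dag_size : var s vdn = size d;
    dag_out : var s von = size (dag_cells d);
    dag_outE : forall i, i < size (dag_cells d) -> arr s aOut i = nth 0 (dag_cells d) i;
    dag_ends : forall i, i < size d -> arr s aDend i = size (dag_cells (take i.+1 d));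
    queue_ok : forall k, k < var s vtl -> exists f,
      [/\ gen_at (arr s aQp k) f, arr s aQs k = beh f, onth forms (arr s aQd k) = Some f
        & arr s aTab (arr s aQp k * 2 ^ N + arr s aQs k) = k.+1];
    tab_ok : forall p S, S < 2 ^ N -> known s p S -> exists2 k, k < var s vtl &
      [/\ arr s aQp k = p, arr s aQs k = S & arr s aTab (p * 2 ^ N + S) = k.+1] }.

(** Each dag node is emitted together with a queue entry, so the bound on the number of facts also
    bounds the length of the output. *)
Definition queue_inv (s : state) : Prop :=
  exists d forms, dag_ok d forms s /\ size d <= var s vtl.

(** Facts, dag ends and table entries are only ever added, so whatever has been established about
    them survives all later steps. *)
Definition extends (s s' : state) : Prop :=
  [/\ var s vtl <= var s' vtl, var s vdn <= var s' vdn,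
      forall k, k < var s vtl -> [/\ arr s' aQp k = arr s aQp k,
        arr s' aQs k = arr s aQs k & arr s' aQd k = arr s aQd k],
      forall i, i < var s vdn -> arr s' aDend i = arr s aDend i
    & forall x, arr s aTab x != 0 -> arr s' aTab x = arr s aTab x].

Lemma extends_refl s : extends s s.
Proof. by split. Qed.

Lemma extends_trans s1 s2 s3 : extends s1 s2 -> extends s2 s3 -> extends s1 s3.
Proof.
move=> [a1 b1 c1 d1 e1] [a2 b2 c2 d2 e2]; split.
- exact: leq_trans a2.
- exact: leq_trans b2.
- move=> k kl; have [-> -> ->] := c2 _ (leq_trans kl a1); exact: c1.
- move=> i il; rewrite d2 ?d1 //; exact: leq_trans b1.
- by move=> x h; rewrite e2 ?e1.
Qed.

Lemma extends_known s s' p S : extends s s' -> known s p S -> known s' p S.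
Proof. by move=> [_ _ _ _ e] h; rewrite /known e. Qed.

Definition keeps_queue (c : com) : bool :=
  all (fun x => x \notin modv c) [:: vtl; vdn] &&
  all (fun a => a \notin moda c) [:: aTab; aQp; aQs; aQd; aDend].

Lemma extends_frame c s : keeps_queue c -> extends s (den c s).
Proof.
case/andP => /and3P[m1 m2 _] /and5P[a1 a2 a3 a4 /andP[a5 _]].
by split=> *; rewrite ?var_frame ?arr_frame.
Qed.

Definition keeps_dag (c : com) : bool :=
  [&& keeps_queue c, von \notin modv c & aOut \notin moda c].

Lemma dag_ok_frame c d forms s : keeps_dag c -> dag_ok d forms s ->
  dag_ok d forms (den c s).
Proof.
case/and3P=> /andP[/and3P[m1 m2 _] /and5P[a1 a2 a3 a4 /andP[a5 _]]] m3 a6.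
case=> h1 h2 h3 h4 h5 h6 h7; split; rewrite ?var_frame ?arr_frame //.
by move=> p S SN; rewrite /known !arr_frame //; exact: h7.
Qed.

Lemma queue_inv_frame c s : keeps_dag c -> queue_inv s -> queue_inv (den c s).
Proof.
move=> kc [d [forms [ok le]]]; exists d, forms; split; first exact: dag_ok_frame.
by case/and3P: kc => /andP[/andP[m1 _] _] _ _; rewrite var_frame.
Qed.

Lemma size_dag_forms d forms s : dag_ok d forms s -> size forms = size d.
Proof. by move=> ok; have [-> _] := dag_forms_from_take (dag_formsE ok). Qed.

Lemma tab_index_inj p S p' S' : S < 2 ^ N -> S' < 2 ^ N ->
  p * 2 ^ N + S = p' * 2 ^ N + S' -> p = p' /\ S = S'.
Proof.
move=> h h' e; have M0 : 0 < 2 ^ N by rewrite expn_gt0.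
have := congr1 (fun x => x %/ 2 ^ N) e; rewrite !divnMDl // !divn_small // !addn0 => ep.
by split=> //; move: e; rewrite ep => /addnI.
Qed.

Lemma push_ok d forms s f : dag_ok d forms s -> gen_at (var s tp) f ->
  var s ts = beh f -> onth forms (var s td) = Some f ->
  var s vx = var s tp * 2 ^ N + var s ts -> arr s aTab (var s vx) = 0 ->
  let s' := den push s in
  [/\ dag_ok d forms s', extends s s', known s' (var s tp) (var s ts)
    & var s' vtl = (var s vtl).+1].
Proof.
move=> ok gf et ef ex e0 s'.
have hl : var s' vtl = (var s vtl).+1 by rewrite /s' /push; ev; rewrite addn1.
have [q1 q2 q3 q4] : [/\ arr s' aQp = update (arr s aQp) (var s vtl) (var s tp),
   arr s' aQs = update (arr s aQs) (var s vtl) (var s ts),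
   arr s' aQd = update (arr s aQd) (var s vtl) (var s td)
 & arr s' aTab = update (arr s aTab) (var s vx) (var s vtl).+1].
  by rewrite /s' /push; ev; rewrite addn1.
have [f1 f2 f3 f4] : [/\ var s' vdn = var s vdn, var s' von = var s von,
   arr s' aOut = arr s aOut & arr s' aDend = arr s aDend] by rewrite /s'; split; frame.
have eext : extends s s'.
  split; rewrite ?hl ?f1 ?q1 ?q2 ?q3 ?q4 ?f4 //.
    by move=> k kl; rewrite !updE; have -> : (k == var s vtl) = false by lia.
  by move=> x hx; rewrite updE; case: eqP => // e; move: hx; rewrite e e0.
split=> //; last by rewrite /known q4 updE -ex eqxx.
case: ok => h1 h2 h3 h4 h5 h6 h7; split; rewrite ?f1 ?f2 ?f3 ?f4 // hl q1 q2 q4.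
  move=> k; rewrite ltnS leq_eqVlt q3 !updE; case: eqP => [-> _|_ /= kl].
    by exists f; rewrite -ex eqxx.
  have [g [g1 g2 g3 g4]] := h6 _ kl; exists g; split=> //.
  by case: eqP => // e; move: g4; rewrite e e0.
move=> p S SN; rewrite /known q4 updE; case: (p * 2 ^ N + S =P var s vx) => [e _|_].
  rewrite ex in e; have [|-> ->] := tab_index_inj SN _ e; first by rewrite et beh_lt.
  by exists (var s vtl) => //; rewrite !updE eqxx.
move=> kn; have [k kl [k1 k2 k3]] := h7 _ _ SN kn.
exists k; first exact: ltnW.
rewrite !updE; have -> : (k == var s vtl) = false by lia.
by split=> //; case: eqP => // e; move: kn; rewrite /known e e0.
Qed.

Definition node_cells (c x y : nat) : seq nat :=
  [:: c; x] ++ (if 0 < c < 3 then [:: y] else [::]).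

Lemma emit_ok d forms s x f : dag_ok d forms s -> node_form forms x = Some f ->
  enc_node x = node_cells (var s vc) (var s dl) (var s dr) ->
  let s' := den emit s in
  [/\ dag_ok (rcons d x) (rcons forms f) s', extends s s', var s' td = size d
    & var s' vtl = var s vtl].
Proof.
move=> ok nf ex s'; have sf := size_dag_forms ok.
case: (ok) => h1 h2 h3 h4 h5 h6 h7.
have ec : dag_cells (rcons d x) = dag_cells d ++ node_cells (var s vc) (var s dl) (var s dr).
  by rewrite /dag_cells map_rcons flatten_rcons ex.
have [e1 e2] : [/\ var s' von = size (dag_cells (rcons d x)) &
   forall i, i < size (dag_cells (rcons d x)) -> arr s' aOut i = nth 0 (dag_cells (rcons d x)) i].
  rewrite ec; move: (dag_cells d) h3 h4 => D h3 h4; rewrite size_cat /s' /emit; ev.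
  have d01 : (size D == size D + 1) = false by lia.
  have d02 : (size D == size D + 2) = false by lia.
  have d12 : (size D + 1 == size D + 2) = false by lia.
  have d10 : (size D + 1 == size D) = false by lia.
  have d20 : (size D + 2 == size D) = false by lia.
  have d21 : (size D + 2 == size D + 1) = false by lia.
  (* The two nested tests of [emit] single out the binary tags 1 and 2. *)
  have h0 : (var s vc == 0) || (3 - var s vc == 0) = ~~ (0 < var s vc < 3) by lia.
  rewrite /node_cells; case: ifP => hc; rewrite hc in h0.
    move/norP: h0 => [/negbTE h0 /negbTE h0'].
    rewrite !denI /= !updE /= h0 h0'; ev; rewrite h3; split; first by lia.
    move=> i; rewrite nth_cat !updE; case: (ltnP i (size D)) => il ih.
      have -> : (i == size D + 2) = false by lia.
      have -> : (i == size D + 1) = false by lia.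
      have -> : (i == size D) = false by lia.
      exact: h4.
    have [->|[->|->]] : i = size D \/ i = size D + 1 \/ i = size D + 2 by lia.
    - by rewrite d02 d01 eqxx subnn.
    - by rewrite d12 eqxx addKn.
    - by rewrite eqxx addKn.
  have hs : den (CIf $vc (CIf (EC 3 [-] $vc) (aOut@[$von] ::= $dr;; incr von) CSkip) CSkip)
     (setv (seta (seta s 0 (var s 21) (var s 17)) 0 (var s 21 + 1) (var s 32)) 21 (var s 21 + 2))
   = setv (seta (seta s 0 (var s 21) (var s 17)) 0 (var s 21 + 1) (var s 32)) 21 (var s 21 + 2).
    rewrite !denI /= !updE /=; case: ifP => h9 //; case: ifP => h10 //.
    by move: h0; rewrite h9 h10.
  rewrite hs; ev; rewrite h3; split; first by lia.
  move=> i; rewrite nth_cat !updE; case: (ltnP i (size D)) => il ih.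
    have -> : (i == size D + 1) = false by lia.
    have -> : (i == size D) = false by lia.
    exact: h4.
  have [->|->] : i = size D \/ i = size D + 1 by lia.
  - by rewrite d01 eqxx subnn.
  - by rewrite eqxx addKn.
have hl : var s' vtl = var s vtl by rewrite /s'; frame.
have [e3 e4 e5] : [/\ var s' td = var s vdn, var s' vdn = (var s vdn).+1 &
    arr s' aDend = update (arr s aDend) (var s vdn) (var s' von)].
  rewrite /s' /emit !denS; set s2 := den (CIf _ _ _) _.
  have [g1 g2] : var s2 vdn = var s vdn /\ arr s2 aDend = arr s aDend.
    by rewrite /s2; split; frame.
  by clearbody s2; ev; rewrite g1 g2 addn1.
have [f1 f2 f3 f4] : [/\ arr s' aQp = arr s aQp, arr s' aQs = arr s aQs,
   arr s' aQd = arr s aQd & arr s' aTab = arr s aTab] by rewrite /s'; split; frame.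
have eext : extends s s'.
  split; rewrite ?hl ?e4 ?f1 ?f2 ?f3 ?f4 // => i il.
  by rewrite e5 updE; have -> : (i == var s vdn) = false by lia.
split=> //; last by rewrite e3.
split; rewrite ?hl ?f1 ?f2 ?f3 ?f4 ?e4 ?size_rcons ?h2 //.
- by rewrite -cats1 dag_forms_from_cat h1 /= nf.
- move=> i; rewrite ltnS leq_eqVlt e5 updE h2; case: eqP => [-> _|_ /= il].
    by rewrite e1 take_oversize ?size_rcons.
  by rewrite h5 // -cats1 takel_cat.
- move=> k kl; have [g [g1 g2 g3 g4]] := h6 _ kl; exists g; split=> //.
  rewrite -cats1 onth_cat; have := onthTE forms (arr s aQd k); rewrite g3 /= => <-.
  by [].
- by rewrite /known f4; exact: h7.
Qed.

Definition derived (s s' : state) : Prop := queue_inv s' /\ extends s s'.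

Lemma lookup_ready s : nodes_ok s ->
  var (den lookup s) vx = var s tp * 2 ^ N + var s ts.
Proof. by case=> e _ _; rewrite lookup_ok e. Qed.

Lemma derive_copy_ok s k : nodes_ok s -> queue_inv s -> k < var s vtl ->
  var s td = arr s aQd k -> var s ts = arr s aQs k ->
  (forall f, gen_at (arr s aQp k) f -> gen_at (var s tp) f) ->
  derived s (den derive_copy s) /\ known (den derive_copy s) (var s tp) (var s ts).
Proof.
move=> nok [d [forms [ok le]]] kl ed es hg; rewrite /derive_copy denS.
have ex := lookup_ready nok; set s1 := den lookup s in ex *.
have ok1 : dag_ok d forms s1 by apply: dag_ok_frame.
have x1 : extends s s1 by apply: extends_frame.
have [a1 a2 a3 a4] : [/\ var s1 tp = var s tp, var s1 ts = var s ts,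
  var s1 td = var s td & var s1 vtl = var s vtl] by rewrite /s1; split; frame.
rewrite denI; case: ifP => /= h0; last first.
  rewrite den0; split; last by rewrite /known -ex h0.
  by split=> //; exists d, forms; rewrite a4.
have [f [f1 f2 f3 f4]] := queue_ok ok kl.
have [] := @push_ok d forms s1 f ok1; rewrite ?a1 ?a2 ?a3 ?es ?ed //.
- exact: hg.
- by rewrite ex es.
- exact/eqP.
move=> ok2 x2 kn el; split=> //; split; last exact: extends_trans x2.
by exists d, forms; rewrite el a4; split=> //; exact: leqW.
Qed.

(** The hypothesis asks for a new node over whatever dag is current, because [queue_inv] hides the
    dag behind an existential quantifier. *)
Lemma derive_op_ok s : nodes_ok s -> queue_inv s ->
  (forall d forms, dag_ok d forms s -> exists x f, [/\ node_form forms x = Some f,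
     enc_node x = node_cells (var s vc) (var s dl) (var s dr),
     gen_at (var s tp) f & var s ts = beh f]) ->
  derived s (den derive_op s) /\ known (den derive_op s) (var s tp) (var s ts).
Proof.
move=> nok [d [forms [ok le]]] hx; rewrite /derive_op denS.
have ex := lookup_ready nok; set s1 := den lookup s in ex *.
have ok1 : dag_ok d forms s1 by apply: dag_ok_frame.
have x1 : extends s s1 by apply: extends_frame.
have [a1 a2 a3 a4] : [/\ var s1 tp = var s tp, var s1 ts = var s ts,
  var s1 td = var s td & var s1 vtl = var s vtl] by rewrite /s1; split; frame.
have [a5 a6 a7] : [/\ var s1 vc = var s vc, var s1 dl = var s dl & var s1 dr = var s dr].
  by rewrite /s1; split; frame.
rewrite denI; case: ifP => /= h0; last first.
  rewrite den0; split; last by rewrite /known -ex h0.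
  by split=> //; exists d, forms; rewrite a4.
have [x [f [f1 f2 f3 f4]]] := hx _ _ ok.
rewrite denS; have [|ok2 x2 et el] := @emit_ok d forms s1 x f ok1 f1; first by rewrite a5 a6 a7.
set s2 := den emit s1 in ok2 x2 et el *.
have [b1 b2 b3 b4] : [/\ var s2 tp = var s tp, var s2 ts = var s ts,
  var s2 vx = var s1 vx & arr s2 aTab = arr s1 aTab] by rewrite /s2; split; frame.
have [] := @push_ok _ _ s2 f ok2; rewrite ?b1 ?b2 ?b3 ?b4 //.
- by rewrite et -cats1 onth_cat (size_dag_forms ok) ltnn subnn.
- exact/eqP.
move=> ok3 x3 kn el3; split=> //; split; last by apply: extends_trans x3; exact: extends_trans x2.
by exists (rcons d x), (rcons forms f); rewrite el3 el a4 size_rcons.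
Qed.

Lemma forward_ok s k : nodes_ok s -> queue_inv s -> k < var s vtl ->
  var s vd = arr s aQd k -> var s vS = arr s aQs k ->
  (var s tp != 0 -> forall f, gen_at (arr s aQp k) f -> gen_at (var s tp) f) ->
  derived s (den forward s) /\
  (var s tp != 0 -> known (den forward s) (var s tp) (var s vS)).
Proof.
move=> nok qi kl ed es hg; rewrite /forward !denS.
set s1 := den (td ::= _) _.
have n1 : nodes_ok s1 by do 2!apply: nodes_ok_frame => //.
have q1 : queue_inv s1 by do 2!apply: queue_inv_frame => //.
have x1 : extends s s1 by apply: (extends_trans (s2 := den (ts ::= $vS) s)); apply: extends_frame.
have [a1 a2 a3 a4] : [/\ var s1 tp = var s tp, var s1 ts = var s vS,
  var s1 td = var s vd & var s1 vtl = var s vtl] by [].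
have [a5 a6 a7] : [/\ arr s1 aQp = arr s aQp, arr s1 aQs = arr s aQs & arr s1 aQd = arr s aQd] by [].
clearbody s1; rewrite denI /= a1; case: eqP => e0; first by rewrite den0.
have [] := @derive_copy_ok s1 k n1 q1; rewrite ?a1 ?a2 ?a3 ?a4 ?a5 ?a6 ?a7 //.
  by apply: hg; exact/eqP.
by case=> q2 x2 kn; split=> //; split=> //; exact: extends_trans x2.
Qed.

(** The fact processed last may concern either argument, whereas the emitted node keeps the
    arguments in order; the sets agree all the same. *)
Lemma beh_comm c f g : 0 < c < 3 -> beh (fop c f g) = beh (fop c g f).
Proof.
have h (F F' : form Sigma) : (forall K (u : knode K), sat u F = sat u F') -> beh F = beh F'.
  move=> e; rewrite /beh /bits; congr (pack (flatten _)).
  by apply: eq_map => K; apply: eq_map => u.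
by case: c => [|[|[|c]]] //= _; apply: h => K u /=; rewrite 1?andbC 1?orbC.
Qed.

(** The second conclusion holds for all [f] and [g] with the given sets, not just for the stored
    witnesses, since [operate] computes from the sets alone; this compositionality is what lets a
    set stand for a formula. Only the set of [h] is prescribed, as its arguments may be
    exchanged. *)
Lemma combine_ok s k k2 : nodes_ok s -> queue_inv s ->
  k < var s vtl -> k2 < var s vtl ->
  var s vS = arr s aQs k -> var s vS2 = arr s aQs k2 -> 0 < var s vc < 6 ->
  (forall forms f g, gen_at (arr s aQp k) f -> gen_at (arr s aQp k2) g ->
     onth forms (arr s aQd k) = Some f -> onth forms (arr s aQd k2) = Some g ->
     exists x h, [/\ node_form forms x = Some h,
       enc_node x = node_cells (var s vc) (var s dl) (var s dr),
       gen_at (var s vq) h & beh h = beh (fop (var s vc) f g)]) ->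
  derived s (den combine s) /\
  (forall f g, var s vS = beh f -> var s vS2 = beh g ->
     known (den combine s) (var s vq) (beh (fop (var s vc) f g))).
Proof.
move=> nok qi kl kl2 eS eS2 c6 hx; rewrite /combine !denS.
set s1 := den (unpack aB1 vS) s; set s2 := den (unpack aB2 vS2) s1.
set s3 := den operate s2; set s4 := den (tp ::= $vq) s3.
have n2 : nodes_ok s2 by do 2!apply: nodes_ok_frame => //.
have n4 : nodes_ok s4 by do 2!apply: nodes_ok_frame => //.
have q4 : queue_inv s4 by do 4!apply: queue_inv_frame => //.
have x4 : extends s s4.
  do 3?[apply: (extends_trans (s2 := s3)); last by apply: extends_frame].
  apply: (extends_trans (s2 := s2)); last by apply: extends_frame.
  by apply: (extends_trans (s2 := s1)); apply: extends_frame.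
have [eN eB _] := nok.
have hts f g : var s vS = beh f -> var s vS2 = beh g ->
    var s4 ts = beh (fop (var s vc) f g).
  move=> ef eg; have -> : var s4 ts = var s3 ts by [].
  have ec : var s2 vc = var s vc by rewrite /s2 /s1; frame.
  rewrite -ec /s3; apply: operate_ok => //; first by rewrite ec.
    move=> j jN; have -> : arr s2 aB1 = arr s1 aB1 by rewrite /s2; frame.
    by rewrite /s1 (@unpack_ok _ _ _ _ (bits f)) ?size_bits.
  move=> j jN; rewrite /s2 (@unpack_ok _ _ _ _ (bits g)) ?size_bits //; rewrite /s1; frame => //.
have [b1 b2 b3 b4] : [/\ var s4 tp = var s vq, var s4 vc = var s vc,
   var s4 dl = var s dl & var s4 dr = var s dr].
  by rewrite /s4; split; ev; rewrite /s3 /s2 /s1; frame.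
have [] := @derive_op_ok s4 n4 q4.
  move=> d forms ok.
  have [a1 a2 a3 a4] : [/\ arr s4 aQp = arr s aQp, arr s4 aQs = arr s aQs,
     arr s4 aQd = arr s aQd & var s4 vtl = var s vtl].
    by rewrite /s4 /s3 /s2 /s1; split; frame.
  have [f [f1 f2 f3 _]] : exists f, [/\ gen_at (arr s4 aQp k) f, arr s4 aQs k = beh f,
    onth forms (arr s4 aQd k) = Some f & True].
    by have [|f [? ? ? _]] := @queue_ok _ _ _ ok k; [rewrite a4 | exists f].
  have [g [g1 g2 g3 _]] : exists f, [/\ gen_at (arr s4 aQp k2) f, arr s4 aQs k2 = beh f,
    onth forms (arr s4 aQd k2) = Some f & True].
    by have [|g [? ? ? _]] := @queue_ok _ _ _ ok k2; [rewrite a4 | exists g].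
  rewrite a1 a3 in f1 f3 g1 g3; rewrite a2 in f2 g2.
  have [x [h [h1 h2 h3 h4]]] := hx _ _ _ f1 g1 f3 g3.
  exists x, h; rewrite b1 b2 b3 b4; split=> //.
  by rewrite h4; apply: hts; rewrite ?eS ?eS2.
case=> q5 x5 kn; split; first by split=> //; exact: extends_trans x5.
by move=> f g ef eg; rewrite -(hts _ _ ef eg) -b1.
Qed.

Definition static_ok (s : state) : Prop :=
  [/\ nodes_ok s, gram_ok s & [/\ var s vL = L, var s vR = R, var s vnc = L - R
    & var s vSt = rank (start_nonterm G)]].

Definition keeps_static (c : com) : bool :=
  all (fun x => x \notin modv c) [:: vL; vN; vB; vR; vnc; vSt] &&
  all (fun a => a \notin moda c)
    [:: aEnd; aPar; aNxt; aOcc; aFs; aSz; aEr; aLr; aWant].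

Lemma static_frame c s : keeps_static c -> static_ok s -> static_ok (den c s).
Proof.
case/andP=> /and5P[m1 m2 m3 m4 /and3P[m5 m6 _]].
case/and5P=> a1 a2 a3 a4 /and5P[b1 b2 b3 b4 /andP[b5 _]] [n g [e1 e2 e3 e4]].
split; last by rewrite !var_frame.
  by apply: nodes_ok_frame => //=; [rewrite m2 m3 | rewrite b1 b2 b3 b4 b5].
case: g => [g1 g2 g3 g4 [[g5 g6] g7]].
have [f1 f2 f3 f4] : [/\ arr (den c s) aEnd = arr s aEnd, arr (den c s) aPar = arr s aPar,
   arr (den c s) aNxt = arr s aNxt & arr (den c s) aOcc = arr s aOcc].
  by rewrite !arr_frame.
split; rewrite /ends_done /parents_sound /occ_sound /occ_complete ?f1 ?f2 ?f3 ?f4 //.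
Qed.

Lemma gen_at_isub q p t f : isub q p t -> gen_at p f -> gen t f.
Proof.
move=> s [[A [u [hh _]]]|[q' [u [su gu]]]]; first by case: (hdr_isub_disj hh s).
by have [_ ->] := isub_inj s su.
Qed.

Lemma gen_at_hdr p A t f : hdr p A t -> gen_at p f -> gen t f.
Proof.
move=> hh [[B [u [hu gu]]]|[q' [u [su _]]]]; last by case: (hdr_isub_disj hh su).
by have [_ ->] := hdr_inj hh hu.
Qed.

(** * Facts about atoms *)

Definition atoms_known (s : state) : Prop :=
  forall q p a, isub q p (TAtom a) -> known s p (beh (FAtom a)).

Lemma isub_parent_neq0 q p t : isub q p t -> q != 0.
Proof.
by move=> /isub_parent_ge[h _]; have := rules_pos_gt5 Pos Neg G; lia.
Qed.

Lemma derived_frame c s : keeps_dag c -> queue_inv s -> derived s (den c s).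
Proof.
move=> k qi; split; first exact: queue_inv_frame.
by apply: extends_frame; case/andP: k.
Qed.

Lemma derived_trans s1 s2 s3 : derived s1 s2 -> derived s2 s3 -> derived s1 s3.
Proof. by move=> [_ x1] [q2 x2]; split=> //; exact: extends_trans x2. Qed.

Lemma atoms_step_ok s c : static_ok s -> queue_inv s -> var s vp = c -> c < L ->
  [/\ static_ok (den atoms_step s), derived s (den atoms_step s)
  & forall q a, isub q c (TAtom a) -> known (den atoms_step s) c (beh (FAtom a))].
Proof.
move=> st qi ec cL.
have ss : static_ok (den atoms_step s) by apply: static_frame.
have [nok [_ gp _ ps _] _] := st; rewrite /atoms_step denS in ss *.
set s1 := den (CIf _ _ _) s in ss *.
suff [d1 k1] : derived s s1 /\
    forall q a, isub q c (TAtom a) -> known s1 c (beh (FAtom a)).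
  split=> //; apply: derived_trans (d1) _; apply: derived_frame => //.
  by case: d1.
rewrite /s1 denI /= ec; case: ifP => hp.
  rewrite den0; split=> [|q a sc]; first by split=> //; exact: extends_refl.
  by move: hp; rewrite (gp _ _ _ sc) (negbTE (isub_parent_neq0 sc)).
have [t sc] := ps c (negbT hp).
have tt := isub_term_at sc; have tL := isub_lt sc.
rewrite denS denI; set s2 := den (vc ::= _) s.
have e2 : var s2 vc = tcode t by rewrite /s2; ev; rewrite ec cellE // (term_at_code tt).
have d2 : derived s s2 by apply: derived_frame.
have e2' : eval inp s2 $vc = tcode t := e2.
rewrite e2'; case: ifP => h0; last first.
  rewrite den0; split=> // q a sa; have [_ et] := isub_inj sc sa.
  by move: h0; rewrite et.
case: t sc tt tL e2 e2' h0 => // a sc tt tL e2 _ _.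
rewrite !denS; set s3 := den (dl ::= _) s2.
have e3 : var s3 dl = rank a.
  have cL' : c + 1 < L by move: tL => /=; lia.
  rewrite /s3; ev; rewrite !ec cellE //.
  by case: tt => r e; rewrite (nth_drop_at 1 e).
set s4 := den label_bits s3; set s5 := den (tp ::= $vp) s4.
have n3 : nodes_ok s3 by do 2!apply: nodes_ok_frame => //.
have n5 : nodes_ok s5 by do 2!apply: nodes_ok_frame => //.
have d5 : derived s s5.
  apply: derived_trans (d2) _.
  apply: derived_trans (derived_frame (c := dl ::= EIn ($vp [+] EC 1)) _ _) _ => //.
    by case: d2.
  rewrite -/s3; have q3 : queue_inv s3 by do 2!apply: queue_inv_frame => //.
  apply: derived_trans (derived_frame (c := label_bits) _ _) _ => //.
  by apply: derived_frame => //; apply: queue_inv_frame.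
have [f1 f2 f3 f4] : [/\ var s5 tp = c, var s5 ts = beh (FAtom a), var s5 vc = 0
   & var s5 dl = rank a].
  split.
  - by rewrite /s5 denA /= updE /= /s4; frame.
  - have -> : var s5 ts = var s4 ts by [].
    exact: label_bits_ok.
  - by rewrite /s5; frame; rewrite /s4; frame; rewrite /s3; frame; rewrite e2.
  - by rewrite /s5; frame; rewrite /s4; frame.
have [] := @derive_op_ok s5 n5.
- by case: d5.
- move=> d forms _; exists (DAtom a), (FAtom a); rewrite f1 f2 f3 f4; split=> //.
  by right; exists (arr s aPar c), (TAtom a); split=> //; constructor.
rewrite f1 f2 => d6 kn; split; first exact: derived_trans d6.
by move=> q b sb; have [_ [<-]] := isub_inj sc sb.
Qed.

Lemma atoms_ok s : static_ok s -> var s vtl = 0 -> var s vdn = 0 ->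
  (forall x, arr s aTab x = 0) ->
  [/\ static_ok (den atoms s), queue_inv (den atoms s) & atoms_known (den atoms s)].
Proof.
move=> st tl0 dn0 tab0; rewrite /atoms !denS; set s0 := den (vp ::= $vR) _.
have st0 : static_ok s0 by do 3!apply: static_frame => //.
have RL := rules_pos_size Pos Neg G.
have q0 : queue_inv s0.
  exists [::], [::]; split=> //; split=> //.
  - by case.
  - by move=> k; have -> : var s0 vtl = 0 by [].
  - by move=> p S _; rewrite /known; have -> : arr s0 aTab (p * 2 ^ N + S) = 0 by exact: tab0.
have e0 : var s0 vp = R by rewrite /s0; ev; case: st => _ _ [].
have := @loop_inv inp vnc atoms_step s0 (fun i t => [/\ var t vp = R + i, static_ok t,
  queue_inv t & forall q p a, isub q p (TAtom a) -> p < R + i -> known t p (beh (FAtom a))]).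
have -> : var s0 vnc = L - R by case: st0 => _ _ [].
case.
- by split=> //; [rewrite e0 addn0 | move=> q p a /isub_gt; lia].
- move=> i t iL _ [e1 e2 e3 e4].
  have iL' : R + i < L by lia.
  have [f1 [f2 f3] f4] := atoms_step_ok e2 e3 e1 iL'; split=> //.
    rewrite /atoms_step denS denA /= updE /=; frame; rewrite e1; lia.
  move=> q p a sp; rewrite addnS ltnS leq_eqVlt => /orP[/eqP ep|pi].
    by rewrite ep in sp *; exact: f4 sp.
  by apply: extends_known f3 _; exact: e4 sp pi.
- move=> _ e2 e3 e4; split=> // q p a sp; apply: (e4 _ _ _ sp).
  by have := isub_lt sp; have := size_enc_term_gt0 (TAtom a : term Sigma (nonterm G)); lia.
Qed.

(** * Processing one fact *)

(** Goodness depends on the set only, so it is claimed for every formula with the stored set; the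
    witness is chosen when the answer is read off. *)
Definition found_ok (s : state) : Prop :=
  var s vfnd != 0 -> exists k t, [/\ k < var s vtl, hdr (arr s aQp k) (start_nonterm G) t,
    forall f, arr s aQs k = beh f -> good f & var s vfe = arr s aDend (arr s aQd k)].

Lemma queue_dag_lt s k : queue_inv s -> k < var s vtl -> arr s aQd k < var s vdn.
Proof.
move=> [d [forms [ok _]]] kl; have [f [_ _ ef _]] := queue_ok ok kl.
by rewrite (dag_size ok) -(size_dag_forms ok) -onthTE ef.
Qed.

Lemma found_ok_ext s s' : queue_inv s -> extends s s' ->
  var s' vfnd = var s vfnd -> var s' vfe = var s vfe -> found_ok s -> found_ok s'.
Proof.
move=> qi [e1 e2 e3 e4 e5] ef ee fo; rewrite /found_ok ef ee => /fo[k [t [k1 k2 k3 k4]]].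
have [f1 f2 f3] := e3 _ k1; exists k, t; rewrite f1 f2 f3; split=> //.
  exact: leq_trans e1.
by rewrite e4 //; exact: queue_dag_lt.
Qed.

(** The state while queue entry [k] is processed. Its data are held in variables, which stay valid
    because new facts are only appended. *)
Record current (k : nat) (s : state) : Prop := Current {
  cur_static : static_ok s;
  cur_queue : queue_inv s;
  cur_found : found_ok s;
  cur_lt : k < var s vtl;
  cur_p : var s vp = arr s aQp k;
  cur_S : var s vS = arr s aQs k;
  cur_d : var s vd = arr s aQd k;
  cur_q : var s vq = arr s aPar (arr s aQp k) }.

Definition keeps_current (c : com) : bool :=
  keeps_static c && all (fun x => x \notin modv c) [:: vp; vS; vd; vq; vfnd; vfe].

Lemma current_derived k s c : keeps_current c -> current k s -> derived s (den c s) ->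
  current k (den c s).
Proof.
case/andP=> ks /and5P[m1 m2 m3 m4 /and3P[m5 m6 _]] [h1 h2 h3 h4 h5 h6 h7 h8] [qi x].
have [e1 e2 /(_ _ h4)[f1 f2 f3] e4 e5] := x.
have a2 : aPar \notin moda c by case/andP: ks => _ /and3P[].
split; rewrite ?f1 ?f2 ?f3.
- exact: static_frame.
- exact: qi.
- by apply: found_ok_ext h2 x _ _ h3; rewrite var_frame.
- exact: leq_trans e1.
- by rewrite var_frame.
- by rewrite var_frame.
- by rewrite var_frame.
- by rewrite var_frame // arr_frame.
Qed.

Lemma current_gen k s : current k s -> exists f,
  [/\ gen_at (arr s aQp k) f & arr s aQs k = beh f].
Proof.
move=> c; have [d [forms [ok _]]] := cur_queue c.
by have [f [h1 h2 _ _]] := queue_ok ok (cur_lt c); exists f.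
Qed.

Lemma forward_current k s : current k s ->
  (var s tp != 0 -> forall f, gen_at (arr s aQp k) f -> gen_at (var s tp) f) ->
  [/\ current k (den forward s), derived s (den forward s)
    & var s tp != 0 -> known (den forward s) (var s tp) (arr s aQs k)].
Proof.
move=> c hg; have [n _ _] := cur_static c.
have [d h] := forward_ok n (cur_queue c) (cur_lt c) (cur_d c) (cur_S c) hg.
split=> //; first exact: current_derived.
by rewrite -(cur_S c).
Qed.

Lemma current_frame k s c : keeps_current c -> keeps_dag c -> current k s ->
  current k (den c s).
Proof.
by move=> k1 k2 cu; apply: current_derived => //; apply: derived_frame => //; exact: cur_queue cu.
Qed.

Lemma check_ok k s t : current k s -> hdr (arr s aQp k) (start_nonterm G) t ->
  [/\ current k (den check s), derived s (den check s),
     var s vfnd != 0 -> var (den check s) vfnd != 0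
   & forall f, arr s aQs k = beh f -> good f -> var (den check s) vfnd != 0].
Proof.
move=> cu hh; have [f [gf ef]] := current_gen cu.
have [n _ _] := cur_static cu.
have dd : derived s (den check s) by apply: derived_frame => //; exact: cur_queue cu.
rewrite /check !denS in dd *; set s1 := den (unpack aB1 vS) s in dd *.
set s3 := den (vi ::= EC 0) (den (vbad ::= EC 0) s1) in dd *.
have c3 : current k s3 by do 3!apply: current_frame => //.
have n3 : nodes_ok s3 by case: (cur_static c3).
have b1 j : j < N -> arr s3 aB1 j = nth false (bits f) j.
  move=> jN; rewrite /s3; frame; rewrite /s1; have [eN eB _] := n.
  by rewrite (@unpack_ok _ _ _ _ (bits f)) ?size_bits // (cur_S cu) ef.
have := @check_loop_ok _ _ _ G s3 f n3 erefl erefl b1.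
set s4 := den (CLoop vN check_step) s3 in dd *; move=> hb.
have c4 : current k s4 by apply: current_frame.
have x4 : extends s s4.
  apply: extends_trans (_ : extends s1 _); first by apply: extends_frame.
  apply: (extends_trans (s2 := s3)); last by apply: extends_frame.
  by apply: (extends_trans (s2 := den (vbad ::= EC 0) s1)); apply: extends_frame.
(* Injectivity of [pack]: run on the same number, [unpack] yields the bits of either formula. *)
have hS g : arr s aQs k = beh g -> bits g = bits f.
  move=> eg; have := @unpack_ok inp aB1 vS s1 (bits g).
  have [eN eB _] := n; rewrite !size_bits.
  have -> : var s1 vN = N by rewrite /s1; frame.
  have -> : var s1 vB = 2 ^ N by rewrite /s1; frame.
  have -> : var s1 vS = beh g by rewrite /s1; frame; rewrite (cur_S cu).
  move=> /(_ erefl erefl erefl) h1.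
  have := @unpack_ok inp aB1 vS s1 (bits f).
  rewrite !size_bits.
  have -> : var s1 vN = N by rewrite /s1; frame.
  have -> : var s1 vB = 2 ^ N by rewrite /s1; frame.
  have -> : var s1 vS = beh f by rewrite /s1; frame; rewrite (cur_S cu).
  move=> /(_ erefl erefl erefl) h2.
  apply: (@eq_from_nth _ false); rewrite !size_bits // => j jN.
  by have := h1 _ jN; rewrite h2 //; do 2!case: nth.
have hgood g g' : bits g = bits g' -> good g -> good g'.
  move=> eb gg K1 K K2 e.
  have nu : node_at Pos Neg (nodes K1 + enum_rank (kstart K)) K1 (kstart K).
    by split=> //; exists K2.
  by rewrite -(gg _ _ _ e) /models -(nth_bits g' nu) -(nth_bits g nu) eb.
have f4 : var s4 vfnd = var s vfnd by rewrite /s4 /s3 /s1; frame.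
have eQs : arr s4 aQs k = arr s aQs k by rewrite /s4 /s3 /s1; frame.
have eQp : arr s4 aQp k = arr s aQp k by rewrite /s4 /s3 /s1; frame.
move: dd; rewrite denI /=; case: eqP hb => [hb0|hb0] hb dd; last first.
  rewrite den0 in dd *; split=> //; first by rewrite f4.
  move=> g eg gg; case: hb => _ hb.
  have gf' : good f by apply: hgood gg; exact: hS.
  by have := hb gf'.
split=> //; rewrite ?denS ?denA.
clearbody s4; case: c4 => k1 k2 k3 k4 k5 k6 k7 k8; split=> //.
- by case: dd.
- move=> _; exists k, t; split=> //.
  + by rewrite /= eQp.
  + move=> g /=; rewrite eQs => eg; apply: (hgood f); first by rewrite hS.
    by apply/hb; exact/eqP.
  + by ev; rewrite k7.
Qed.

(** Only the head of the occurrence list receives the fact here; the remaining occurrences get it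
    from one another through [at_occurrence]. *)
Lemma at_header_ok k s A t : current k s -> hdr (arr s aQp k) A t ->
  [/\ current k (den at_header s), derived s (den at_header s),
     var s vfnd != 0 -> var (den at_header s) vfnd != 0,
     A = start_nonterm G -> forall f, arr s aQs k = beh f -> good f ->
       var (den at_header s) vfnd != 0
   & forall q p, isub q p (TNonterm A) -> p = arr s aOcc (rank A) ->
       known (den at_header s) p (arr s aQs k)].
Proof.
move=> cu hh; rewrite /at_header !denS.
set s1 := den (vA ::= _) s.
have c1 : current k s1 by apply: current_frame.
have d1 : derived s s1 by apply: derived_frame => //; exact: cur_queue cu.
have hL : arr s aQp k < L.
  by have := term_at_size (hdr_term_at hh); lia.
have eA : var s1 vA = rank A.
  by rewrite /s1 denA /= updE /= (cur_p cu) cellE // (hdr_nt hh).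
have eSt : var s1 vSt = rank (start_nonterm G) by case: (cur_static c1) => _ _ [].
set s2 := den (CIf _ _ _) s1.
have [c2 d2 m2 f2] : [/\ current k s2, derived s1 s2, var s1 vfnd != 0 -> var s2 vfnd != 0
  & A = start_nonterm G -> forall f, arr s aQs k = beh f -> good f -> var s2 vfnd != 0].
  have ee : eval inp s1 (ne $vA $vSt) = var s1 vA - var s1 vSt + (var s1 vSt - var s1 vA) by [].
  rewrite /s2 denI ee eA eSt; case: ifP => h0.
    have eAS : A = start_nonterm G by apply: rank_inj; lia.
    rewrite eAS in hh; have [] := @check_ok k s1 t c1 hh.
    by move=> *; split.
  rewrite den0; split; [exact: c1 | | by [] | by move=> eAS; move: h0; rewrite eAS; lia].
  by split; [exact: cur_queue c1 | exact: extends_refl].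
have a2 : arr s2 aOcc = arr s aOcc by rewrite /s2 /s1; frame.
have v2 : var s2 vA = rank A by rewrite /s2; frame.
have q2 : [/\ arr s2 aQp k = arr s aQp k & arr s2 aQs k = arr s aQs k].
  by have [_ _ /(_ _ (cur_lt cu))[-> -> _] _ _] := (derived_trans d1 d2).2.
set s3 := den (tp ::= _) s2.
have c3 : current k s3 by apply: current_frame.
have d3 : derived s2 s3 by apply: derived_frame => //; exact: cur_queue c2.
have e3 : var s3 tp = arr s aOcc (rank A) by rewrite /s3 denA /= updE /= v2 a2.
have q3 : [/\ arr s3 aQp k = arr s aQp k & arr s3 aQs k = arr s aQs k].
  by case: q2; split; rewrite /s3; frame.
have f3 : var s3 vfnd = var s2 vfnd by [].
have [_ [_ _ _ _ [[os _] _]] _] := cur_static cu.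
have [] := @forward_current k s3 c3.
  rewrite e3 (q3.1) => h0 f /(gen_at_hdr hh) gf; have [q sq] := os _ h0.
  by right; exists q, (TNonterm A); split=> //; apply: GenRule gf; exact: hdr_In hh.
rewrite e3 (q3.2) => c4 d4 k4; split=> //.
- exact: derived_trans (derived_trans d1 d2) (derived_trans d3 d4).
- by move=> h; frame; rewrite f3; apply: m2.
- by move=> eAS f ef gf; frame; rewrite f3; apply: f2 gf.
- move=> q p sp ep; rewrite ep; apply: k4; rewrite -ep.
  by have := isub_gt sp; lia.
Qed.

Lemma at_occurrence_ok k s q t : current k s -> isub q (arr s aQp k) t ->
  [/\ current k (den at_occurrence s), derived s (den at_occurrence s)
   & forall A, t = TNonterm A -> arr s aNxt (arr s aQp k) != 0 ->
       known (den at_occurrence s) (arr s aNxt (arr s aQp k)) (arr s aQs k)].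
Proof.
move=> cu sp; rewrite /at_occurrence denI /= (cur_p cu).
have tt := isub_term_at sp; have pL := isub_lt sp.
have tg := size_enc_term_gt0 t.
have pL' : arr s aQp k < L by lia.
rewrite cellE // (term_at_code tt); case: ifP => h6; last first.
  rewrite den0; split=> //; first by split; [exact: cur_queue cu | exact: extends_refl].
  by move=> A et; move: h6; rewrite et.
have [A et] : exists A, t = TNonterm A.
  by case: t h6 {sp tt pL tg} => [A|a|u v|u v|u|u|u] // _; exists A.
rewrite denS; set s1 := den (tp ::= _) s.
have c1 : current k s1 by apply: current_frame.
have e1 : var s1 tp = arr s aNxt (arr s aQp k) by rewrite /s1 denA /= updE /= (cur_p cu).
have [_ [_ _ _ _ [[_ os] _]] _] := cur_static cu.
rewrite et in sp.
have [] := @forward_current k s1 c1.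
  rewrite e1 -[arr s1 aQp k]/(arr s aQp k) => h0 f /(gen_at_isub sp) gf.
  by have [q' sq] := os _ _ _ h0 sp; right; exists q', (TNonterm A).
rewrite e1 => c2 d2 k2; split=> //.
Qed.

Lemma node_form_binary c i j (forms : seq (form Sigma)) f g : 0 < c < 3 ->
  onth forms i = Some f -> onth forms j = Some g ->
  exists x, node_form forms x = Some (fop c f g) /\ enc_node x = node_cells c i j.
Proof.
case: c => [|[|[|c]]] // _ ef eg.
  by exists (DAnd Sigma i j); rewrite /= ef eg.
by exists (DOr Sigma i j); rewrite /= ef eg.
Qed.

Lemma node_form_unary c i y (forms : seq (form Sigma)) f : 2 < c < 6 ->
  onth forms i = Some f ->
  exists x, node_form forms x = Some (fop c f f) /\ enc_node x = node_cells c i y.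
Proof.
case: c => [|[|[|[|[|[|c]]]]]] // _ ef.
- by exists (DNot Sigma i); rewrite /= ef.
- by exists (DBox Sigma i); rewrite /= ef.
- by exists (DDia Sigma i); rewrite /= ef.
Qed.

Lemma derived_refl s : queue_inv s -> derived s s.
Proof. by move=> qi; split=> //; exact: extends_refl. Qed.

Lemma current_val k s s' : current k s -> derived s s' ->
  [/\ k < var s' vtl, arr s' aQp k = arr s aQp k, arr s' aQs k = arr s aQs k
    & arr s' aQd k = arr s aQd k].
Proof.
move=> cu [_ [e1 _ /(_ _ (cur_lt cu))[-> -> ->] _ _]]; split=> //.
exact: leq_trans (cur_lt cu) e1.
Qed.

Lemma unary_ok k s q t : current k s -> isub q (var s vq) t -> 2 < tcode t < 6 ->
  arr s aQp k = var s vq + 1 -> var s vc = tcode t ->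
  let s' := den (dl ::= $vd ;; vS2 ::= $vS ;; combine) s in
  [/\ current k s', derived s s' & forall f, arr s aQs k = beh f ->
     known s' (var s vq) (beh (fop (tcode t) f f))].
Proof.
move=> cu sq c6 ep ec; cbv zeta; rewrite 2!denS; set s1 := den (vS2 ::= $vS) _.
have c1 : current k s1 by do 2!apply: current_frame => //.
have d1 : derived s s1.
  apply: derived_trans (derived_frame (c := dl ::= $vd) _ (cur_queue cu)) _ => //.
  by apply: derived_frame => //; apply: queue_inv_frame => //; exact: cur_queue cu.
have [e1 e2 e3 e4] : [/\ var s1 vS2 = var s vS, var s1 vc = var s vc, var s1 dl = var s vd
  & var s1 vq = var s vq] by [].
have [x1 x2 x3 x4] := current_val cu d1.
have eS1 := cur_S c1; have eS := cur_S cu; have eD := cur_d cu.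
clearbody s1.
have [u ku] : exists u, List.In (1, u) (kids t).
  by case: (t) c6 => //= u _; exists u; left.
have [] := @combine_ok s1 k k.
- by case: (cur_static c1).
- exact: cur_queue c1.
- by [].
- by [].
- by rewrite eS1.
- by rewrite e1 eS x3.
- by rewrite e2 ec; lia.
- move=> forms f g gf gg of_ og.
  have [x [nx ex]] := node_form_unary (var s1 dr) c6 of_.
  exists x, (fop (tcode t) f f); rewrite e2 e3 e4 ec eD -x4; split=> //.
    right; exists q, t; split=> //; apply: (gen_unary c6 ku).
    by apply: gen_at_isub gf; rewrite x2 ep; exact: isub_kid sq ku.
  by case: (tcode t) c6 => [|[|[|[|[|[|?]]]]]].
move=> d2 k2; split; [exact: current_derived | exact: derived_trans d2 |].
by move=> f ef; have := k2 f f; rewrite e1 e2 e4 ec eS1 eS x3 ef; apply.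
Qed.

(* The kid at the queue position [p] is [u], its sibling at [sib] is [v]. *)
Definition siblings (q : nat) (t : term Sigma (nonterm G)) (p sib : nat) : Prop :=
  exists u v o, kids t = [:: (1, u); (o, v)] /\
   (p = q + 1 /\ sib = q + o \/ p = q + o /\ sib = q + 1).

Lemma siblings_bin q t p sib : siblings q t p sib -> 0 < tcode t < 3.
Proof. by move=> [u [v [o [e _]]]]; case: t e. Qed.

Lemma binary_step_ok k s q t : current k s -> isub q (var s vq) t ->
  siblings (var s vq) t (arr s aQp k) (var s vsib) -> var s vc = tcode t ->
  var s vS2 < 2 ^ N ->
  let s' := den binary_step s in
  [/\ current k s', derived s s' &
    known s (var s vsib) (var s vS2) ->
    forall f g, arr s aQs k = beh f -> var s vS2 = beh g ->
     known s' (var s vq) (beh (fop (tcode t) f g))].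
Proof.
move=> cu sq sb ec S2N; rewrite /binary_step.
have c3 := siblings_bin sb.
rewrite denS; set s1 := den (tp ::= _) s; rewrite denS; set s2 := den (ts ::= _) s1.
rewrite denS; set s3 := den lookup s2; rewrite denS; set s4 := den (vk2 ::= _) s3.
have k2' : keeps_current (tp ::= $vsib) by [].
have c2 : current k s2 by do 2!apply: current_frame => //.
have c4 : current k s4 by do 2!apply: current_frame => //.
have d4 : derived s s4.
  apply: derived_trans (derived_frame (c := tp ::= $vsib) _ (cur_queue cu)) _ => //.
  apply: derived_trans (derived_frame (c := ts ::= $vS2) _ _) _ => //.
    by apply: queue_inv_frame => //; exact: cur_queue cu.
  apply: derived_trans (derived_frame (c := lookup) _ (cur_queue c2)) _ => //.
  by apply: derived_frame => //; apply: queue_inv_frame => //; exact: cur_queue c2.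
have ek2 : var s4 vk2 = arr s aTab (var s vsib * 2 ^ N + var s vS2).
  have ex3 : var s3 vx = var s2 tp * 2 ^ var s2 vN + var s2 ts := lookup_ok inp s2.
  rewrite -[LHS]/(arr s3 aTab (var s3 vx)) ex3.
  have -> : arr s3 aTab = arr s aTab by rewrite /s3; frame.
  have -> : var s2 vN = N by have [[e _ _] _ _] := cur_static c2.
  by [].
have [f1 f2 f3 f4] : [/\ var s4 vq = var s vq, var s4 vc = var s vc,
   var s4 vS2 = var s vS2 & var s4 vp = var s vp].
  by rewrite /s4; split; frame; rewrite /s3; frame.
have [x1 x2 x3 x4] := current_val cu d4.
have a4 : arr s4 aTab = arr s aTab by rewrite /s4; frame; rewrite /s3; frame.
rewrite denS; set s6 := den (CIf _ _ _) s4.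
suff [c6 d6 h6] : [/\ current k s6, derived s4 s6 &
    known s (var s vsib) (var s vS2) ->
    forall f g, arr s aQs k = beh f -> var s vS2 = beh g ->
     known s6 (var s vq) (beh (fop (tcode t) f g))].
  split; first by apply: current_frame.
    apply: derived_trans d4 (derived_trans d6 _).
    by apply: derived_frame => //; exact: cur_queue c6.
  move=> kn f g ef eg; apply: extends_known (h6 kn f g ef eg).
  by apply: extends_frame.
clearbody s4; rewrite /s6 denI [eval _ _ _]/=.
case: ifP => h0; rewrite ek2 in h0.
  rewrite den0; split; [exact: c4 | exact: derived_refl (cur_queue c4) |].
  by rewrite /known h0.
have [k2 [kl2 kp2 kS2 kt2]] : exists k2, [/\ k2 < var s4 vtl, arr s4 aQp k2 = var s vsib,
    arr s4 aQs k2 = var s vS2 & var s4 vk2 = k2.+1].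
  have [d [forms [ok _]]] := cur_queue c4.
  have [|k2 kl2 [e1 e2 e3]] := tab_ok ok S2N (p := var s vsib).
    by rewrite /known a4 h0.
  by exists k2; split=> //; rewrite ek2 -a4.
rewrite denS; set s5 := den (CIf _ _ _) s4.
have c5 : current k s5 by apply: current_frame.
have d5 : derived s4 s5 by apply: derived_frame => //; exact: cur_queue c4.
have [y1 y2 y3 y4] := current_val c4 d5.
have [g1 g2 g3] : [/\ var s5 vq = var s vq, var s5 vc = var s vc & var s5 vS2 = var s vS2].
  by rewrite /s5; split; frame.
have [g4 g5 g6 g7] : [/\ arr s5 aQp = arr s4 aQp, arr s5 aQs = arr s4 aQs,
   arr s5 aQd = arr s4 aQd & var s5 vtl = var s4 vtl].
  by rewrite /s5; split; frame.
have g89 : if arr s aQp k == var s vq + 1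
   then var s5 dl = arr s4 aQd k /\ var s5 dr = arr s4 aQd k2
   else var s5 dl = arr s4 aQd k2 /\ var s5 dr = arr s4 aQd k.
  rewrite /s5 denI /= f1 f4 (cur_p cu) -(cur_d c4).
  have -> : (arr s aQp k - (var s vq + 1) + (var s vq + 1 - arr s aQp k) == 0)
    = (arr s aQp k == var s vq + 1) by lia.
  by case: ifP => hc; rewrite ?hc; ev; rewrite ?kt2 ?subn1.
have c3' : 0 < tcode t < 6 by case/andP: c3 => -> /= /ltn_trans; apply.
have [u [v [o [ek esib]]]] := sb.
have o1 : o != 1.
  case: (t) ek => // w1 w2 [_ <- _]; have := size_enc_term_gt0 w1; lia.
have kid1 : isub (var s vq) (var s vq + 1) u by apply: isub_kid sq _; rewrite ek; left.
have kid2 : isub (var s vq) (var s vq + o) v by apply: isub_kid sq _; rewrite ek; right; left.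
have [] := @combine_ok s5 k k2.
- by case: (cur_static c5).
- exact: cur_queue c5.
- by [].
- by rewrite g7.
- exact: cur_S c5.
- by rewrite g3 g5.
- by rewrite g2 ec.
- move=> forms f g; rewrite g4 g6 x2 kp2 x4 => gf gg of_ og.
  case: esib => -[e1 e2].
    move: g89; rewrite e1 eqxx x4 => -[g8 g9].
    have [x [nx ex]] := node_form_binary c3 of_ og.
    exists x, (fop (tcode t) f g); rewrite g1 g2 g8 g9 ec; split=> //.
    right; exists q, t; split=> //; apply: (gen_binary c3 ek).
      by apply: gen_at_isub kid1 _; rewrite -e1.
    by apply: gen_at_isub kid2 _; rewrite -e2.
  (* The current position is the right argument: the node has the sibling on its left, and
     [beh_comm] accounts for the exchange. *)
  move: g89; have -> : (arr s aQp k == var s vq + 1) = false.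
    by rewrite e1 eqn_add2l; exact: negbTE.
  rewrite x4 => -[g8 g9].
  have [x [nx ex]] := node_form_binary c3 og of_.
  exists x, (fop (tcode t) g f); rewrite g1 g2 g8 g9 ec; split=> //.
    right; exists q, t; split=> //; apply: (gen_binary c3 ek).
      by apply: gen_at_isub kid1 _; rewrite -e2.
    by apply: gen_at_isub kid2 _; rewrite -e1.
  exact: beh_comm.
move=> d6 k6; split.
- exact: current_derived.
- exact: derived_trans d6.
- move=> _ f g ef eg; have := k6 f g; rewrite g1 g2 ec; apply.
    by rewrite (cur_S c5) y3 x3.
  by rewrite g3.
Qed.

Definition find_sibling : com :=
  CIf (ne $vp ($vq [+] EC 1))
       (vsib ::= $vq [+] EC 1)
       (vsib ::= aEnd@($vq [+] EC 1)) ;;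
  vS2 ::= EC 0 ;;
  CLoop vB binary_step.

(** Confined to sibling facts [k2] that are already queued. A sibling fact that appears later causes
    the combination when its own turn comes. *)
Lemma binary_ok k s q t sib : current k s -> isub q (var s vq) t ->
  siblings (var s vq) t (arr s aQp k) sib -> var s vc = tcode t ->
  let s' := den find_sibling s in
  [/\ current k s', derived s s' &
    forall k2, k2 < var s vtl -> arr s aQp k2 = sib ->
    forall f g, arr s aQs k = beh f -> arr s aQs k2 = beh g ->
     known s' (var s vq) (beh (fop (tcode t) f g))].
Proof.
move=> cu sq sb ec; rewrite /find_sibling !denS /=.
set s1 := den (CIf _ _ _) s.
have esib : var s1 vsib = sib.
  have [_ [es _ _ _ _] _] := cur_static cu.
  have [u [v [o [ek eo]]]] := sb.
  have ku : List.In (1, u) (kids t) by rewrite ek; left.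
  have oE : o = 1 + size (enc_term u) by case: (t) ek => // w1 w2 [<- <-].
  have kid1 := isub_kid sq ku.
  have ee : arr s aEnd (var s vq + 1) = var s vq + o.
    rewrite (es _ u); first by rewrite oE addnA.
      by apply: ltnW; exact: isub_gt kid1.
    exact: isub_term_at kid1.
  have o1 := size_enc_term_gt0 u.
  rewrite /s1 denI /= (cur_p cu); case: eo => -[e1 e2]; rewrite e1.
    by rewrite subnn addn0 /=; ev; rewrite ee.
  have -> : (var s vq + o - (var s vq + 1) + (var s vq + 1 - (var s vq + o)) == 0) = false.
    by rewrite oE; lia.
  by ev.
set s2 := den (vS2 ::= EC 0) s1.
have c2 : current k s2 by do 2!apply: current_frame => //.
have d2 : derived s s2.
  apply: derived_trans (derived_frame (c := CIf (ne $vp ($vq [+] EC 1))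
       (vsib ::= $vq [+] EC 1) (vsib ::= aEnd@($vq [+] EC 1))) _ (cur_queue cu)) _ => //.
  by apply: derived_frame => //; apply: queue_inv_frame => //; exact: cur_queue cu.
have [f1 f2 f3 f4] : [/\ var s2 vq = var s vq, var s2 vc = var s vc, var s2 vsib = sib & var s2 vS2 = 0].
  rewrite /s2; split; frame => //.
    by rewrite /s1; frame.
  by rewrite /s1; frame.
have fp : [/\ arr s2 aQp = arr s aQp, arr s2 aQs = arr s aQs & var s2 vtl = var s vtl].
  by rewrite /s2; split; frame; rewrite /s1; frame.
clearbody s2.
(* After [i] rounds, the sibling facts whose sets are numbered below [i] have been combined. *)
have := @loop_inv inp vB binary_step s2 (fun i t' => [/\ current k t', derived s2 t',
  var t' vS2 = i & forall k2, k2 < var s vtl -> arr s aQp k2 = sib -> arr s aQs k2 < i ->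
    forall f g, arr s aQs k = beh f -> arr s aQs k2 = beh g ->
     known t' (var s vq) (beh (fop (tcode t) f g))]).
have -> : var s2 vB = 2 ^ N by case: (cur_static c2) => -[].
have [p1 p2 p3] := fp.
case.
- by split=> //; exact: derived_refl (cur_queue c2).
- move=> i t' iB [frv _] [h1 h2 h3 h4].
  have [k1 k2 k3 k4] := current_val c2 h2.
  have [e1 e2 e3] : [/\ var t' vq = var s vq, var t' vc = var s vc & var t' vsib = sib].
    by rewrite !frv.
  have sq' : isub q (var t' vq) t by rewrite e1.
  have sb' : siblings (var t' vq) t (arr t' aQp k) (var t' vsib) by rewrite e1 e3 k2 p1.
  have ec' : var t' vc = tcode t by rewrite e2.
  have i' : var t' vS2 < 2 ^ N by rewrite h3.
  have [b1 b2 b3] := binary_step_ok h1 sq' sb' ec' i'.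
  split=> //.
  + exact: derived_trans b2.
  + by rewrite /binary_step !denS denA /= updE /=; frame; rewrite h3 addn1.
  + move=> k0 kl0 kp0; rewrite ltnS leq_eqVlt => /orP[/eqP eS|ki] f g ef eg; last first.
      by apply: extends_known (h4 _ kl0 kp0 ki f g ef eg); case: b2.
    rewrite e1 e3 h3 in b3; apply: b3 => //; last by rewrite -eS.
      rewrite -eS -kp0; have [[d [forms [ok _]]] [_ _ x3 _ _]] := h2.
      have kl2 : k0 < var s2 vtl by rewrite p3.
      have [z1 z2 _] := x3 _ kl2.
      have kl3 : k0 < var t' vtl by have [_ [z _ _ _ _]] := h2; apply: leq_trans z.
      have [f0 [_ _ _ et]] := queue_ok ok kl3.
      by rewrite /known -p1 -p2 -z1 -z2 et.
    by rewrite k3 p2.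
- move=> h1 h2 _ h4; split=> //; first exact: derived_trans h2.
  move=> k2 kl kp f g ef eg; apply: (h4 k2) => //.
  by rewrite eg beh_lt.
Qed.

Lemma siblings_sym q t p sib : siblings q t p sib -> siblings q t sib p.
Proof. by move=> [u [v [o [ek [[-> ->]|[-> ->]]]]]]; exists u, v, o; split=> //; [right|left]. Qed.

Lemma kid_cases q t u o : List.In (o, u) (kids t) ->
  (2 < tcode t < 6 /\ o = 1) \/ exists sib, siblings q t (q + o) sib.
Proof.
case: t => //= [w1 w2|w1 w2|w1|w1|w1] h; last 3 first.
- by left; case: h => [[<-]|].
- by left; case: h => [[<-]|].
- by left; case: h => [[<-]|].
- right; case: h => [[<- _]|[[<- _]|//]].
    by exists (q + (1 + size (enc_term w1))), w1, w2, (1 + size (enc_term w1)); split=> //; left.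
  by exists (q + 1), w1, w2, (1 + size (enc_term w1)); split=> //; right.
- right; case: h => [[<- _]|[[<- _]|//]].
    by exists (q + (1 + size (enc_term w1))), w1, w2, (1 + size (enc_term w1)); split=> //; left.
  by exists (q + 1), w1, w2, (1 + size (enc_term w1)); split=> //; right.
Qed.

Lemma at_operator_ok k s q t u o : current k s -> isub q (var s vq) t ->
  List.In (o, u) (kids t) -> arr s aQp k = var s vq + o ->
  let s' := den at_operator s in
  [/\ current k s', derived s s',
    2 < tcode t < 6 -> forall f, arr s aQs k = beh f ->
     known s' (var s vq) (beh (fop (tcode t) f f)) &
    forall k2, k2 < var s vtl -> siblings (var s vq) t (arr s aQp k) (arr s aQp k2) ->
    forall f g, arr s aQs k = beh f -> arr s aQs k2 = beh g ->
     known s' (var s vq) (beh (fop (tcode t) f g))].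
Proof.
move=> cu sq ku ep; rewrite /at_operator denS /=; set s1 := den (vc ::= _) s.
have c1 : current k s1 by apply: current_frame.
have d1 : derived s s1 by apply: derived_frame => //; exact: cur_queue cu.
have [x1 x2 x3 x4] := current_val cu d1.
have e1 : var s1 vc = tcode t.
  rewrite /s1 denA /= updE /= cellE ?(term_at_code (isub_term_at sq)) //.
  by have := isub_lt sq; have := size_enc_term_gt0 t; lia.
have [e2 e3 e4 e5] : [/\ var s1 vq = var s vq, arr s1 aQp = arr s aQp,
  arr s1 aQs = arr s aQs & var s1 vtl = var s vtl] by [].
clearbody s1; rewrite denI [eval _ _ _]/= e1.
have sq1 : isub q (var s1 vq) t by rewrite e2.
case: (kid_cases (var s vq) ku) => [[c6 o1]|[sib sb]].
  have -> : (3 - tcode t == 0) by lia.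
  have ep1 : arr s1 aQp k = var s1 vq + 1 by rewrite e2 e3 ep o1.
  have [a1 a2 a3] := unary_ok c1 sq1 c6 ep1 e1.
  rewrite e2 e4 in a3; split=> //; first exact: derived_trans a2.
  by move=> k2 _ /siblings_bin; lia.
have c3 := siblings_bin sb.
have -> : (3 - tcode t == 0) = false by lia.
rewrite -ep in sb.
have sb1 : siblings (var s1 vq) t (arr s1 aQp k) sib by rewrite e2 e3.
have [a1 a2 a3] := binary_ok c1 sq1 sb1 e1.
rewrite e2 e3 e4 e5 in a3; split=> //; first exact: derived_trans a2.
  by lia.
move=> k2 kl sb2; apply: a3 => //.
have [w1 [w2 [o' [ek h]]]] := sb; have [w1' [w2' [o'' [ek' h']]]] := sb2.
have eo : o'' = o' by rewrite ek in ek'; case: ek'.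
rewrite eo in h'.
have o2 : o' != 1 by case: (t) ek => // v1 v2 [_ <- _]; have := size_enc_term_gt0 v1; lia.
by case: h h' => -[h1 ->] [] [h2 ->] //; lia.
Qed.

(** The parent [q] is either a rule or an operator; in each case the conclusions about the other
    kind hold by disjointness of the positions. *)
Lemma at_parent_ok k s q t : current k s -> isub q (arr s aQp k) t ->
  let s' := den at_parent s in
  [/\ current k s', derived s s',
    forall A t', hdr q A t' -> known s' q (arr s aQs k),
    forall q' t', isub q' q t' -> 2 < tcode t' < 6 -> forall f, arr s aQs k = beh f ->
     known s' q (beh (fop (tcode t') f f)) &
    forall q' t' k2, isub q' q t' -> k2 < var s vtl ->
    siblings q t' (arr s aQp k) (arr s aQp k2) ->
    forall f g, arr s aQs k = beh f -> arr s aQs k2 = beh g ->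
     known s' q (beh (fop (tcode t') f g))].
Proof.
move=> cu sp; rewrite /at_parent denI /=.
have [_ [_ gp gh _ _] _] := cur_static cu.
have eq_ : var s vq = q by rewrite (cur_q cu) (gp _ _ _ sp).
have q0 := isub_parent_neq0 sp.
case: (isub_inv sp) => [[A hh ep]|[q' [t' [o [sq ku ep]]]]].
  rewrite eq_ (gh _ _ _ hh) /= denS; set s1 := den (tp ::= _) s.
  have c1 : current k s1 by apply: current_frame.
  have d1 : derived s s1 by apply: derived_frame => //; exact: cur_queue cu.
  have e1 : var s1 tp = q by rewrite /s1 denA /= updE /= eq_.
  have [e2 e3] : arr s1 aQp = arr s aQp /\ arr s1 aQs = arr s aQs by [].
  clearbody s1; have [] := @forward_current k s1 c1.
    rewrite e1 e2 => _ f /(gen_at_isub sp) gf; left; exists A, t; split=> //.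
  rewrite e1 e3 => c2 d2 k2; split=> //.
  - exact: derived_trans d2.
  - by move=> *; apply: k2.
  - by move=> q' t' /(hdr_isub_disj hh).
  - by move=> q' t' k0 /(hdr_isub_disj hh).
rewrite eq_ (gp _ _ _ sq) (negbTE (isub_parent_neq0 sq)).
have sq1 : isub q' (var s vq) t' by rewrite eq_.
have ep1 : arr s aQp k = var s vq + o by rewrite eq_.
have [a1 a2 a3 a4] := at_operator_ok cu sq1 ku ep1.
rewrite eq_ in a3 a4; split=> //.
- by move=> A u hh; case: (hdr_isub_disj hh sq).
- by move=> q1 t1 s1; have [_ <-] := isub_inj sq s1; exact: a3.
- by move=> q1 t1 k2 s1; have [_ <-] := isub_inj sq s1; exact: a4.
Qed.

(** * The main loop *)

(** The consequences of entry [k] alone: acceptance, transfer from a rule to the first occurrence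
    and from one occurrence to the next, transfer to the rule, and unary operators. Those of a pair
    of entries are in [done2]. *)
Definition done1 (s : state) (k : nat) : Prop :=
  (forall A t, hdr (arr s aQp k) A t ->
     (A = start_nonterm G -> forall f, arr s aQs k = beh f -> good f -> var s vfnd != 0) /\
     (forall q p, isub q p (TNonterm A) -> p = arr s aOcc (rank A) ->
        known s p (arr s aQs k))) /\
  (forall q t, isub q (arr s aQp k) t ->
     [/\ forall A, t = TNonterm A -> arr s aNxt (arr s aQp k) != 0 ->
        known s (arr s aNxt (arr s aQp k)) (arr s aQs k),
      forall A t', hdr q A t' -> known s q (arr s aQs k)
    & forall q' t', isub q' q t' -> 2 < tcode t' < 6 -> forall f, arr s aQs k = beh f ->
        known s q (beh (fop (tcode t') f f))]).

Definition done2 (s : state) (k k2 : nat) : Prop :=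
  forall q q' t', isub q' q t' -> siblings q t' (arr s aQp k) (arr s aQp k2) ->
  forall f g, arr s aQs k = beh f -> arr s aQs k2 = beh g ->
  known s q (beh (fop (tcode t') f g)).

Lemma done1_ext s s' k : k < var s vtl -> extends s s' ->
  arr s' aOcc = arr s aOcc -> arr s' aNxt = arr s aNxt ->
  (var s vfnd != 0 -> var s' vfnd != 0) -> done1 s k -> done1 s' k.
Proof.
move=> kl x eo en ef [h1 h2]; have [_ _ /(_ _ kl)[e1 e2 _] _ _] := x.
rewrite /done1 e1 e2 eo en; split.
  move=> A t hh; have [a1 a2] := h1 _ _ hh; split.
    by move=> eA f bf gf; apply: ef; exact: a1 bf gf.
  by move=> q p sp ep; apply: extends_known x _; exact: a2 sp ep.
move=> q t sp; have [a1 a2 a3] := h2 _ _ sp; split.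
- by move=> A et h0; apply: extends_known x _; exact: a1 et h0.
- by move=> A t' hh; apply: extends_known x _; exact: a2 hh.
- by move=> q' t' sq c6 f bf; apply: extends_known x _; exact: a3 sq c6 f bf.
Qed.

Lemma done2_ext s s' k k2 : k < var s vtl -> k2 < var s vtl -> extends s s' ->
  done2 s k k2 -> done2 s' k k2.
Proof.
move=> kl kl2 x h; have [_ _ e _ _] := x.
have [e1 e2 _] := e _ kl; have [e1' e2' _] := e _ kl2.
rewrite /done2 e1 e2 e1' e2' => q q' t' sq sb f g bf bg.
by apply: extends_known x _; exact: h sq sb f g bf bg.
Qed.

Lemma done2_sym s k k2 : done2 s k k2 -> done2 s k2 k.
Proof.
move=> h q q' t' sq sb f g bf bg; have sb' := siblings_sym sb.
rewrite beh_comm; first exact: h sq sb' _ _ bg bf.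
exact: siblings_bin sb.
Qed.

(** The consequences of the processed entries are all known; when every entry has been processed,
    this is saturation. *)
Record main_inv (s : state) : Prop := MainInv {
  main_static : static_ok s;
  main_queue : queue_inv s;
  main_found : found_ok s;
  main_head : var s vhd <= var s vtl;
  main_done1 : forall k, k < var s vhd -> done1 s k;
  main_done2 : forall k k2, k < var s vhd -> k2 < var s vhd -> done2 s k k2 }.

Lemma process_ok s : main_inv s -> var s vhd < var s vtl ->
  [/\ main_inv (den process s), extends s (den process s)
    & var (den process s) vhd = (var s vhd).+1].
Proof.
move=> [st qi fo hd d1 d2] hl; set k := var s vhd in hl *.
have ehd : var (den process s) vhd = k.+1.
  by rewrite /process !denS denA /= updE /=; frame; rewrite addn1.
rewrite /process denS; set s1 := den (vp ::= _) s.
rewrite denS; set s2 := den (vS ::= _) s1.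
rewrite denS; set s3 := den (vd ::= _) s2.
rewrite denS; set s4 := den (vq ::= _) s3.
have [e1 e2 e3 e4] : [/\ var s4 vp = arr s aQp k, var s4 vS = arr s aQs k,
  var s4 vd = arr s aQd k & var s4 vq = arr s aPar (arr s aQp k)] by [].
have x4 : extends s s4.
  apply: (extends_trans (s2 := s3)); last by apply: extends_frame.
  apply: (extends_trans (s2 := s2)); last by apply: extends_frame.
  by apply: (extends_trans (s2 := s1)); apply: extends_frame.
have c4 : current k s4.
  by split=> //; do ?apply: queue_inv_frame => //.
have a4 : [/\ arr s4 = arr s, var s4 vtl = var s vtl, var s4 vfnd = var s vfnd
  & var s4 vhd = k] by [].
clearbody s4; case: a4 => a4 tl4 f4 hd4.
rewrite denS; set s5 := den (CIf _ _ _) s4.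
have [c5 d5 m5 dn1 dn2] : [/\ current k s5, derived s4 s5, var s4 vfnd != 0 -> var s5 vfnd != 0,
   done1 s5 k & forall k2, k2 < var s vtl -> done2 s5 k k2].
  have [f [gf ef]] := current_gen c4.
  rewrite /s5 denI [eval _ _ _]/= e4; rewrite a4 in gf.
  have [_ [_ gp gh _ _] _] := st.
  case: gf => [[A [t [hh gt]]]|[q [t [sp gt]]]].
    rewrite (gh _ _ _ hh) /=.
    have hh4 : hdr (arr s4 aQp k) A t by rewrite a4.
    have [b1 b2 b3 b4 b5] := at_header_ok c4 hh4.
    have [v1 v2 v3 v4] := current_val c4 b2.
    split=> //.
      rewrite /done1 v2 v3; split=> [B u|q u]; last by move/(hdr_isub_disj hh4).
      move=> hu; have [eA _] := hdr_inj hh4 hu; rewrite -eA; split=> // q p sp.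
      by frame; exact: b5 sp.
    (* A rule position is not the argument of an operator, so [done2] is vacuous here. *)
    move=> k2 kl2 q q' t' sq; have [_ _ xv _ _] := b2.2.
    rewrite v2 => sb; case: (siblings_bin sb) => _; exfalso.
    have [u [v [o [ek eo]]]] := sb.
    have [w kw] : exists w, isub q (arr s4 aQp k) w.
      case: eo => -[-> _]; [exists u | exists v]; apply: isub_kid sq _; rewrite ek; first by left.
      by right; left.
    exact: hdr_isub_disj hh4 kw.
  rewrite (gp _ _ _ sp) (negbTE (isub_parent_neq0 sp)) denS.
  have sp4 : isub q (arr s4 aQp k) t by rewrite a4.
  have [b1 b2 b3] := at_occurrence_ok c4 sp4.
  set s6 := den at_occurrence s4 in b1 b2 b3 *.
  have [v1 v2 v3 v4] := current_val c4 b2.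
  have sp6 : isub q (arr s6 aQp k) t by rewrite v2.
  have [g1 g2 g3 g4 g5] := at_parent_ok b1 sp6.
  set s7 := den at_parent s6 in g1 g2 g3 g4 g5 *.
  have [w1 w2 w3 w4] := current_val b1 g2.
  split=> //.
  - exact: derived_trans g2.
  - by rewrite /s7; frame; rewrite /s6; frame.
  - rewrite /done1 w2 v2 w3 v3; split=> [B u hu|q1 u su].
      by case: (hdr_isub_disj hu sp4).
    have [eq1 eu] := isub_inj sp4 su; rewrite -eq1 -eu.
    rewrite v3 in g3 g4; split=> //.
    move=> A et; have -> : arr s7 aNxt = arr s4 aNxt by rewrite /s7; frame; rewrite /s6; frame.
    by move=> h0; apply: extends_known (b3 _ et h0); case: g2.
  - move=> k2 kl2 q1 q' t' sq; rewrite w2.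
    have kl4 : k2 < var s4 vtl by rewrite tl4.
    have [_ [y1 _ /(_ _ kl4)[y2 y3 _] _ _]] := b2.
    have kl6 : k2 < var s6 vtl by apply: leq_trans y1.
    have [_ [_ _ /(_ _ kl6)[z2 z3 _] _ _]] := g2.
    rewrite z2 w3 z3 => sb.
    have [u [v [o [ek eo]]]] := sb.
    have [w kw] : exists w, isub q1 (arr s6 aQp k) w.
      case: eo => -[-> _]; [exists u | exists v]; apply: isub_kid sq _; rewrite ek; first by left.
      by right; left.
    have [eq1 _] := isub_inj sp6 kw; rewrite -eq1 in sb sq *.
    exact: g5 sq kl6 sb.
have x5 : extends s s5 by apply: extends_trans x4 _; case: d5.
set s6 := den (incr vhd) s5.
have x6 : extends s s6 by apply: extends_trans x5 _; apply: extends_frame.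
have x56 : extends s5 s6 by apply: extends_frame.
have hl6 : var s6 vhd = k.+1.
  by rewrite /s6 /s5 denA /= updE /=; frame; rewrite hd4 addn1.
have kl5 := cur_lt c5.
have [eO eN] : arr s6 aOcc = arr s aOcc /\ arr s6 aNxt = arr s aNxt.
  by rewrite /s6 /s5; split; frame; rewrite a4.
have m6 : var s vfnd != 0 -> var s6 vfnd != 0 by rewrite -f4 => /m5.
have dk : done1 s6 k by apply: done1_ext dn1.
(* Entry [k] has been combined with every entry queued before, processed or not; pairs with [k] in
   second place follow by symmetry. *)
have dk2 k2 : k2 < var s vtl -> done2 s6 k k2.
  move=> kl2; apply: done2_ext (dn2 _ kl2) => //.
  by apply: leq_trans kl2 _; case: x5.
split=> //; split=> //.
- by apply: static_frame => //; exact: cur_static c5.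
- by apply: queue_inv_frame => //; exact: cur_queue c5.
- by apply: found_ok_ext x56 _ _ (cur_found c5) => //; exact: cur_queue c5.
- by rewrite hl6; apply: leq_trans kl5 _; case: x56.
- move=> k0; rewrite hl6 ltnS leq_eqVlt => /orP[/eqP->//|kk].
  by apply: done1_ext (d1 _ kk) => //; exact: ltn_trans hl.
- move=> k0 k2; rewrite hl6 (ltnS k0) (leq_eqVlt k0) (ltnS k2) (leq_eqVlt k2) => /orP[/eqP->|kk] /orP[/eqP->|kk2].
  + exact: dk2.
  + by apply: dk2; exact: ltn_trans hl.
  + by apply/done2_sym/dk2; exact: ltn_trans hl.
  + by apply: done2_ext (d2 _ _ kk kk2) => //; exact: ltn_trans hl.
Qed.

Lemma gen_at_bounds p f : gen_at p f -> R <= p < L.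
Proof.
case=> [[A [t [hh _]]]|[q [t [sp _]]]].
  by apply/andP; split; [exact: hdr_ge hh | have := term_at_size (hdr_term_at hh); lia].
apply/andP; split; first exact/ltnW/isub_gt/sp.
by have := isub_lt sp; have := size_enc_term_gt0 t; lia.
Qed.

(** The table leads from a fact back to its queue index, so queued facts are distinct; each has a
    position from [R] up to [L] and one of 2^N sets. *)
Lemma queue_bound s : queue_inv s -> var s vtl <= (L - R) * 2 ^ N.
Proof.
move=> [d [forms [ok _]]].
pose idx k := arr s aQp k * 2 ^ N + arr s aQs k.
have hk k : k < var s vtl -> R * 2 ^ N <= idx k < R * 2 ^ N + (L - R) * 2 ^ N.
  move=> kl; have [f [gf ef _ _]] := queue_ok ok kl.
  have /andP[h1 h2] := gen_at_bounds gf; have := beh_lt Pos Neg f; rewrite -ef => h3.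
  rewrite /idx -mulnDl subnKC; last by apply: ltnW; exact: leq_ltn_trans h2.
  apply/andP; split; first by apply: leq_trans (leq_addr _ _); rewrite leq_mul2r h1 orbT.
  exact: flat_index_lt.
have u : uniq [seq idx k - R * 2 ^ N | k <- iota 0 (var s vtl)].
  rewrite map_inj_in_uniq ?iota_uniq // => k k'; rewrite !mem_iota !add0n /= => kl kl' e.
  have ei : idx k = idx k' by have := hk _ kl; have := hk _ kl'; lia.
  have [f [_ _ _ t1]] := queue_ok ok kl; have [f' [_ _ _ t2]] := queue_ok ok kl'.
  by move: t1; rewrite -/(idx k) ei t2 => -[].
have := uniq_leq_size u (s2 := iota 0 ((L - R) * 2 ^ N)); rewrite size_map !size_iota; apply.
move=> x /mapP[k]; rewrite !mem_iota !add0n => /andP[_ kl] ->.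
by apply/andP; split=> //; have := hk _ kl; lia.
Qed.

Lemma main_ok s : static_ok s -> queue_inv s -> atoms_known s ->
  var s vhd = 0 -> var s vfnd = 0 ->
  [/\ main_inv (den main s), var (den main s) vhd = var (den main s) vtl
    & atoms_known (den main s)].
Proof.
move=> st qi ak h0 f0; rewrite /main 2!denS.
set s1 := den (vT ::= $vnc) s; set s2 := den (CLoop vN _) s1.
have st2 : static_ok s2 by do 2!apply: static_frame => //.
have q2 : queue_inv s2 by do 2!apply: queue_inv_frame => //.
have x2 : extends s s2.
  by apply: (extends_trans (s2 := s1)); apply: extends_frame.
have eT : var s2 vT = (L - R) * 2 ^ N.
  by rewrite /s2 double_loop; have [[eN _ _] _ [_ _ enc _]] := st; rewrite /s1; ev; rewrite eN enc.
have [e1 e2] : var s2 vhd = 0 /\ var s2 vfnd = 0.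
  by rewrite /s2; split; frame; rewrite /s1; frame.
have m2 : main_inv s2.
  split=> //; rewrite ?e1 //.
  by rewrite /found_ok e2.
(* Either every round so far has processed an entry, or the queue has run dry and stays so. At the
   end both cases give [vhd = vtl], the first one by [queue_bound]. *)
have := @loop_inv inp vT main_step s2 (fun i t => [/\ main_inv t, extends s2 t &
   var t vhd = i \/ var t vhd = var t vtl]).
rewrite eT; case.
- by split; [exact: m2 | exact: extends_refl | left].
- move=> i t _ _ [m x h]; rewrite /main_step denI /=.
  case: ifP => hd; first by rewrite den0; split=> //; right; have := main_head m; lia.
  have [|m' x' e'] := process_ok m; first by lia.
  split=> //; first exact: extends_trans x'.
  by left; rewrite e'; case: h => [->//|h]; lia.
set s3 := den (CLoop vT _) s2 => m3 x3 h3; split=> //.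
  case: h3 => // h3; apply/eqP; rewrite eqn_leq (main_head m3) h3.
  exact: queue_bound (main_queue m3).
move=> q p a sp; apply: extends_known x3 _; apply: extends_known x2 _; exact: ak sp.
Qed.

(** * Correctness of the answer at saturation *)

Section Saturated.
Variable s : state.
Hypotheses (inv : main_inv s) (all_done : var s vhd = var s vtl) (ak : atoms_known s).

Lemma known_queue p f : known s p (beh f) -> exists k,
  [/\ k < var s vhd, arr s aQp k = p & arr s aQs k = beh f].
Proof.
have [d [forms [ok _]]] := main_queue inv.
move=> /(tab_ok ok (beh_lt Pos Neg f))[k kl [e1 e2 _]].
by exists k; rewrite all_done.
Qed.

(** Induction on the distance from the end of the input, since occurrence lists lead from larger
    positions to smaller ones. *)
Lemma known_occurrences A S : (forall q p, isub q p (TNonterm A) ->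
    p = arr s aOcc (enum_rank A) -> known s p S) ->
  (forall q p, isub q p (TNonterm A) -> known s p S -> arr s aNxt p != 0 ->
    known s (arr s aNxt p) S) ->
  forall q p, isub q p (TNonterm A) -> known s p S.
Proof.
move=> h1 h2; have [_ [_ _ _ _ [_ oc]] _] := main_static inv.
move=> q p; have [n ln] := ubnP (L - p); elim: n => // n IH in q p ln * => sp.
have pL : p < L by have := isub_lt sp; have /= := size_enc_term_gt0 (TNonterm A : term Sigma _); lia.
case: (oc _ _ _ sp pL) => [e|[q' [x' [k1 k2 k3 k4]]]]; first exact: h1 sp e.
rewrite -k4; apply: (h2 _ _ k3); last by rewrite k4; have := isub_gt sp; lia.
by apply: IH k3; lia.
Qed.

Lemma known_header h A t f : hdr h A t -> known s h.+1 (beh f) -> known s h (beh f).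
Proof.
move=> hh /known_queue[k [kl kp kS]]; have [_ d] := main_done1 inv kl.
have sr := isub_root hh; rewrite -kp in sr.
by have [_ d2 _] := d _ _ sr; rewrite -kS; exact: d2 hh.
Qed.

Lemma known_unary q p t u f : isub q p t -> kids t = [:: (1, u)] -> 2 < tcode t < 6 ->
  (forall q p, isub q p u -> known s p (beh f)) -> known s p (beh (fop (tcode t) f f)).
Proof.
move=> sp ek c6 IH; have ku : isub p (p + 1) u by apply: isub_kid sp _; rewrite ek; left.
have [k [kl kp kS]] := known_queue (IH _ _ ku).
have [_ d] := main_done1 inv kl; rewrite -kp in ku.
by have [_ _ d3] := d _ _ ku; exact: d3 sp c6 f kS.
Qed.

Lemma known_binary q p t u v o f g : isub q p t -> kids t = [:: (1, u); (o, v)] ->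
  (forall q p, isub q p u -> known s p (beh f)) ->
  (forall q p, isub q p v -> known s p (beh g)) ->
  known s p (beh (fop (tcode t) f g)).
Proof.
move=> sp ek IHu IHv.
have ku : isub p (p + 1) u by apply: isub_kid sp _; rewrite ek; left.
have kv : isub p (p + o) v by apply: isub_kid sp _; rewrite ek; right; left.
have [k [kl kp kS]] := known_queue (IHu _ _ ku).
have [k' [kl' kp' kS']] := known_queue (IHv _ _ kv).
have d2 := main_done2 inv kl kl'; apply: (d2 _ q t sp _ f g kS kS').
by exists u, v, o; split=> //; left.
Qed.

(** Induction on the derivation. The claim concerns all positions of [t], because equal subterms may
    occur in several places and a fact about a nonterminal has to reach each of its occurrences. *)
Lemma gen_known t f : gen t f -> forall q p, isub q p t -> known s p (beh f).
Proof.
elim=> {t f} [a|u v f g _ IHu _ IHv|u v f g _ IHu _ IHv|u f _ IH|u f _ IH|u f _ IH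
  |A t f i gt IH] q p sp.
- exact: ak sp.
- exact: (known_binary sp erefl IHu IHv).
- exact: (known_binary sp erefl IHu IHv).
- exact: (known_unary sp erefl isT IH).
- exact: (known_unary sp erefl isT IH).
- exact: (known_unary sp erefl isT IH).
- have [h hh] := In_hdr Pos Neg i.
  have kh := known_header hh (IH _ _ (isub_root hh)).
  have [k [kl kp kS]] := known_queue kh.
  have [d _] := main_done1 inv kl; rewrite -kp in hh; have [_ d2] := d _ _ hh.
  rewrite kS in d2; apply: known_occurrences sp => // q' p' sp' kn h0.
  have [k' [kl' kp' kS']] := known_queue kn.
  have [_ d'] := main_done1 inv kl'; rewrite -kp' in sp'.
  have [d3 _ _] := d' _ _ sp'; rewrite kp' kS' in d3.
  exact: d3.
Qed.

Lemma not_found_none : var s vfnd = 0 -> forall f, ~ separates Pos Neg G f.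
Proof.
move=> f0 f sf; have gf := separates_good sf.
have [/language_gen lf _ _] := sf; inversion lf as [| | | | | |A t f' i gt]; subst.
have [h hh] := In_hdr Pos Neg i.
have kh := known_header hh (gen_known gt (isub_root hh)).
have [k [kl kp kS]] := known_queue kh.
have [d _] := main_done1 inv kl; rewrite -kp in hh; have [d1 _] := d _ _ hh.
by have := d1 erefl f kS gf; rewrite f0.
Qed.

(** The dag is cut behind the node of an accepted fact. A node takes at most three cells, and the
    remaining cell is the tag of the answer. *)
Lemma answer_ok : exists r : answer Sigma, [/\ correct_answer Pos Neg G r,
    size (enc_answer r) <= 1 + 3 * var s vtl,
    var s vfnd = 0 -> r = None
  & var s vfnd != 0 -> var s vfe = size (enc_answer r) /\
    forall i, i < size (enc_answer r) -> arr s aOut i = nth 0 (enc_answer r) i].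
Proof.
case: (eqVneq (var s vfnd) 0) => f0.
  by exists None; split=> //; exact: not_found_none.
have [k [t [kl hh hg ee]]] := main_found inv f0.
have [d [forms [ok ld]]] := main_queue inv.
have [f [gf ef of_ _]] := queue_ok ok kl.
have dl' : arr s aQd k < size d by rewrite -(size_dag_forms ok) -onthTE of_.
set j := arr s aQd k in of_ ee dl'.
have ht e : size (flatten [seq @enc_node Sigma x | x <- e]) <= 3 * size e.
  elim: e => //= x e IH; rewrite size_cat mulnS leq_add //.
  by case: x.
exists (Some (take j.+1 d)); split=> //.
- exists f; first exact: dag_form_take (dag_formsE ok) of_.
  apply: good_separates; last exact: hg.
  by apply/language_gen; apply: GenRule (hdr_In hh) (gen_at_hdr hh gf).
- rewrite /= add1n ltnS; apply: leq_trans (ht _) _; rewrite leq_mul2l /=.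
  apply: leq_trans ld; rewrite size_take; case: ifP => //.
- by move=> e; move: f0; rewrite e.
- move=> _; rewrite ee (dag_ends ok dl'); split=> // i il.
  have ed : dag_cells d = dag_cells (take j.+1 d) ++ flatten [seq enc_node x | x <- drop j.+1 d].
    by rewrite /dag_cells /= -flatten_cat -map_cat cat_take_drop.
  rewrite (dag_outE ok) ed ?nth_cat ?size_cat.
    by rewrite -[enc_answer _]/(dag_cells (take j.+1 d)) in il *; rewrite il.
  by apply: leq_trans il _; rewrite leq_addr.
Qed.

End Saturated.

(** * Writing the output *)

Lemma copy_rest_ok rs t : uniq rs -> 0 \notin rs ->
  let c := foldr (fun r c => r@[$vi] ::= aOut@($vx [+] EC r) ;; c) CSkip rs in
  var (den c t) = var t /\ forall b, arr (den c t) b =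
    if b \in rs then update (arr t b) (var t vi) (arr t aOut (var t vx + b)) else arr t b.
Proof.
elim: rs t => [|r rs IH] t //= /andP[rn u]; rewrite inE => /norP[r0 n0].
have [e1 e2] := IH (seta t r (var t vi) (arr t aOut (var t vx + r))) u n0.
rewrite denS denT /= e1; split=> // b; rewrite e2 inE /=.
have -> : (0 == r) = false by exact: negbTE.
by case: (b =P r) => [->|_] //=; rewrite (negbTE rn).
Qed.

Lemma copy_lanes_ok t : var t vx + 1 > var t vi ->
  var (den copy_lanes t) = var t /\ forall b, arr (den copy_lanes t) b =
    if b < 32 then update (arr t b) (var t vi) (arr t aOut (var t vx + b)) else arr t b.
Proof.
move=> h.
have -> : copy_lanes = (aOut@[$vi] ::= aOut@($vx [+] EC 0) ;;
  foldr (fun r c => r@[$vi] ::= aOut@($vx [+] EC r) ;; c) CSkip (iota 1 31)) by [].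
rewrite denS denT; set t1 := seta _ _ _ _.
have [-> e2] := @copy_rest_ok (iota 1 31) t1 isT isT.
split=> // b; rewrite e2 mem_iota /t1 /=.
case: b => [|b]; first by [].
have -> : (0 < b.+1 < 1 + 31) = (b.+1 < 32) by lia.
rewrite /=; case: ifP => // _.
by rewrite updE; have -> : (var t vx + b.+1 == var t vi) = false by lia.
Qed.

(** Pass [j] reads from index [32 * j] on, while earlier passes have overwritten only indices below
    [j]; hence copying in place loses nothing. *)
Definition copy_inv (s : state) (j : nat) (t : state) : Prop :=
  [/\ var t vi = j, var t vx = j * 32,
    forall a j', a < 32 -> j' < j -> arr t a j' = arr s aOut (j' * 32 + a)
  & forall x, j <= x -> arr t aOut x = arr s aOut x].

Lemma copy_step_ok s j t : copy_inv s j t ->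
  copy_inv s j.+1 (den (copy_lanes ;; vx ::= $vx [+] EC 32 ;; incr vi) t).
Proof.
move=> [h1 h2 h3 h4].
have h0 : var t vi < var t vx + 1 by rewrite h1 h2; lia.
have [f1 f2] := copy_lanes_ok h0.
rewrite denS; move: (den copy_lanes t) f1 f2 => t1 f1 f2; rewrite denS.
split.
- by ev; rewrite f1 h1 addn1.
- by ev; rewrite f1 h2; lia.
- move=> a j' a32; rewrite ltnS leq_eqVlt /=; rewrite f2 a32 h1 h2 updE.
  case: eqP => [-> _|_ /= jj]; last exact: h3.
  by rewrite h4 //; lia.
- move=> x jx; rewrite /= f2 /= updE h1; have -> : (x == j) = false by lia.
  by apply: h4; exact: ltnW.
Qed.

Lemma copy_loop_ok s : var s vx = 0 -> var s vi = 0 ->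
  copy_inv s (var s vOL)
    (den (CLoop vOL (copy_lanes ;; vx ::= $vx [+] EC 32 ;; incr vi)) s).
Proof.
move=> e1 e2; apply: (@loop_inv inp vOL _ s (copy_inv s)); first by split.
by move=> j t _ _; exact: copy_step_ok.
Qed.

Lemma finish_ok s (out : seq nat) :
  var (den choose_output s) vOL = size out ->
  (forall i, i < size out -> arr (den choose_output s) aOut i = nth 0 out i) ->
  var (den finish s) vOL = size out /\
  forall i, i < size out -> cell inp (den finish s) (L + i) = nth 0 out i.
Proof.
move=> eO hO; rewrite /finish denS.
have [e1 e2] : var (den choose_output s) vx = 0 /\ var (den choose_output s) vi = 0.
  by rewrite /choose_output; split; ev.
split; first by rewrite var_frame.
have [_ _ h3 _] := copy_loop_ok e1 e2; rewrite eO in h3.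
(* Address [L + i] is cell [i %/ 32] of array [i %% 32]. As [i %/ 32 <= i], one pass per output cell
   fills enough cells, and the number of passes needs no division. *)
move=> i il; rewrite /cell ltnNge leq_addr /= addKn h3 ?ltn_mod //.
  by rewrite -divn_eq hO.
by apply: leq_ltn_trans il; rewrite leq_div.
Qed.

Lemma choose_output_ok s (r : answer Sigma) :
  (var s vfnd = 0 -> r = None) ->
  (var s vfnd != 0 -> var s vfe = size (enc_answer r) /\
    forall i, i < size (enc_answer r) -> arr s aOut i = nth 0 (enc_answer r) i) ->
  var (den choose_output s) vOL = size (enc_answer r) /\
  forall i, i < size (enc_answer r) ->
    arr (den choose_output s) aOut i = nth 0 (enc_answer r) i.
Proof.
move=> h1 h2; rewrite /choose_output; ev; rewrite denI /=; case: eqP => f0.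
  by rewrite (h1 f0); ev; split=> // -[].
have [|e1 e2] := h2; first exact/eqP.
by ev; rewrite e1.
Qed.

Local Notation scanned_state := (den scan (start_state)).
Local Notation parsed_state := (den parents (den ends scanned_state)).
Local Notation final_state := (den main (den atoms parsed_state)).

Lemma parsed_ok : static_ok parsed_state.
Proof.
have [eL eR enc eS nok] := scan_ok.
set s1 := scanned_state in eL eR enc eS nok *.
have z a x : a \notin moda scan -> arr s1 a x = 0 by move=> h; rewrite /s1 arr_frame.
set s2 := den ends s1.
have ed : ends_done s2 by move=> p t; exact: ends_ok.
have gok : gram_ok (den parents s2).
  apply: parents_ok => //; rewrite /s2; frame => // x.
  by split; rewrite ?arr_frame //; apply: z.
split=> //; last by split; frame; rewrite /s2; frame.
by do 2!apply: nodes_ok_frame => //.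
Qed.

Lemma final_ok : [/\ main_inv final_state, var final_state vhd = var final_state vtl
  & atoms_known final_state].
Proof.
have [st q ak] : [/\ static_ok (den atoms parsed_state), queue_inv (den atoms parsed_state)
    & atoms_known (den atoms parsed_state)].
  apply: atoms_ok; first exact: parsed_ok.
  - by frame.
  - by frame.
  - by move=> x; frame.
by apply: main_ok => //; frame.
Qed.

Lemma den_seq8 c1 c2 c3 c4 c5 c6 c7 c8 s :
  den (c1 ;; c2 ;; c3 ;; c4 ;; c5 ;; c6 ;; c7 ;; c8) s
  = den c8 (den c7 (den c6 (den c5 (den c4 (den (c1 ;; c2 ;; c3) s))))).
Proof. by []. Qed.

Lemma cost_seq8 c1 c2 c3 c4 c5 c6 c7 c8 s :
  let s3 := den (c1 ;; c2 ;; c3) s in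
  let s4 := den c4 s3 in let s5 := den c5 s4 in let s6 := den c6 s5 in
  cost inp (c1 ;; c2 ;; c3 ;; c4 ;; c5 ;; c6 ;; c7 ;; c8) s
  = cost inp (c1 ;; c2 ;; c3) s + (cost inp c4 s3 + (cost inp c5 s4 +
     (cost inp c6 s5 + (cost inp c7 s6 + cost inp c8 (den c7 s6))))).
Proof. by rewrite /= !addnA. Qed.

Lemma solver_denE : den solver (start_state) = den finish final_state.
Proof. by rewrite /solver /scan den_seq8. Qed.

Lemma solver_ok : exists2 r : answer Sigma, correct_answer Pos Neg G r &
  let s := den solver (start_state) in
  [/\ var s vOL = size (enc_answer r), var s vOL <= 1 + 3 * ((L - R) * 2 ^ N)
  & forall i, i < size (enc_answer r) -> cell inp s (L + i) = nth 0 (enc_answer r) i].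
Proof.
have [inv hd ak] := final_ok.
have [r [cr sr h1 h2]] := answer_ok inv hd ak.
have [e1 e2] := choose_output_ok h1 h2.
have [e3 e4] := finish_ok e1 e2.
exists r; first exact: cr.
cbv zeta; rewrite solver_denE; split; [exact: e3 | rewrite e3 | exact: e4].
apply: leq_trans sr _; rewrite leq_add2l leq_mul2l /=.
exact: queue_bound (main_queue inv).
Qed.

(** * Running time *)

(** The outermost loop is charged by its actual count and only the loops inside by [M]; in this way
    the size of the grammar enters linearly. *)
Lemma cost_loop_static x c s M : 0 < M -> static c ->
  (forall y, y \in loopv c -> var s y <= M) ->
  cost inp (CLoop x c) s <= 3 + var s x * (weight c * M ^ depth c + 5).
Proof.
move=> M0 st H; apply: (@cost_loop inp x c s (fun _ _ => True)) => // i t _ [fr _] _.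
split=> //; apply: cost_static => // y yl; rewrite fr; first exact: H.
by move/allP: st; apply.
Qed.

(** Here [W] is [2 ^ N], [g] the size of the grammar, [n] its number of cells from [R] on, and [k]
    is [N]; [k0] to [k5] are the costs of the phases. The main loop [k4] dominates, with [n * W]
    rounds of order [W ^ 3]. *)
Lemma cost_arith W g n k a1 a2 a3 a4 b1 b2 b3 b4 b5 b6 k0 k1 k2 k3 k4 k5 :
  0 < W -> 0 < g -> n <= 3 * g -> k <= W ->
  k0 <= (a1 + 8 + a2 + a3 + a4) * (W * W) ->
  k1 <= 4 + (3 + n * (b1 + 5)) -> k2 <= 8 + (3 + n * (b2 + 5)) ->
  k3 <= 18 + (3 + n * (b3 * W + 5)) ->
  k4 <= 4 + ((3 + k * (7 + 5)) + (3 + n * W * (b4 * W ^ 3 + 5))) ->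
  k5 <= b5 + (3 + (1 + 3 * (n * W)) * (b6 + 5)) ->
  k0 + (k1 + (k2 + (k3 + (k4 + k5)))) <=
  ((a1 + 8 + a2 + a3 + a4) + (7 + 3 * (b1 + 5)) + (11 + 3 * (b2 + 5))
   + (21 + 3 * (b3 + 5)) + (22 + 3 * (b4 + 5)) + (b5 + 3 + 10 * (b6 + 5)))
  * (W * W * W * W) * g.
Proof.
move=> W0 g0 ng kW.
set Z := W * W * W * W * g.
have WW : 0 < W * W by rewrite muln_gt0 W0.
have WWW : 0 < W * W * W by rewrite muln_gt0 WW.
have z1 : W * W <= Z.
  by rewrite /Z -!mulnA leq_mul2l leq_pmulr ?orbT // !muln_gt0 W0 g0.
have z2 : g <= Z by rewrite /Z leq_pmull // muln_gt0 WWW.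
have z3 : W * g <= Z by rewrite /Z leq_mul2r leq_pmull ?orbT.
have z4 : W <= Z by apply: leq_trans z1; rewrite leq_pmulr.
have z5 : 0 < Z by apply: leq_trans z2.
have nW : n * W <= 3 * (W * g) by rewrite (mulnC W) mulnA leq_mul2r ng orbT.
have nZ : n <= 3 * Z by apply: leq_trans ng _; rewrite leq_mul2l z2.
have nWZ : n * W <= 3 * Z by apply: leq_trans nW _; rewrite leq_mul2l z3.
have nW4 : n * W * W ^ 3 <= 3 * Z.
  apply: leq_trans (leq_mul nW (leqnn _)) _.
  by rewrite /Z !expnS expn0; apply/eq_leq; lia.
rewrite -(mulnA _ (W * W * W * W) g) -/Z; clearbody Z.
move: (W ^ 3) nW4 => V nW4 c0 c1 c2 c3 c4 c5.
have m0 : (a1 + 8 + a2 + a3 + a4) * (W * W) <= (a1 + 8 + a2 + a3 + a4) * Z.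
  by rewrite leq_mul2l z1 orbT.
have m1 : n * (b1 + 5) <= 3 * Z * (b1 + 5) by rewrite leq_mul2r nZ orbT.
have m2 : n * (b2 + 5) <= 3 * Z * (b2 + 5) by rewrite leq_mul2r nZ orbT.
have m3 : b3 * (n * W) <= b3 * (3 * Z) by rewrite leq_mul2l nWZ orbT.
have m4 : b4 * (n * W * V) <= b4 * (3 * Z) by rewrite leq_mul2l nW4 orbT.
have m5 : n * W * (b6 + 5) <= 3 * Z * (b6 + 5) by rewrite leq_mul2r nWZ orbT.
have m6 : b5 <= b5 * Z by rewrite leq_pmulr.
have m7 : b6 <= b6 * Z by rewrite leq_pmulr.
have d0 := leq_trans c0 m0.
have d1 : k1 <= (7 + 3 * (b1 + 5)) * Z by clear -c1 m1 z5; lia.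
have d2 : k2 <= (11 + 3 * (b2 + 5)) * Z by clear -c2 m2 z5; lia.
have d3 : k3 <= (21 + 3 * (b3 + 5)) * Z by clear -c3 m3 nZ z5; lia.
have d4 : k4 <= (22 + 3 * (b4 + 5)) * Z by clear -c4 m4 nWZ kW z4 z5; lia.
have d5 : k5 <= (b5 + 3 + 10 * (b6 + 5)) * Z by clear -c5 m5 m6 m7 z5; lia.
rewrite !mulnDl in d0 d1 d2 d3 d4 d5 *; clear -d0 d1 d2 d3 d4 d5; lia.
Qed.

(** The weights belong to fixed program texts, so this number is independent of the instance; its
    summands follow [cost_arith]. *)
Definition solver_const : nat :=
  (weight scan_init + 8 + weight scan_head + weight scan_tail + weight scan_final)
  + (7 + 3 * (weight ends_step + 5)) + (11 + 3 * (weight parents_step + 5))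
  + (21 + 3 * (weight atoms_step + 5)) + (22 + 3 * (weight main_step + 5))
  + (weight choose_output + 3 + 10 * (weight (copy_lanes ;; vx ::= $vx [+] EC 32 ;; incr vi) + 5)).

Lemma rtg_size_gt0 : 0 < rtg_size G.
Proof.
by rewrite /rtg_size ltn_addr //; apply/card_gt0P; exists (start_nonterm G).
Qed.

Lemma solver_cost : cost inp solver (start_state)
  <= solver_const * 2 ^ (4 * N) * rtg_size G.
Proof.
have [r _ [_ hOL _]] := solver_ok; rewrite solver_denE in hOL.
have [eL eR enc eS [eN eB _]] := scan_ok.
have c0 := scan_cost.
set s1 := scanned_state in eL eR enc eS eN eB.
have nc3 : L - R <= 3 * rtg_size G by rewrite leq_subLR size_inp_bound.
have W0 : 0 < 2 ^ N by rewrite expn_gt0.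
have NW : N <= 2 ^ N by exact/ltnW/ltn_expl.
set s2 := den ends s1; set s3 := den parents s2; set s4 := den atoms s3; set s5 := den main s4.
have c1 : cost inp ends s1 <= 4 + (3 + (L - R) * (weight ends_step + 5)).
  rewrite -[cost _ _ _]/(4 + cost inp (CLoop vnc ends_step) (den (vp ::= $vL) s1)).
  rewrite leq_add2l -enc -[weight ends_step]muln1; exact: (@cost_loop_static _ _ _ 1).
have c2 : cost inp parents s2 <= 8 + (3 + (L - R) * (weight parents_step + 5)).
  rewrite -[cost _ _ _]/(4 + (4 + cost inp (CLoop vnc parents_step) (den (vh ::= $vR) (den (vp ::= $vR) s2)))).
  have -> : L - R = var (den (vh ::= $vR) (den (vp ::= $vR) s2)) vnc by rewrite -enc /s2; frame.
  rewrite addnA leq_add2l -[weight parents_step]muln1; exact: (@cost_loop_static _ _ _ 1).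
have c3 : cost inp atoms s3 <= 18 + (3 + (L - R) * (weight atoms_step * 2 ^ N + 5)).
  set t := den (vp ::= $vR) (den (von ::= EC 1) (den (aOut@[EC 0] ::= EC 1) s3)).
  rewrite -[cost _ _ _]/(11 + (3 + (4 + cost inp (CLoop vnc atoms_step) t))).
  have -> : L - R = var t vnc by rewrite -enc /t; frame; rewrite /s3 /s2; frame.
  rewrite !addnA -[11 + 3 + 4]/18 -addnA leq_add2l.
  apply: (@cost_loop_static _ _ _ (2 ^ N)) => // y.
  have -> : loopv atoms_step = [:: vN; vN] by [].
  by rewrite !inE orbb => /eqP->; rewrite /t; frame; rewrite /s3 /s2; frame; rewrite eN.
have c4 : cost inp main s4 <= 4 + ((3 + N * (7 + 5)) + (3 + (L - R) * 2 ^ N * (weight main_step * (2 ^ N) ^ 3 + 5))).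
  set t := den (vT ::= $vnc) s4; set t' := den (CLoop vN (vT ::= $vT [+] $vT)) t.
  rewrite -[cost _ _ _]/(4 + (cost inp (CLoop vN (vT ::= $vT [+] $vT)) t + cost inp (CLoop vT main_step) t')).
  rewrite leq_add2l.
  have eNt : var t vN = N by rewrite /t; frame; rewrite /s4 /s3 /s2; frame.
  apply: leq_add; first by rewrite -eNt; exact: (@cost_loop_static _ (vT ::= $vT [+] $vT) _ 1).
  have <- : var t' vT = (L - R) * 2 ^ N.
    by rewrite /t' double_loop eNt; congr (_ * _); rewrite /t; ev; rewrite /s4 /s3 /s2; frame.
  (* [main_step] nests three loops: over the sets of the sibling, over the nodes, and over the
     candidate successors of a node. *)
  apply: (@cost_loop_static _ _ _ (2 ^ N)) => // y yl.
  have : all (fun y => (y == vN) || (y == vB)) (loopv main_step) by [].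
  move=> /allP/(_ _ yl)/orP[]/eqP->; rewrite /t'; frame; rewrite /t; frame; rewrite /s4 /s3 /s2; frame.
    by rewrite eN.
  by rewrite eB.
have c5 : cost inp finish s5 <= weight choose_output +
    (3 + (1 + 3 * ((L - R) * 2 ^ N)) * (weight (copy_lanes ;; vx ::= $vx [+] EC 32 ;; incr vi) + 5)).
  set body := (copy_lanes ;; vx ::= $vx [+] EC 32 ;; incr vi).
  rewrite -[cost _ _ _]/(cost inp choose_output s5 + cost inp (CLoop vOL body) (den choose_output s5)).
  apply: leq_add.
    by have := @cost_static inp choose_output s5 1 isT isT; rewrite exp1n muln1; apply.
  have hO : var (den choose_output s5) vOL <= 1 + 3 * ((L - R) * 2 ^ N).
    by move: hOL; rewrite /finish denS var_frame.
  apply: leq_trans (@cost_loop_static vOL body (den choose_output s5) 1 isT isT _) _.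
    by have -> : loopv body = [::] by [].
  by rewrite exp1n muln1 leq_add2l leq_mul2r hO orbT.
rewrite {1}/solver cost_seq8 -/scan -/s1 -/s2 -/s3 -/s4 -/s5.
have -> : 2 ^ (4 * N) = 2 ^ N * 2 ^ N * 2 ^ N * 2 ^ N by rewrite -!expnD; congr (2 ^ _); lia.
rewrite /solver_const.
move: (weight scan_init) (weight scan_head) (weight scan_tail) (weight scan_final)
  (weight ends_step) (weight parents_step) (weight atoms_step) (weight main_step)
  (weight choose_output) (weight (copy_lanes ;; _)) c0 c1 c2 c3 c4 c5.
move=> a1 a2 a3 a4 b1 b2 b3 b4 b5 b6.
move: (cost inp scan _) (cost inp ends _) (cost inp parents _) (cost inp atoms _)
  (cost inp main _) (cost inp finish _) => k0 k1 k2 k3 k4 k5 c0 c1 c2 c3 c4 c5.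
exact: (cost_arith W0 rtg_size_gt0 nc3 NW c0 c1 c2 c3 c4 c5).
Qed.

End Solver.

Lemma horner_nat4 (x : nat) : (('X + 'X + 'X + 'X : {poly nat}).[x])%R = 4 * x.
Proof. rewrite !hornerD hornerX -[LHS]/(x + x + x + x); lia. Qed.

Theorem theorem4p5 :
  exists (prog : seq instr) (p : {poly nat}) (c : nat),
  forall (Sigma : finType) (Pos Neg : seq (kripke Sigma)) (G : rtg Sigma),
    let m := size Pos + size Neg in
    let n := \max_(K <- Pos ++ Neg) ksize K in
    exists2 r : answer Sigma,
      correct_answer Pos Neg G r
      & outputs_within prog (enc_instance Pos Neg G) (enc_answer r)
          (c * 2 ^ p.[(m * n)%N]%R * rtg_size G).
Proof.
(* The polynomial is 4 X because the cost carries the exponent 4 N, and N is at most [m * n]. *)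
exists (comp solver 0 temp), ('X + 'X + 'X + 'X)%R, solver_const.
move=> Sigma Pos Neg G m n; rewrite horner_nat4.
have [r cr [hO _ hc]] := solver_ok Pos Neg G; exists r => //.
have [cf [run hlt [s0 sr sm]]] := comp_halts (enc_instance Pos Neg G) solver_wf.
exists (cost (enc_instance Pos Neg G) solver (start_state Pos Neg G)); rewrite run; split=> //.
  apply: leq_trans (solver_cost Pos Neg G) _.
  by rewrite leq_mul2r leq_mul2l leq_pexp2l ?orbT // leq_mul2l nodes_le orbT.
apply: (@eq_from_nth _ 0); rewrite /output size_mkseq sr // hO // => i il.
by rewrite nth_mkseq // sm sr // s0 hc.
Qed.
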